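(* Let $S:\mathbb{T}^1\to\mathbb{T}^1$, $g:\mathbb{T}^1\to(0,\infty)$, $h:[0,a]\to[0,\infty)$ satisfy the standing assumptions (H1), (H2), (H3) listed in the context, let $\varphi_\infty:\mathbb{T}^1\to[0,a]$ be the associated invariant graph, let $m$ be Lebesgue measure on $\mathbb{T}^1$, and let $s_*>0$ be the unique positive zero of the pressure function $\psi$. Then $$\lim_{x\to\infty}\frac1x\log m\{v\in\mathbb{T}^1:\log\varphi_\infty(v)<-x\}=-s_*,$$ equivalently $$\lim_{\epsilon\to0^+}\frac{\log m\{v\in\mathbb{T}^1:\varphi_\infty(v)<\epsilon\}}{\log\epsilon}=s_*.$$
   Context: Conventions: $\mathbb{T}^1=\mathbb{R}/\mathbb{Z}$, $m$ is Lebesgue measure on $\mathbb{T}^1$, $|U|$ is the length of an interval $U$; $C^{1+}$ means $C^1$ with Hölder continuous derivative (unspecified exponent); $\log 0=-\infty$. Fibre function: $a>0$, $I=[0,a]$, $h:I\to[0,\infty)$ is strictly increasing, concave, $C^{1+}$, with $h(0)=0$, $h'(0)=1$. The function $g:\mathbb{T}^1\to(0,\infty)$ is measurable and $g(v)h(a)\le a$ for all $v$, so that $x\mapsto g(v)h(x)$ maps $I$ into $I$. (H1) $S:\mathbb{T}^1\to\mathbb{T}^1$ is a piecewise expanding, piecewise $C^{1+}$, mixing Markov map with finitely many branches: there is a finite partition of $\mathbb{T}^1$ into intervals (the monotonicity intervals) on each of which $S$ is a $C^{1+}$ diffeomorphism onto its image (up to the endpoints), each image is a union of partition intervals (up to endpoints),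 the resulting Markov chain is mixing, and there are $c>0,\lambda>1$ with $|(S^n)'|\ge c\lambda^n$ for all $n\ge1$. $\mu_{\rm ac}$ denotes the unique $S$-invariant probability measure absolutely continuous with respect to $m$. (H2) Put $g_n=\prod_{i=1}^n g\circ S^i$. For $v\in\mathbb{T}^1$ let $\mathcal{U}_n(v)$ be the family of all interval neighbourhoods $U$ of $v$ such that $S^n|_U:U\to S^nU$ is a diffeomorphism. There is $D>0$ such that for all $n\ge1$, $v\in\mathbb{T}^1$, $U\in\mathcal{U}_n(v)$, $\tilde v\in U$: $D^{-1}\le g_n(\tilde v)/g_n(v)\le D$. (H3) There is an $S$-invariant probability measure $\mu_-$ with $\int\log g\,d\mu_-<0<\int\log g\,d\mu_{\rm ac}$. Invariant graph: for $v\in\mathbb{T}^1$ let $f_{0,v}=\mathrm{id}_I$, $f_{1,v}(x)=g(Sv)h(x)$ and $f_{n,v}(x)=f_{1,v}(f_{n-1,Sv}(x))$. Put $\varphi_n(v)=f_{n,v}(a)$, which is non-increasing in $n$, and $\varphi_\infty(v)=\lim_{n\to\infty}\varphi_n(v)$. (If $\hat S:\Theta\to\Theta$ is a bimeasurable bijection and $\Pi:\Theta\to\mathbb{T}^1$ is measurable with $S\circ\Pi=\Pi\circ\hat S^{-1}$, then $\varphi_\infty\circ\Pi$ is the maximal invariant graph of the skew product $(\theta,x)\mapsto(\hat S\theta,g(\Pi\theta)h(x))$.) Pressure: for $s\in\mathbb{R}$, $\psi(s)$ is the topological pressure of the potential $-\log|S'|-s\log g$ for (the topological Markov chain coding) $S$,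 i.e. $$\psi(s)=\lim_{n\to\infty}\frac1n\log\sum_{Z}\sup_{v\in Z}\frac{\prod_{i=0}^{n-1}g(S^iv)^{-s}}{|(S^n)'(v)|},$$ the sum running over all non-empty open $n$-cylinders $Z$, i.e. sets $\bigcap_{i=0}^{n-1}S^{-i}J_{k_i}^{\circ}$ with $J_{k}$ the monotonicity intervals. It is convex with $\psi(0)=0$, $\psi'(0)=-\int\log g\,d\mu_{\rm ac}<0$, $\psi(s)\to\infty$ as $s\to\infty$, and $s_*$ denotes its unique zero in $(0,\infty)$. *)

(* Defs.v *)
From HB Require Import structures.
From mathcomp Require Import all_boot all_order all_algebra.
From mathcomp Require Import all_classical all_reals all_analysis.
Set Implicit Arguments.
Unset Strict Implicit.
Unset Printing Implicit Defensive.
Import Order.TTheory GRing.Theory Num.Theory.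
Import numFieldNormedType.Exports.
Local Open Scope classical_set_scope.
Local Open Scope ring_scope.

(* A point of the circle R/Z is represented by its representative in [0, 1[.
   Self-maps of the circle and functions on it are functions R -> R that are
   only ever evaluated at such representatives; circ is the projection
   R -> R/Z. *)
Definition circle (R : realType) : set R := [set` `[0, 1[].
Arguments circle : clear implicits.

Definition circ (R : realType) (t : R) : R := t - (Num.floor t)%:~R.
Arguments circ {R} t.

(* the representative of the class x - y in [-1/2, 1/2[ *)
Definition cdiff (R : realType) (x y : R) : R := circ (x - y + 2^-1) - 2^-1.

(* Derivative of T : R/Z -> R/Z at v: near v, T is lifted to R by
   u |-> T v + cdiff (T u) (T v). *)
Definition cderiv (R : realType) (T : R -> R) (v : R) : R :=
  derive1 (fun u : R => cdiff (T (circ u)) (T v)) v.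

(* F' is the derivative of F on A, one-sided at the endpoints belonging to A *)
Definition deriv_within (R : realType) (A : set R) (F F' : R -> R) : Prop :=
  forall x, A x -> (F y - F x) / (y - x) @[y --> within A x^'] --> F' x.

Definition hoelder_on (R : realType) (A : set R) (f : R -> R) : Prop :=
  exists alpha C : R, [/\ 0 < alpha, alpha <= 1 &
    forall x y, A x -> A y -> `|f x - f y| <= C * `|x - y| `^ alpha].

(* I lies in a chart ]p, p + 1[ of R/Z, so that circ identifies it with a
   proper arc *)
Definition in_chart (R : realType) (I : set R) : Prop :=
  exists p : R, I `<=` `]p, (p + 1)[.

(* For an interval I lying in a chart, T restricted to the arc circ @` I is a
   C^1 diffeomorphism onto its image, itself a proper arc; F is the expression
   of T in charts and F' its derivative. *)
Definition diffeo_lift (R : realType) (T : R -> R) (I : set R) (F F' : R -> R)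
    : Prop :=
  [/\ forall t, I t -> T (circ t) = circ (F t),
      deriv_within I F F',
      {within I, continuous F'},
      forall t, I t -> F' t != 0
    & in_chart (F @` I)].

Definition diffeo_on (R : realType) (T : R -> R) (I : set R) : Prop :=
  exists F F', diffeo_lift T I F F'.

(* The arcs U need not be open, but v lies in their interior. *)
Definition diffeo_nbhds (R : realType) (S : R -> R) (n : nat) (v : R)
    : set (set R) :=
  [set U | exists I : set R,
     [/\ is_interval I, in_chart I, U = circ @` I,
         exists2 t, interior I t & circ t = v
       & diffeo_on (iter n S) I]].

(* The partition is given by points p 0 < ... < p N.+1 = p 0 + 1 of R; the
   open monotonicity intervals are the projections of the ]p k, p k.+1[. *)
Definition mono_int (R : realType) (p : nat -> R) (k : nat) : set R :=
  circ @` `]p k, p k.+1[.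

Definition endpoints (R : realType) (N : nat) (p : nat -> R) : set R :=
  [set v | exists2 k, (k <= N)%N & v = circ (p k)].

Definition trans_mx (R : realType) (S : R -> R) (N : nat) (p : nat -> R)
    : 'M[R]_N.+1 :=
  \matrix_(k, l) (`[< mono_int p l `<=` S @` mono_int p k >] : nat)%:R.

(* For v in a cylinder the whole orbit segment avoids the partition points, so
   (S^n)'(v) exists. *)
Definition cylinder (R : realType) (S : R -> R) (N : nat) (p : nat -> R)
    (n : nat) (w : n.-tuple 'I_N.+1) : set R :=
  [set v | circle R v /\
           forall i : 'I_n, mono_int p (tnth w i) (iter i S v)].

(* No condition is imposed on the values of S at the finitely many
   partition points, except that they lie in R/Z. The Hoelder bound on the open
   interval makes each branch C^{1+} up to the endpoints. *)
Definition expanding_markov (R : realType) (S : R -> R) (N : nat)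
    (p : nat -> R) : Prop :=
  [/\ forall v, circle R v -> circle R (S v),
      (forall k, (k <= N)%N -> p k < p k.+1) /\ p N.+1 = p 0%N + 1,
      forall k : 'I_N.+1, exists F F',
        diffeo_lift S `]p k, p k.+1[ F F' /\ hoelder_on `]p k, p k.+1[ F',
      (forall k : 'I_N.+1, exists A : {set 'I_N.+1},
         S @` mono_int p k `\` endpoints N p =
         \bigcup_(l in [set` A]) mono_int p l) /\
      (forall k l : 'I_N.+1, exists n0, forall n, (n0 <= n)%N ->
         0 < (trans_mx S N p ^+ n) k l)
    & exists c lambda : R, [/\ 0 < c, 1 < lambda &
        forall n (w : n.-tuple 'I_N.+1) v, (1 <= n)%N -> cylinder S p w v ->
          c * lambda ^+ n <= `|cderiv (iter n S) v| ]].

Definition concave_on (R : realType) (A : set R) (h : R -> R) : Prop :=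
  convex_function (A : set (convex_lmodType R^o)) (fun x : R => - h x).

Definition fibre_map (R : realType) (a : R) (h : R -> R) : Prop :=
  [/\ {in `[0, a] &, {homo h : x y / x < y}},
      concave_on `[0, a] h,
      forall x, x \in `[0, a] -> 0 <= h x,
      h 0 = 0
    & exists h', [/\ deriv_within `[0, a] h h', hoelder_on `[0, a] h' &
                     h' 0 = 1]].

Definition multiplier (R : realType) (a : R) (h g : R -> R) : Prop :=
  measurable_fun (circle R : set (measurableTypeR R))
    (g : measurableTypeR R -> measurableTypeR R) /\
  (forall v, circle R v -> 0 < g v /\ g v * h a <= a).

Definition gprod (R : realType) (S g : R -> R) (n : nat) (v : R) : R :=
  \prod_(1 <= i < n.+1) g (iter i S v).

Definition bounded_distortion (R : realType) (S g : R -> R) : Prop :=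
  exists2 D : R, 0 < D & forall n v (U : set R) v', (1 <= n)%N ->
    circle R v -> diffeo_nbhds S n v U -> U v' ->
    D^-1 <= gprod S g n v' / gprod S g n v <= D.

(* A Borel probability measure on R/Z is one on R carried by [0, 1[. *)
Definition invariant_prob (R : realType) (S : R -> R)
    (mu : probability (measurableTypeR R) R) : Prop :=
  mu (circle R) = 1%E /\
  forall A : set (measurableTypeR R), measurable A ->
    mu (circle R `&` S @^-1` A) = mu A.

Definition log_integral (R : realType) (g : R -> R)
    (mu : probability (measurableTypeR R) R) : \bar R :=
  (\int[mu]_(v in circle R) (ln (g v))%:E)%E.

Definition lyapunov_gap (R : realType) (S g : R -> R)
    (mu_ac : probability (measurableTypeR R) R) : Prop :=
  (exists mu, invariant_prob S mu /\ (log_integral g mu < 0)%E) /\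
  (0 < log_integral g mu_ac)%E.

Fixpoint fiter (R : realType) (h S g : R -> R) (n : nat) (v x : R) : R :=
  if n is n'.+1 then g (S v) * h (fiter h S g n' (S v) x) else x.

Definition phi_inf (R : realType) (a : R) (h S g : R -> R) (v : R) : R :=
  limn (fun n => fiter h S g n v a).

Definition pressure_sum (R : realType) (S g : R -> R) (N : nat) (p : nat -> R)
    (s : R) (n : nat) : \bar R :=
  (\sum_(w : n.-tuple 'I_N.+1 | cylinder S p w != set0)
     ereal_sup [set ((\prod_(i < n) g (iter i S v) `^ (- s))
                     / `|cderiv (iter n S) v|)%R%:E
               | v in cylinder S p w])%E.

Definition pressure (R : realType) (S g : R -> R) (N : nat) (p : nat -> R)
    (s : R) : \bar R :=
  limn (fun n => (n%:R^-1)%:E * lne (pressure_sum S g N p s n))%E.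

(* Main.v *)
(* Let [g_n = prod_(1 <= i <= n) g o S^i]. As [h(x) <= x] and [h(x) >= e^(-eta)
   min(x, r)] for small [r], the graph is squeezed between [inf_j e^(-eta j)
   g_j] and [inf_j g_j] up to constants, so the theorem is a statement on the
   tails of [inf_j g_j]. By bounded distortion everything happens on cylinders:
   for words [w], the masses [m w] of the cylinders are quasi-Bernoulli, [L w =
   log g_n] is almost additive, and the pressure is the growth rate of [Q_n(s)
   = sum_(|w| = n) m w e^(-s L w)]. Hence [Q_n(s0)], with [s0] the zero of the
   pressure, is bounded from above and below.

   The positive exponent of [mu_ac] gives, at every stage and with a
   conditional probability bounded from below, an arbitrarily large climb of
   [L], which Chebyshev's inequality at [s0] makes permanent. Therefore [L ->
   +oo] in probability, so [Q_n(s)] decays exponentially for [s < s0] (whence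
   the upper bound, by a union bound) and is unbounded for [s > s0]. In the
   latter case some deviation [L_n < -k] has probability at least [e^(-sk)],
   and concatenating copies of it yields the lower bound at all scales. *)
Require Import Defs.
From HB Require Import structures.
From mathcomp Require Import all_boot all_order all_algebra.
From mathcomp Require Import all_classical all_reals all_analysis.
From mathcomp Require Import measurable_realfun.
From mathcomp Require Import ring lra.
Import Order.TTheory GRing.Theory Num.Theory.
Import numFieldNormedType.Exports.
Local Open Scope classical_set_scope.
Local Open Scope ring_scope.

(** Every estimate holds only up to constants: a concatenation costs a factor [K] in mass and an
    error [c] in [L]. Cutting a word is always possible, but [u ++ w] may be inadmissible, so lower
    estimates insert a connecting word whose length is fixed once and for all by mixing. With both
    directions available, [ln Q_n(s)] is additive up to a bounded error. A vanishing growth rate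
    therefore bounds [ln Q_n(s0)] uniformly in [n], which is more than subexponential growth. This
    uniformity makes Chebyshev's inequality at [s0] effective at all times with the same constant,
    and hence a climb permanent. In the lower bound the deviation to be repeated is chosen at a
    large depth [k], so that the losses [ln K] and [c] per copy are small compared with [k]. In the
    upper bound the union runs over all times [j], and the loss [e^(-eta j)] in the squeezing of the
    graph costs [e^(r eta j)] in Chebyshev's inequality at [r < s0]. The exponential decay of
    [Q_j(r)] pays for it once [eta] is small. *)

Lemma sum_tuple_cat (V : nmodType) (T : finType) (n k : nat) (f : seq T -> V) :
  \sum_(v : (n + k).-tuple T) f v =
  \sum_(u : n.-tuple T) \sum_(w : k.-tuple T) f (u ++ w).
Proof.
rewrite pair_big /=.
rewrite (reindex (fun q : n.-tuple T * k.-tuple T => [tuple of q.1 ++ q.2])) //=.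
exists (fun v : (n + k).-tuple T => (tcast (minn_idPl (leq_addr k n)) (take_tuple n v),
  tcast (addKn n k : (n + k - n = k)%N) (drop_tuple n v))) => /=.
  move=> [u w] _ /=; congr pair; apply/val_inj.
    by rewrite [LHS]val_tcast /= take_size_cat ?size_tuple.
  by rewrite [LHS]val_tcast /= drop_size_cat ?size_tuple.
by move=> v _; apply/val_inj; rewrite /= !val_tcast /= cat_take_drop.
Qed.

Lemma sum_tuple0 (V : nmodType) (T : finType) (f : seq T -> V) :
  \sum_(v : 0.-tuple T) f v = f [::].
Proof.
rewrite (big_pred1 [tuple]) // => v /=; apply/esym/eqP.
by apply/val_inj; case: v => [[]].
Qed.

Lemma expRN_small (R : realType) (a x : R) : 0 < a -> 0 < x ->
  exists2 y : R, 0 < y & forall z, y <= z -> expR (- (a * z)) <= x.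
Proof.
move=> a0 x0; exists (Num.max 1 (- ln x) / a) => [|z].
  by rewrite divr_gt0// lt_max ltr01.
rewrite ler_pdivrMr// ge_max => /andP[_ xz].
by rewrite -[leRHS]lnK ?posrE// ler_expR; lra.
Qed.

(** * Quasi-Bernoulli weights on words *)

Section Words.
Context {R : realType} {T : finType} {m L : seq T -> R} {K c : R} {k0 : nat}.

(** The partition function [Q_n(s)] of the overview. *)
Definition psum (n : nat) (s : R) : R :=
  \sum_(w : n.-tuple T) m w * expR (- (s * L w)).

(** [qb_L_cat] is restricted to positive mass because [L] is a junk value on empty cylinders.
    [qb_join] stands in for a lower bound on [m (u ++ w)], which fails when [u ++ w] is
    inadmissible; the connecting word depends on [u] and [w], its length [k0] does not. *)
Record quasi_bernoulli : Prop := QuasiBernoulli {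
  qb_c : 0 <= c;
  qb_K : 1 <= K;
  qb_m_ge0 : forall w, 0 <= m w;
  qb_m_nil : m [::] = 1;
  qb_L_nil : L [::] = 0;
  qb_m_sum : forall u n, \sum_(w : n.-tuple T) m (u ++ w) = m u;
  qb_m_cat : forall u w, m (u ++ w) <= K * (m u * m w);
  qb_L_cat : forall u w, 0 < m (u ++ w) -> `|L (u ++ w) - (L u + L w)| <= c;
  qb_join : forall u w, 0 < m u -> 0 < m w -> exists z : k0.-tuple T,
      m u * m w <= K * m (u ++ z ++ w) /\
      `|L (u ++ z ++ w) - (L u + L w)| <= c }.

Hypothesis qb : quasi_bernoulli.

Let K0 : 0 < K. Proof. exact: lt_le_trans ltr01 (qb_K qb). Qed.
Let c0 := qb_c qb.
Let m0 := qb_m_ge0 qb.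

Lemma m_cat_gt0 u w : 0 < m (u ++ w) -> 0 < m u /\ 0 < m w.
Proof.
move=> h; have := lt_le_trans h (qb_m_cat qb u w).
rewrite pmulr_rgt0// => uw; split; rewrite lt0r m0 andbT; apply/eqP => e;
 by move: uw; rewrite e ?mul0r ?mulr0 ltxx.
Qed.

Lemma psum_ge0 n s : 0 <= psum n s.
Proof. by apply: sumr_ge0 => w _; rewrite mulr_ge0 ?expR_ge0. Qed.

Lemma psum0 s : psum 0 s = 1.
Proof.
by rewrite /psum (sum_tuple0 _ _ (fun w => m w * expR (- (s * L w)))) (qb_m_nil qb) (qb_L_nil qb) mulr0 oppr0 expR0 mulr1.
Qed.

Lemma mass_total n : \sum_(w : n.-tuple T) m w = 1.
Proof. by rewrite -(qb_m_nil qb) -(qb_m_sum qb [::] n). Qed.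

Lemma mass_le (P : pred (seq T)) u n :
  \sum_(w : n.-tuple T | P w) m (u ++ w) <= m u.
Proof.
rewrite -(qb_m_sum qb u n) big_mkcond/=; apply: ler_sum => w _.
by case: ifP => // _; exact: m0.
Qed.

Lemma L_lower n : exists2 b, 0 <= b & forall w : n.-tuple T, - b <= L w.
Proof.
exists (\sum_(w : n.-tuple T) `|L w|); first exact: sumr_ge0.
move=> w; rewrite (bigD1 w)//=; have := ler_norm (- L w); rewrite normrN.
have : 0 <= \sum_(i : n.-tuple T | i != w) `|L i| by exact: sumr_ge0.
by lra.
Qed.

Lemma psum_cat_le n k s : 0 <= s ->
  psum (n + k) s <= K * expR (s * c) * (psum n s * psum k s).
Proof.
move=> s0.
rewrite /psum (sum_tuple_cat _ _ _ _ (fun w => m w * expR (- (s * L w)))).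
rewrite mulr_suml mulr_sumr; apply: ler_sum => u _.
rewrite mulr_sumr mulr_sumr; apply: ler_sum => w _.
(* Nothing is known about [L] on words of mass 0, but these contribute 0 to the left-hand side. *)
have [uw|] := ltP 0 (m (u ++ w)); last first.
  move=> h; have -> : m (u ++ w) = 0 by apply/eqP; rewrite eq_le h m0.
  by rewrite mul0r !mulr_ge0 ?expR_ge0 ?m0// ltW.
have -> : K * expR (s * c) * (m u * expR (- (s * L u)) * (m w * expR (- (s * L w))))
  = (K * (m u * m w)) * expR (s * c - s * L u - s * L w).
  by rewrite !expRD; ring.
apply: ler_pM; rewrite ?m0 ?expR_ge0 ?(qb_m_cat qb)//.
rewrite ler_expR; have := qb_L_cat qb _ _ uw; rewrite ler_norml => /andP[h _].
have := ler_wpM2l s0 h; lra.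
Qed.

(** Among the words [u ++ z ++ w] only the one with the connecting [z] is kept; the remaining terms
    are nonnegative. *)
Lemma psum_join_ge n k s : 0 <= s ->
  psum n s * psum k s <= K * expR (s * c) * psum (n + (k0 + k)) s.
Proof.
move=> s0; pose f w := m w * expR (- (s * L w)).
have f0 w : 0 <= f w by rewrite mulr_ge0 ?m0 ?expR_ge0.
rewrite /psum (sum_tuple_cat _ _ _ _ f).
rewrite mulr_suml mulr_sumr; apply: ler_sum => u _.
rewrite mulr_sumr (sum_tuple_cat _ _ _ _ (fun w => f (u ++ w))) exchange_big.
rewrite mulr_sumr; apply: ler_sum => w _.
have [mu|] := ltP 0 (m u); last first.
  move=> h; have -> : m u = 0 by apply/eqP; rewrite eq_le h m0.
  by rewrite !mul0r !mulr_ge0 ?expR_ge0 ?sumr_ge0 ?ltW.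
have [mw|] := ltP 0 (m w); last first.
  move=> h; have -> : m w = 0 by apply/eqP; rewrite eq_le h m0.
  by rewrite !(mul0r,mulr0) !mulr_ge0 ?expR_ge0 ?sumr_ge0 ?ltW.
have [z [h1 h2]] := qb_join qb u w mu mw.
apply: (@le_trans _ _ (K * expR (s * c) * f (u ++ z ++ w))); last first.
  apply: ler_wpM2l; first by rewrite mulr_ge0 ?expR_ge0 ?ltW.
  by rewrite (bigD1 z)//= lerDl sumr_ge0.
have -> : K * expR (s * c) * f (u ++ z ++ w)
  = (K * m (u ++ z ++ w)) * expR (s * c - s * L (u ++ z ++ w)).
  by rewrite /f expRD; ring.
have -> : m u * expR (- (s * L u)) * (m w * expR (- (s * L w))) =
  m u * m w * expR (- (s * L u) - s * L w) by rewrite expRD; ring.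
apply: ler_pM; rewrite ?mulr_ge0 ?m0 ?expR_ge0 //.
rewrite ler_expR; move: h2; rewrite ler_norml => /andP[_ h].
have := ler_wpM2l s0 h; lra.
Qed.

Lemma psum_gt0 n s : 0 < psum n s.
Proof.
have [w mw] : exists w : n.-tuple T, 0 < m w.
  apply/not_existsP => h; have := qb_m_sum qb [::] n; rewrite (qb_m_nil qb)/=.
  rewrite big1; first by move/eqP; rewrite eq_sym oner_eq0.
  by move=> w _; apply/eqP; rewrite eq_le m0 andbT leNgt; apply/negP/h.
rewrite /psum (bigD1 w)//=; apply: ltr_pwDl; first by rewrite mulr_gt0 ?expR_gt0.
by apply: sumr_ge0 => v _; rewrite mulr_ge0 ?expR_ge0.
Qed.

Lemma psum_quasi_additive s : 0 <= s -> exists C, forall n k,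
  `|ln (psum (n + k) s) - (ln (psum n s) + ln (psum k s))| <= C.
Proof.
move=> s0; pose A := K * expR (s * c).
have A0 : 0 < A by rewrite mulr_gt0 ?expR_gt0.
pose C1 := `|ln A|; pose C2 := `|ln (psum k0 s)|.
exists (C1 *+ 2 + C2) => n k.
have C10 : ln A <= C1 by exact: ler_norm.
have C20 : ln (psum k0 s) <= C2 by exact: ler_norm.
have p n' := psum_gt0 n' s.
have C30 : 0 <= C1 := normr_ge0 _.
have C40 : 0 <= C2 := normr_ge0 _.
have h1 a b : ln (psum (a + b) s) <= ln A + (ln (psum a s) + ln (psum b s)).
  rewrite -!lnM ?posrE ?mulr_gt0 ?expR_gt0//.
  by rewrite ler_ln ?posrE ?mulr_gt0 ?expR_gt0// psum_cat_le.
have h2 : ln (psum n s) + ln (psum k s) <= ln A + ln (psum (n + (k0 + k)) s).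
  rewrite -!lnM ?posrE ?mulr_gt0 ?expR_gt0//.
  by rewrite ler_ln ?posrE ?mulr_gt0 ?expR_gt0// psum_join_ge.
rewrite ler_norml; apply/andP; split; last by have := h1 n k; lra.
(* The connecting letters are stripped again by submultiplicativity: [n + (k0 + k)] is read as
   [k0 + (n + k)], at the cost of the constant [psum k0 s]. *)
have := h1 k0 (n + k)%N; rewrite addnCA in h2; lra.
Qed.

(** Established in [mass_drift] from the positive exponent of [mu_ac]. The probability [d] is the
    same for all heights [H]; only the time depends on [H]. *)
Hypothesis drift : exists2 d : R, 0 < d & forall H, exists n,
  d <= \sum_(w : n.-tuple T | H <= L w) m w.

(** A climbing word is attached to the past [u] by a connecting word, which costs the factor [K].
    The climb is taken to [H + c + c] since [L] is decomposed twice: in the join, and to split off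
    [u] again. *)
Lemma drift_conditional : exists2 d : R, 0 < d & forall H, exists n, forall u,
  d * m u <= \sum_(w : n.-tuple T | H <= L w) m (u ++ w).
Proof.
have [d d0 hd] := drift; exists (d / K) => [|H]; first exact: divr_gt0.
have [n hn] := hd (H + c + c); exists (k0 + n)%N => u.
have [mu|] := ltP 0 (m u); last first.
  move=> h; have -> : m u = 0 by apply/eqP; rewrite eq_le h m0.
  by rewrite mulr0; apply: sumr_ge0 => w _; exact: m0.
rewrite big_mkcond /= (sum_tuple_cat _ _ _ _ (fun w => if H <= L w then m (u ++ w) else 0)).
rewrite exchange_big/= mulrAC ler_pdivrMr//.
apply: (le_trans (ler_wpM2r (m0 u) hn)).
rewrite mulr_suml mulr_suml big_mkcond/=; apply: ler_sum => w _.
case: ifPn => Hw; last first.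
  rewrite mulr_ge0 ?(ltW K0)// sumr_ge0// => z _; by case: ifP.
have [mw|] := ltP 0 (m w); last first.
  move=> h; have -> : m w = 0 by apply/eqP; rewrite eq_le h m0.
  rewrite mul0r mulr_ge0 ?(ltW K0)// sumr_ge0// => z _; by case: ifP.
have [z [h1 h2]] := qb_join qb u w mu mw.
rewrite mulrC (le_trans h1)// mulrC; apply: ler_wpM2r; first exact: ltW.
have uzw : 0 < m (u ++ z ++ w).
  by rewrite -(pmulr_rgt0 _ K0) (lt_le_trans _ h1)// mulr_gt0.
rewrite (bigD1 z)//= ifT; last first.
  have := qb_L_cat qb _ _ uzw; move: h2.
  rewrite !ler_norml => /andP[h2 h3] /andP[h4 h5]; lra.
by rewrite lerDl sumr_ge0// => ? _; case: ifP.
Qed.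

Variable s : R.
Hypotheses (s_gt0 : 0 < s) (psum_bounded : exists C, forall n, `|ln (psum n s)| <= C).

Lemma psum_s_bounds : exists C1 C2, [/\ 0 < C1, 0 < C2 & forall n, C1 <= psum n s <= C2].
Proof.
have [C hC] := psum_bounded; exists (expR (- C)), (expR C).
split; rewrite ?expR_gt0// => n; have := hC n.
by rewrite ler_norml -(ler_expR _ C) -(ler_expR (- C)) lnK// posrE psum_gt0.
Qed.

(* Whatever the past, [L] has climbed above any given level at some time, except
   with conditional probability [theta]. *)
Let low (theta : R) := forall x, exists n, forall u,
  \sum_(w : n.-tuple T | L w <= x) m (u ++ w) <= theta * m u.

(** With conditional probability at least [d] the first [n1] letters climb so high that coming back
    below [x] afterwards has probability at most [d / 2 * theta]. In the other case the hypothesis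
    [low theta] still bounds the probability by [theta]. *)
Lemma low_step (d theta : R) : 0 < d <= 1 -> 0 < theta ->
  (forall H, exists n, forall u,
    d * m u <= \sum_(w : n.-tuple T | H <= L w) m (u ++ w)) ->
  low theta -> low ((1 - d / 2) * theta).
Proof.
move=> /andP[d0 d1] th0 hd lth x.
have [C1 [C2 [C10 C20 hC]]] := psum_s_bounds.
have dth : 0 < d / 2 * theta by rewrite mulr_gt0 ?divr_gt0.
have [y y0 hy] := @expRN_small R s (d / 2 * theta / (K * C2)) s_gt0 (divr_gt0 dth (mulr_gt0 K0 C20)).
have [n1 hn1] := hd (x + c + y).
have [b b0 hb] := L_lower n1.
(* The first [n1] letters lose at most [b], so raising the level by [b] (and [c]) makes the
   hypothesis applicable after any of them. *)
have [n2 hn2] := lth (x + c + b).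
exists (n1 + n2)%N => v.
rewrite big_mkcond/= (sum_tuple_cat _ _ _ _ (fun w => if L w <= x then m (v ++ w) else 0)).
pose good (u : n1.-tuple T) := x + c + y <= L u.
(* Chebyshev's inequality at [s]: a fall by [y] is unlikely after any past and over any time,
   because [psum n s <= C2] for all [n]. *)
have cheb n u : \sum_(w : n.-tuple T | L w <= - y) m (u ++ w) <= d / 2 * theta * m u.
  apply: (@le_trans _ _ (K * m u * (expR (- (s * y)) * psum n s))).
    rewrite /psum !mulr_sumr big_mkcond/=; apply: ler_sum => w _.
    case: ifPn => [Lw|_]; last by rewrite !mulr_ge0 ?expR_ge0 ?m0 ?(ltW K0).
    apply: (le_trans (qb_m_cat qb u w)); rewrite -mulrA ler_pM2l// ler_wpM2l//.
    rewrite mulrCA ler_peMr// -expRD -[leLHS]expR0 ler_expR.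
    have := ler_wpM2l (ltW s_gt0) Lw; lra.
  have h := hy _ (lexx y); have /andP[_ hC2] := hC n.
  have -> : K * m u * (expR (- (s * y)) * psum n s) =
    expR (- (s * y)) * (K * psum n s) * m u by ring.
  apply: ler_wpM2r => //.
  apply: (@le_trans _ _ (d / 2 * theta / (K * C2) * (K * C2))).
    apply: ler_pM; rewrite ?expR_ge0 ?mulr_ge0 ?psum_ge0 ?(ltW K0)//.
    by rewrite ler_pM2l.
  by rewrite divfK// mulf_neq0 ?gt_eqF.
have inner (u : n1.-tuple T) : \sum_(w : n2.-tuple T) (if L (u ++ w) <= x then m (v ++ u ++ w) else 0)
    <= (if good u then d / 2 * theta else theta) * m (v ++ u).
  have key z : (forall w : n2.-tuple T, 0 < m (u ++ w) -> L (u ++ w) <= x -> L w <= z) ->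
     \sum_(w : n2.-tuple T) (if L (u ++ w) <= x then m (v ++ u ++ w) else 0) <=
     \sum_(w : n2.-tuple T | L w <= z) m ((v ++ u) ++ w).
    move=> hz; rewrite [leRHS]big_mkcond; apply: ler_sum => w _; rewrite catA.
    case: ifPn => // Lx; case: ifPn => // Lw.
    rewrite leNgt; apply/negP => vuw; move/negP: Lw; apply; apply: hz => //.
    by move: vuw; rewrite -catA => /m_cat_gt0[].
  case: ifPn => [gu|_].
    apply: (le_trans (key (- y) _)) => // w uw Lx.
    have := qb_L_cat qb _ _ uw; rewrite ler_norml => /andP[h1 h2].
    move: gu; rewrite /good; lra.
  apply: (le_trans (key (x + c + b) _)) => // w uw Lx.
  have := qb_L_cat qb _ _ uw; rewrite ler_norml => /andP[h1 h2].
  have := hb u; lra.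
apply: (le_trans (ler_sum _ (fun u _ => inner u))).
pose g := \sum_(u : n1.-tuple T | good u) m (v ++ u).
have hg : d * m v <= g by exact: hn1.
have -> : \sum_(u : n1.-tuple T) (if good u then d / 2 * theta else theta) * m (v ++ u)
   = d / 2 * theta * g + theta * (m v - g).
  rewrite -(qb_m_sum qb v n1) /g (bigID good)/=; congr (_ + _).
    by rewrite mulr_sumr; apply: eq_bigr => u ->.
  rewrite [in RHS](bigID good)/= addrAC subrr add0r mulr_sumr.
  by apply: eq_bigr => u /negbTE ->.
have -> : d / 2 * theta * g + theta * (m v - g) = theta * (m v - (1 - d / 2) * g) by ring.
rewrite [(1 - _) * theta]mulrC -mulrA ler_pM2l//.
(* As [d <= 1], the gain [(1 - d / 2) * d] is at least [d / 2]. *)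
have : (1 - d / 2) * (d * m v) <= (1 - d / 2) * g by apply: ler_wpM2l => //; lra.
have : 0 <= d * m v by rewrite mulr_ge0// ltW.
have : 0 <= (1 - d) * (d * m v) by rewrite !mulr_ge0//; lra.
lra.
Qed.

Lemma low_all theta : 0 < theta -> low theta.
Proof.
move=> th0; have [d d0 hd] := drift_conditional.
have d1 : d <= 1.
  have [n /(_ [::])] := hd 0; rewrite (qb_m_nil qb) mulr1 => /le_trans; apply.
  by rewrite -(qb_m_nil qb); exact: (mass_le (fun w => 0 <= L w)).
have hj j : low ((1 - d / 2) ^+ j).
  elim: j => [x|j IH].
    by exists 0%N => u; rewrite expr0 mul1r; exact: (mass_le (fun w => L w <= x)).
  rewrite exprS; apply: low_step => //; first by rewrite d0.
  by apply: exprn_gt0; lra.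
have : (fun j => (1 - d / 2) ^+ j) @ \oo --> (0 : R).
  by apply: cvg_expr; rewrite ger0_norm; lra.
move=> /cvgr0Pnorm_lt /(_ _ th0)[j _ /(_ j (leqnn j))].
rewrite ger0_norm; last by rewrite exprn_ge0//; lra.
move=> hth x; have [n hn] := hj j x; exists n => u.
by apply: (le_trans (hn u)); rewrite ler_wpM2r// ltW.
Qed.

(** Three zones: above [x] the weight [e^(-r L)] is small; between [-y] and [x] it is bounded and
    the zone has small mass by [low_all]; below [-y] it is at most [e^(-(s - r) y)] times the weight
    at [s], whose total is bounded. Both [x] and [y] are fixed before [n]. *)
Lemma psum_small r : 0 < r < s -> forall e, 0 < e -> exists n, psum n r <= e.
Proof.
move=> /andP[r0 rs] e e0.
have [C1 [C2 [C10 C20 hC]]] := psum_s_bounds.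
have e3 : 0 < e / 3 by rewrite divr_gt0.
have [y y0 hy] := @expRN_small R (s - r) (e / 3 / C2) ltac:(lra) (divr_gt0 e3 C20).
have [x x0 hx] := @expRN_small R r (e / 3) r0 e3.
have e4 : 0 < e / 3 * expR (- (r * y)) by rewrite mulr_gt0 ?expR_gt0.
have [n hn] := low_all _ e4 x.
exists n.
apply: (@le_trans _ _ (expR (- (r * x)) + (expR (r * y) * (\sum_(w : n.-tuple T | L w <= x) m w)
    + expR (- ((s - r) * y)) * psum n s))); last first.
  have hx' := hx _ (lexx x); have hy' := hy _ (lexx y).
  have := hn [::]; rewrite (qb_m_nil qb)/= mulr1 => hn'.
  have : expR (r * y) * (\sum_(w : n.-tuple T | L w <= x) m w) <= e / 3.
    apply: (le_trans (ler_wpM2l (expR_ge0 _) hn')).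
    by rewrite mulrCA -expRD addrN expR0 mulr1.
  have : expR (- ((s - r) * y)) * psum n s <= e / 3.
    have /andP[_ hC2] := hC n.
    apply: (@le_trans _ _ (e / 3 / C2 * C2)).
      by apply: ler_pM => //; rewrite ?expR_ge0 ?psum_ge0.
    by rewrite divfK// gt_eqF.
  lra.
rewrite /psum.
have -> : expR (- (r * x)) = \sum_(w : n.-tuple T) m w * expR (- (r * x)).
  by rewrite -mulr_suml mass_total mul1r.
rewrite !mulr_sumr [\sum_(w : n.-tuple T | L w <= x) _]big_mkcond/= -!big_split/=.
apply: ler_sum => w _.
have h0 : 0 <= expR (- ((s - r) * y)) * (m w * expR (- (s * L w))).
  by rewrite !mulr_ge0 ?expR_ge0.
case: (leP (L w) x) => Lx; last first.
  rewrite add0r -[leLHS]addr0; apply: lerD => //.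
  by rewrite ler_wpM2l// ler_expR lerN2 ler_pM2l// ltW.
have h1 : 0 <= m w * expR (- (r * x)) by rewrite mulr_ge0 ?expR_ge0.
have h2 : 0 <= expR (r * y) * m w by rewrite mulr_ge0 ?expR_ge0.
have [Ly|Ly] := leP (- y) (L w).
  suff : m w * expR (- (r * L w)) <= expR (r * y) * m w by lra.
  rewrite mulrC ler_wpM2r// ler_expR.
  have := ler_wpM2l (ltW r0) Ly; lra.
suff : m w * expR (- (r * L w)) <= expR (- ((s - r) * y)) * (m w * expR (- (s * L w))) by lra.
rewrite mulrCA ler_wpM2l// -expRD ler_expR.
have := ler_wpM2l (_ : 0 <= s - r) (ltW Ly); lra.
Qed.

(** By submultiplicativity a single [n0] with [A * psum n0 r <= e^(-1)] suffices: each further block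
    of length [n0] gains [e^(-1)], and [M] covers the remainder modulo [n0]. *)
Lemma psum_decay r : 0 < r < s -> exists C k, [/\ 0 < C, 0 < k &
  forall n, psum n r <= C * expR (- (k * n%:R))].
Proof.
move=> rs; have /andP[r0 _] := rs.
pose A := K * expR (r * c).
have A1 : 1 <= A by rewrite mulr_ege1 ?(qb_K qb)// -[leLHS]expR0 ler_expR mulr_ge0// ltW.
have A0 : 0 < A by rewrite (lt_le_trans ltr01).
have [n0 hn0] := psum_small _ rs (expR (- 1) / A) (divr_gt0 (expR_gt0 _) A0).
have n0_gt0 : (0 < n0)%N.
  rewrite lt0n; apply/eqP => e; move: hn0; rewrite e psum0 leNgt => /negP; apply.
  rewrite ltr_pdivrMr// mul1r (lt_le_trans _ A1)// -[ltRHS]expR0 ltr_expR; lra.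
have n0r : 0 < n0%:R :> R by rewrite ltr0n.
pose M := \sum_(i < n0) psum i r.
have M0 : 0 < M.
  rewrite /M; case: (n0) n0_gt0 => // n' _; rewrite big_ord_recl ltr_pwDl ?psum_gt0//.
  by apply: sumr_ge0 => i _; exact: psum_ge0.
have step q i : (i < n0)%N -> psum (q * n0 + i) r <= expR (- q%:R) * M.
  move=> lt_i; elim: q => [|q IH].
    rewrite mul0n add0n oppr0 expR0 mul1r /M (bigD1 (Ordinal lt_i))//= lerDl.
    by apply: sumr_ge0 => j _; exact: psum_ge0.
  rewrite mulSn -addnA; apply: (le_trans (psum_cat_le _ _ _ (ltW r0))).
  have -> : expR (- q.+1%:R) * M = expR (- 1) * (expR (- q%:R) * M).
    by rewrite -natr1 opprD expRD; ring.
  rewrite mulrA; apply: ler_pM => //; rewrite ?psum_ge0//.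
    by rewrite -/A mulr_ge0 ?psum_ge0// ltW.
  by rewrite -/A mulrC -ler_pdivlMr.
exists (M * expR 1), (n0%:R^-1); split; rewrite ?mulr_gt0 ?expR_gt0 ?invr_gt0// => n.
rewrite {1}(divn_eq n n0); apply: (le_trans (step _ _ (ltn_pmod _ n0_gt0))).
rewrite mulrC -mulrA ler_wpM2l ?(ltW M0)// -expRD ler_expR.
have e1 : n%:R = (n %/ n0)%:R * n0%:R + (n %% n0)%:R :> R.
  by rewrite -natrM -natrD -divn_eq.
have e2 : (n %% n0)%:R <= n0%:R :> R by rewrite ler_nat ltnW// ltn_pmod.
have : n0%:R^-1 * n%:R <= (n %/ n0)%:R + 1 :> R.
  by rewrite ler_pdivrMl// e1 mulrDr mulr1 [n0%:R * _]mulrC lerD2l.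
lra.
Qed.

(** Interpolation: splitting at [L = -y] bounds [psum n s] by a multiple of [psum n r] plus a small
    multiple of [psum n t]. Were [psum n t] bounded, the decay at [r < s] would push [psum n s]
    below its positive lower bound [C1]. *)
Lemma psum_unbounded t : s < t -> forall A, exists n, A < psum n t.
Proof.
move=> st A; apply/not_existsP => h.
have {}h n : psum n t <= A by rewrite leNgt; apply/negP/h.
have [C1 [C2 [C10 C20 hC]]] := psum_s_bounds.
have A0 : 0 < A by exact: lt_le_trans (psum_gt0 0 t) (h 0%N).
pose r := s / 2; have rs : 0 < r < s by apply/andP; split; rewrite /r; [ by rewrite divr_gt0 | by rewrite ltr_pdivrMr// ltr_pMr// ltr1n].
have C3 : 0 < C1 / 3 by rewrite divr_gt0.
have [y y0 hy] := @expRN_small R (t - s) (C1 / 3 / A) ltac:(lra) (divr_gt0 C3 A0).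
have C4 : 0 < C1 / 3 * expR (- ((s - r) * y)) by rewrite mulr_gt0 ?expR_gt0.
have [n hn] := psum_small _ rs _ C4.
have /andP[hC1 _] := hC n.
have : psum n s <= expR ((s - r) * y) * psum n r + expR (- ((t - s) * y)) * psum n t.
  rewrite /psum !mulr_sumr -big_split; apply: ler_sum => w _ /=.
  have h1 : 0 <= expR ((s - r) * y) * (m w * expR (- (r * L w))).
    by rewrite !mulr_ge0 ?expR_ge0.
  have h2 : 0 <= expR (- ((t - s) * y)) * (m w * expR (- (t * L w))).
    by rewrite !mulr_ge0 ?expR_ge0.
  have [Ly|Ly] := leP (- y) (L w).
    suff : m w * expR (- (s * L w)) <= expR ((s - r) * y) * (m w * expR (- (r * L w))) by lra.
    rewrite mulrCA ler_wpM2l// -expRD ler_expR.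
    have : 0 <= s - r by lra.
    by move/ler_wpM2l => /(_ _ _ Ly); lra.
  suff : m w * expR (- (s * L w)) <= expR (- ((t - s) * y)) * (m w * expR (- (t * L w))) by lra.
  rewrite mulrCA ler_wpM2l// -expRD ler_expR.
  have : 0 <= t - s by lra.
  by move/ler_wpM2l => /(_ _ _ (ltW Ly)); lra.
have : expR ((s - r) * y) * psum n r <= C1 / 3.
  apply: (le_trans (ler_wpM2l (expR_ge0 _) hn)).
  by rewrite mulrCA -expRD addrN expR0 mulr1.
have : expR (- ((t - s) * y)) * psum n t <= C1 / 3.
  apply: (@le_trans _ _ (C1 / 3 / A * A)).
    by apply: ler_pM => //; rewrite ?expR_ge0 ?psum_ge0// hy.
  by rewrite divfK// gt_eqF.
lra.
Qed.

(** Averaged over [x = L w], it bounds the exponential moment by the tail probabilities at the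
    integers from [k1] on. *)
Lemma layer_cake t (x : R) (k1 k : nat) : 0 <= t -> - (k1 + k)%:R <= x ->
  expR (- (t * x)) <= expR (t * k1%:R) +
    \sum_(i < k | x < - (k1 + i)%:R) expR (t * (k1 + i).+1%:R).
Proof.
move=> t0; elim: k => [|k IH].
  rewrite big_ord0 addn0 addr0 ler_expR => h.
  have := ler_wpM2l t0 h; lra.
have [h _|h] := leP (- (k1 + k)%:R) x.
  rewrite big_mkcond big_ord_recr/= -big_mkcond/= addrA; apply: (le_trans (IH h)).
  by rewrite lerDl; case: ifP => //; rewrite expR_ge0.
rewrite addnS => h'; rewrite big_mkcond big_ord_recr/= -big_mkcond/= h.
apply: (@le_trans _ _ (expR (t * (k1 + k).+1%:R))).
  rewrite ler_expR; have := ler_wpM2l t0 h'; lra.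
by rewrite addrA lerDr addr_ge0 ?expR_ge0// sumr_ge0// => i _; rewrite expR_ge0.
Qed.

(** If all deviations from depth [k1] on were rarer than [e^(-t k)], the layers would form a
    convergent geometric series at the intermediate exponent [t'], and [psum n t'] would be bounded.
    The freedom in [k1] makes the depth dominate the joining losses later on. *)
Lemma deviation_one t k1 : s < t -> exists k n, (k1 <= k)%N /\
  expR (- (t * k%:R)) <= \sum_(w : n.-tuple T | L w < - k%:R) m w.
Proof.
move=> st; apply/not_existsP => h.
have {}h i n : \sum_(w : n.-tuple T | L w < - (k1 + i)%:R) m w <= expR (- (t * (k1 + i)%:R)).
  rewrite leNgt; apply/negP => h'; apply: (h (k1 + i)%N).
  by exists n; rewrite leq_addr ltW.
pose t' := (s + t) / 2; pose q := expR (t' - t).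
have t'0 : 0 <= t' by rewrite /t'; move: s_gt0; lra.
have q1 : q < 1 by rewrite /q -[ltRHS]expR0 ltr_expR /t'; lra.
have q0 : 0 < q by exact: expR_gt0.
have st' : s < t' by rewrite /t'; move: s_gt0; lra.
have [n] := psum_unbounded _ st' (expR (t' * k1%:R) + expR t' / (1 - q)).
rewrite ltNge => /negP; apply.
have [b b0 hb] := L_lower n.
(* Beyond the deepest value of [L] on words of this length, so that [layer_cake] applies to all of
   them. The final bound does not depend on [k]. *)
pose k := (Num.truncn b).+1.
have hk (w : n.-tuple T) : - (k1 + k)%:R <= L w.
  apply: le_trans (hb w); rewrite lerN2 natrD.
  have : b < k%:R by apply: truncnS_gt.
  have : 0 <= k1%:R :> R by exact: ler0n.
  lra.
apply: (@le_trans _ _ (\sum_(w : n.-tuple T) (m w * expR (t' * k1%:R) +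
    \sum_(i < k) expR (t' * (k1 + i).+1%:R) * (if L w < - (k1 + i)%:R then m w else 0)))).
  rewrite /psum; apply: ler_sum => w _.
  apply: (le_trans (ler_wpM2l (m0 w) (layer_cake _ _ _ _ t'0 (hk w)))).
  rewrite mulrDr lerD2l mulr_sumr big_mkcond/=; apply: ler_sum => i _.
  by case: ifP => _; rewrite ?mulr0// mulrC.
rewrite big_split/= -mulr_suml mass_total mul1r.
rewrite lerD2l exchange_big/=.
apply: (@le_trans _ _ (\sum_(i < k) expR t' * q ^+ i)).
  apply: ler_sum => i _; rewrite -mulr_sumr -big_mkcond/=.
  apply: (le_trans (ler_wpM2l (expR_ge0 _) (h i n))).
  rewrite /q -expRM_natr -!expRD ler_expR -natr1 natrD.
  have : 0 <= (t - t') * k1%:R by rewrite mulr_ge0// /t'; lra.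
  lra.
rewrite -mulr_sumr ler_pM2l ?expR_gt0//.
have := subrX1 q k; rewrite -[q - 1]opprB mulNr => /eqP.
rewrite -eqr_oppLR opprB => /eqP e.
rewrite -[leRHS]mul1r ler_pdivlMr; last lra.
rewrite mulrC -e; have := exprn_ge0 k (ltW q0); lra.
Qed.

(** Each new copy of the deviation is joined by a connecting word: the probability is divided by
    [K], the depth shrinks by [c]. *)
Lemma deviation_iter (n : nat) (q x : R) : 0 <= q ->
  q <= \sum_(w : n.-tuple T | L w <= x) m w ->
  forall j, exists n', (q / K) ^+ j <= \sum_(w : n'.-tuple T | L w <= (x + c) *+ j) m w.
Proof.
move=> q0 hq; elim=> [|j [n' IH]].
  exists 0%N; rewrite mulr0n expr0 big_mkcond.
  rewrite (sum_tuple0 _ _ (fun w => if L w <= 0 then m w else 0)) (qb_L_nil qb) lexx.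
  by rewrite (qb_m_nil qb).
exists (n + (k0 + n'))%N.
rewrite big_mkcond/=; set f := fun w => if L w <= (x + c) *+ j.+1 then m w else 0.
have f0 w : 0 <= f w by rewrite /f; case: ifP.
rewrite (sum_tuple_cat _ _ _ _ f) exprS mulrAC ler_pdivrMr//.
have hM := ler_pM q0 (exprn_ge0 j (divr_ge0 q0 (ltW K0))) hq IH.
apply: (le_trans hM); rewrite !mulr_suml big_mkcond/=; apply: ler_sum => u _.
have sge0 : 0 <= (\sum_(w : (k0 + n').-tuple T) f (u ++ w)) * K.
  by rewrite mulr_ge0 ?sumr_ge0 ?(ltW K0)//.
case: ifP => // Lu; rewrite (sum_tuple_cat _ _ _ _ (fun w => f (u ++ w))) exchange_big/=.
rewrite mulr_sumr mulr_suml big_mkcond/=; apply: ler_sum => w _.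
have {}sge0 : 0 <= (\sum_(z : k0.-tuple T) f (u ++ z ++ w)) * K.
  by rewrite mulr_ge0 ?sumr_ge0 ?(ltW K0)//.
case: ifP => // Lw.
have [mu|] := ltP 0 (m u); last first.
  move=> h; have -> : m u = 0 by apply/eqP; rewrite eq_le h m0.
  by rewrite mul0r.
have [mw|] := ltP 0 (m w); last first.
  move=> h; have -> : m w = 0 by apply/eqP; rewrite eq_le h m0.
  by rewrite mulr0.
have [z [h1 h2]] := qb_join qb u w mu mw.
apply: (le_trans h1); rewrite mulrC ler_wpM2r ?(ltW K0)// (bigD1 z)//=.
have -> : f (u ++ z ++ w) = m (u ++ z ++ w).
  rewrite /f ifT// mulrS; move: h2; rewrite ler_norml => /andP[_ h].
  move: Lu Lw h; set X := (x + c) *+ j; move: (L _) => y; lra.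
by rewrite lerDl sumr_ge0.
Qed.

(** Between [s] and [t] two exponents are inserted: the gap from [t'] to [t2] absorbs the losses
    [ln K] and [c] of each copy, the gap from [t2] to [t] the one extra copy that comes from
    rounding [x / b] up. *)
Lemma deviation_lower t : s < t -> exists x0, forall x, x0 <= x -> exists n,
  expR (- (t * x)) <= \sum_(w : n.-tuple T | L w <= - x) m w.
Proof.
move=> st; pose t' := (s + t) / 2; pose t2 := (t' + t) / 2.
have [st' t't2 t2t] : [/\ s < t', t' < t2 & t2 < t] by rewrite /t2 /t'; split; lra.
pose l := ln K; have l0 : 0 <= l by rewrite ln_ge0 ?(qb_K qb).
(* The first bound gives the net depth [b = k - c] of a copy the lower bound 1; the second says that
   the cost [t' k + ln K] of a copy is at most [t2 b]. *)
pose k1 := (Num.truncn (Num.max (c + 1) ((l + t2 * c) / (t2 - t')))).+1.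
have [k [n [k1k hk]]] := deviation_one _ k1 st'.
have kk : Num.max (c + 1) ((l + t2 * c) / (t2 - t')) < k%:R.
  by apply: lt_le_trans (truncnS_gt _) _; rewrite ler_nat.
move: kk; rewrite gt_max => /andP[kc]; rewrite ltr_pdivrMr; last lra.
move=> kt; pose b := k%:R - c.
have b1 : 1 < b by rewrite /b; lra.
have b0 : 0 < b by lra.
have tb : t' * k%:R + l <= t2 * b by rewrite /b; lra.
have tk0 : 0 <= t' * k%:R + l by rewrite addr_ge0// mulr_ge0//; move: s_gt0; lra.
exists (Num.max 0 ((t' * k%:R + l) / (t - t2))) => x.
rewrite ge_max => /andP[x0]; rewrite ler_pdivrMr; last lra.
move=> xt.
have hk' : expR (- (t' * k%:R)) <= \sum_(w : n.-tuple T | L w <= - k%:R) m w.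
  apply: (le_trans hk); rewrite big_mkcond [leRHS]big_mkcond; apply: ler_sum => w _.
  by case: ltP => [/ltW ->//|_]; case: ifP.
pose j := (Num.truncn (x / b)).+1.
have [n' hn'] := @deviation_iter n _ _ (expR_ge0 _) hk' j.
have jx : x < b * j%:R by rewrite mulrC -ltr_pdivrMr// truncnS_gt.
have jx' : j%:R <= x / b + 1.
  rewrite /j -natr1 lerD2r.
  have xb : 0 <= x / b by rewrite divr_ge0// ltW.
  by rewrite truncn_le.
exists n'; apply: (@le_trans _ _ ((expR (- (t' * k%:R)) / K) ^+ j)); last first.
  apply: (le_trans hn'); rewrite big_mkcond [leRHS]big_mkcond; apply: ler_sum => w _.
  case: ifP => [h1|_]; last by case: ifP.
  rewrite ifT//; move: h1; rewrite -mulr_natr => h1; apply: (le_trans h1).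
  by move: jx; rewrite /b; lra.
rewrite -[K]lnK ?posrE// -/l -expRN -expRD -expRM_natr ler_expR.
have : (t' * k%:R + l) * j%:R <= (t' * k%:R + l) * (x / b + 1) by rewrite ler_wpM2l.
have : (t' * k%:R + l) * (x / b) <= t2 * b * (x / b) by rewrite ler_wpM2r// divr_ge0// ltW.
have -> : t2 * b * (x / b) = t2 * x by field; rewrite gt_eqF.
lra.
Qed.

End Words.

(** * The circle *)

Section Circle.
Context {R : realType}.
Implicit Types (x y t : R) (j : int).

Lemma circ_circle t : circle R (circ t).
Proof.
rewrite /circle /= in_itv /= /circ subr_ge0; have /andP[h1 h2] := floor_itv t.
by rewrite h1 /= ltrBlDl -[1]/(1%:~R) -intrD.
Qed.

Lemma circD t j : circ (t + j%:~R) = circ t.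
Proof. by rewrite /circ floorDrz ?intr_int// intrKfloor intrD; lra. Qed.

Lemma circB t j : circ (t - j%:~R) = circ t.
Proof. by rewrite -(circD _ j) subrK. Qed.

Lemma circ_id t : circle R t -> circ t = t.
Proof.
rewrite /circle /= in_itv /= => h; rewrite /circ (_ : Num.floor t = 0) ?subr0//.
by apply: floor_def; rewrite add0r.
Qed.

Lemma circ_eq x y : circ x = circ y -> exists j, x = y + j%:~R.
Proof.
move=> h; exists (Num.floor x - Num.floor y); rewrite intrB; move: h; rewrite /circ; lra.
Qed.

Lemma circ_eq_lt x y : circ x = circ y -> `|x - y| < 1 -> x = y.
Proof.
move=> /circ_eq[j ->]; rewrite addrAC subrr add0r -intr_norm -[1]/(1%:~R) ltr_int.
by case: j => [[|n]|n]//; rewrite addr0.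
Qed.

Lemma circ_inj_chart (q x y : R) : q < x < q + 1 -> q < y < q + 1 -> circ x = circ y -> x = y.
Proof.
by move=> /andP[? ?] /andP[? ?] h; apply: circ_eq_lt => //; rewrite ltr_norml; apply/andP; split; lra.
Qed.

Lemma cdiff_small x y : `|x - y| < 2^-1 -> cdiff (circ x) (circ y) = x - y.
Proof.
rewrite ltr_norml => /andP[h1 h2].
rewrite /cdiff.
have -> : circ x - circ y + 2^-1 = (x - y + 2^-1) - (Num.floor x - Num.floor y)%:~R.
  by rewrite /circ intrB; lra.
rewrite circB circ_id ?addrK// /circle /= in_itv /=; apply/andP; split; lra.
Qed.

(** Near [circ t] the lift used in [cderiv] equals [G] translated by the integer part of [t], minus
    [G t]: by continuity the increments of [G] stay below 1/2, where [cdiff] is the true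
    difference. *)
Lemma cderiv_lift (T G : R -> R) (G' : R) (I : set R) t : open I -> I t ->
  (forall u, I u -> T (circ u) = circ (G u)) -> is_derive t 1 G G' ->
  cderiv T (circ t) = G'.
Proof.
move=> oI It TG dG; rewrite /cderiv.
pose n : R := (Num.floor t)%:~R.
have tn : circ t + n = t by rewrite /circ subrK.
have d1 : is_derive (circ t) 1 (fun u => G (u + n) - G t) G'.
  rewrite -[G']subr0 -[G' in G' - _]mulr1.
  apply: (@is_deriveB _ _ _ (G \o shift n) (cst (G t))).
  by apply: is_derive1_comp; [rewrite /= tn|exact: is_derive_shift].
rewrite derive1E; apply: (@derive_val _ _ _ _ _ (fun u => cdiff (T (circ u)) (T (circ t)))).
apply: near_eq_is_derive d1.
have c1 : {for circ t, continuous (fun u : R => u + n)}.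
  by apply: continuousD; [exact: cvg_id|exact: cst_continuous].
have cG : {for t, continuous G} by apply: differentiable_continuous; apply/derivable1_diffP.
have n1 : \forall u \near circ t, I (u + n).
  apply: c1; rewrite tn; exact: open_nbhs_nbhs.
have n2 : \forall u \near circ t, `|G (u + n) - G t| < 2^-1.
  have cGn : G (u + n) @[u --> circ t] --> G t.
    by rewrite -[X in _ --> G X]tn; apply: continuous_comp => //; rewrite tn.
  by move/cvgrPdist_lt: cGn => /(_ _ (_ : 0 < 2^-1))[]//  d d0 hd; exists d => // u /hd; rewrite distrC.
near=> u.
have Iu : I (u + n) by near: u.
have Gu : `|G (u + n) - G t| < 2^-1 by near: u.
by rewrite -(circD u (Num.floor t)) -/n (TG _ Iu) (TG _ It) cdiff_small.
Unshelve. all: by end_near. Qed.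

End Circle.

(** * Monotonicity on intervals and the length of arcs *)

Section RealInterval.
Context {R : realType}.
Implicit Types (f df : R -> R) (x y z : R) (I : set R).

Lemma MVT_interval f df I x y : is_interval I ->
  (forall t, I t -> is_derive t 1 f (df t)) -> I x -> I y ->
  exists2 t, I t & f x - f y = df t * (x - y).
Proof.
move=> iI dI; wlog xy : x y / x <= y => [H Ix Iy|Ix Iy].
  have [/H|/ltW/H] := leP x y; first exact.
  move=> /(_ Iy Ix)[t It e]; exists t => //.
  by rewrite -[LHS]opprB e -mulrN opprB.
have sub t : t \in `[x, y] -> I t.
  by rewrite in_itv/=; apply: iI.
have [||t txy e] := @MVT_segment _ f df x y xy.
- by move=> t; rewrite in_itv/= => /andP[/ltW ? /ltW ?]; apply/dI/sub; rewrite in_itv/=; apply/andP.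
- by apply: derivable_within_continuous => t /sub /dI[].
by exists t; [exact: sub|rewrite -[LHS]opprB e -mulrN opprB].
Qed.

(** A nonvanishing derivative makes [f] injective, hence monotone by continuity, in a direction left
    open. This is how preimages of intervals under a branch are seen to be intervals. *)
Lemma between_image f df I x y z : is_interval I ->
  (forall t, I t -> is_derive t 1 f (df t)) -> (forall t, I t -> df t != 0) ->
  I x -> I y -> x < z < y -> f x < f z < f y \/ f y < f z < f x.
Proof.
move=> iI dI df0 Ix Iy /andP[xz zy].
have sub t : t \in `[x, y] -> I t.
  by rewrite in_itv/=; apply: iI.
have ctf : {within [set` `[x, y]], continuous f}.
  by apply: derivable_within_continuous => t /sub /dI[].
have inj : {in `[x, y] &, injective f}.
  move=> u v /sub Iu /sub Iv fuv; have [t It] := MVT_interval f df I u v iI dI Iu Iv.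
  move/eqP; rewrite fuv subrr eq_sym mulf_eq0 (negbTE (df0 _ It))/= subr_eq0.
  by move/eqP.
have xin : x \in `[x, y] by rewrite in_itv/= lexx ltW// (lt_trans xz).
have yin : y \in `[x, y] by rewrite in_itv/= lexx ltW// (lt_trans xz).
have zin : z \in `[x, y] by rewrite in_itv/= !ltW.
have [m|m] := itv_continuous_inj_mono ctf inj.
  by left; rewrite !m.
by right; rewrite !m.
Qed.

Lemma open_intervalE I : open I -> is_interval I -> has_lbound I -> has_ubound I ->
  I = [set` `]inf I, sup I[].
Proof.
move=> oI iI lI uI; rewrite -[LHS](interior_id _).1//.
by rewrite interval_bounded_interior//; apply/seteqP; split => t /=; rewrite in_itv.
Qed.

Lemma circ_image_itv (a b : R) : a < b -> b <= a + 1 ->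
  measurable (circ @` `]a, b[ : set (measurableTypeR R)) /\
  lebesgue_measure (circ @` `]a, b[ : set (measurableTypeR R)) = (b - a)%:E.
Proof.
move=> ab b1; pose n : R := (Num.floor a)%:~R.
have /andP[na an] := floor_itv a; rewrite -/n in na.
have {}an : a < n + 1 by move: an; rewrite intrD.
(* The arc may run through the point 0 of the circle. The first piece is its part before 0, the
   second its part from 0 on, empty when [d = 0]. *)
pose c := Num.min (b - n) 1; pose d := Num.max (b - n - 1) 0.
have -> : circ @` `]a, b[ = `]a - n, c[ `|` `[0, d[.
  apply/seteqP; split => [_ [t /= + <-]|v /=].
    rewrite !in_itv/= => /andP[at_ tb].
    have [tn|tn] := ltP t (n + 1).
      left; rewrite (_ : circ t = t - n).
        by rewrite lt_min; apply/and3P; split; lra.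
      rewrite -(circB t (Num.floor a)) circ_id//.
      rewrite /circle /= in_itv/=; apply/andP; split; rewrite -/n; lra.
    right; rewrite (_ : circ t = t - n - 1).
      by rewrite lt_max; apply/andP; split; first lra; apply/orP; left; lra.
    have -> : t - n - 1 = t - (Num.floor a + 1)%:~R by rewrite intrD -/n; lra.
    rewrite -(circB t (Num.floor a + 1)) circ_id//.
    rewrite /circle /= in_itv/= intrD -/n; apply/andP; split; lra.
  rewrite !in_itv/= lt_min lt_max => -[/and3P[h1 h2 h3]|/andP[h1 /orP[h2|h2]]].
  - exists (v + n); first by rewrite in_itv/=; apply/andP; split; lra.
    by rewrite circD circ_id// /circle /= in_itv/=; apply/andP; split; lra.
  - exists (v + (Num.floor a + 1)%:~R).
      by rewrite in_itv/= intrD -/n; apply/andP; split; lra.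
    by rewrite circD circ_id// /circle /= in_itv/=; apply/andP; split; lra.
  - lra.
have m1 : measurable (`]a - n, c[ : set (measurableTypeR R)) by exact: measurable_itv.
have m2 : measurable (`[0, d[ : set (measurableTypeR R)) by exact: measurable_itv.
split; first exact: measurableU.
pose A : set (measurableTypeR R) := `]a - n, c[%classic.
pose B : set (measurableTypeR R) := `[0, d[%classic.
transitivity (lebesgue_measure A + lebesgue_measure B)%E.
  apply: measureU => //; apply/seteqP; split => // v [] /=.
  rewrite !in_itv/= lt_max => /andP[h1 _] /andP[h2 /orP[]]; lra.
rewrite /A /B (lebesgue_measure_itv `]a - n, c[) (lebesgue_measure_itv `[0, d[)/= !lte_fin.
have -> : a - n < c by rewrite lt_min; apply/andP; split; lra.
have [h|h] := leP (b - n) 1.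
  have -> : c = b - n by apply/min_idPl.
  have -> : d = 0 by apply/max_idPr; lra.
  by rewrite ltxx adde0 -EFinB; congr EFin; lra.
have -> : c = 1 by apply/min_idPr/ltW.
have -> : d = b - n - 1 by apply/max_idPl; lra.
rewrite ifT; last lra.
by rewrite -!EFinB -EFinD; congr EFin; lra.
Qed.

End RealInterval.

(** * Lifts of the Markov map to cylinders *)

(* [F k] expresses the [k]-th branch of [S] in charts, with derivative [F' k]. *)
Record markov_lift (R : realType) (S : R -> R) (N : nat) (p : nat -> R)
    (F F' : 'I_N.+1 -> R -> R) (c lam : R) : Prop := MarkovLift {
  ml_circle : forall v, circle R v -> circle R (S v);
  ml_lt : forall k, (k <= N)%N -> p k < p k.+1;
  ml_per : p N.+1 = p 0%N + 1;
  ml_F : forall (k : 'I_N.+1) t, t \in `]p k, p k.+1[ -> S (circ t) = circ (F k t);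
  ml_der : forall (k : 'I_N.+1) t, t \in `]p k, p k.+1[ -> is_derive t 1 (F k) (F' k t);
  ml_cont : forall (k : 'I_N.+1) t, t \in `]p k, p k.+1[ -> {for t, continuous (F' k)};
  ml_neq0 : forall (k : 'I_N.+1) t, t \in `]p k, p k.+1[ -> F' k t != 0;
  ml_chart : forall k : 'I_N.+1, exists q,
    forall t, t \in `]p k, p k.+1[ -> q < F k t < q + 1;
  ml_hoelder : forall k : 'I_N.+1, hoelder_on `]p k, p k.+1[ (F' k);
  ml_markov : forall k : 'I_N.+1, exists A : {set 'I_N.+1},
    S @` mono_int p k `\` endpoints N p = \bigcup_(l in [set` A]) mono_int p l;
  ml_mixing : forall k l : 'I_N.+1, exists n0, forall n, (n0 <= n)%N ->
    0 < (trans_mx S N p ^+ n) k l;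
  ml_c : 0 < c;
  ml_lam : 1 < lam;
  ml_exp : forall n (w : n.-tuple 'I_N.+1) v, (1 <= n)%N -> cylinder S p w v ->
    c * lam ^+ n <= `|cderiv (iter n S) v| }.

Arguments ml_circle {R S N p F F' c lam} _.
Arguments ml_lt {R S N p F F' c lam} _.
Arguments ml_per {R S N p F F' c lam} _.
Arguments ml_F {R S N p F F' c lam} _.
Arguments ml_der {R S N p F F' c lam} _.
Arguments ml_cont {R S N p F F' c lam} _.
Arguments ml_neq0 {R S N p F F' c lam} _.
Arguments ml_chart {R S N p F F' c lam} _.
Arguments ml_hoelder {R S N p F F' c lam} _.
Arguments ml_markov {R S N p F F' c lam} _.
Arguments ml_mixing {R S N p F F' c lam} _.
Arguments ml_c {R S N p F F' c lam} _.
Arguments ml_lam {R S N p F F' c lam} _.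
Arguments ml_exp {R S N p F F' c lam} _.

Section Lifts.
Context {R : realType} {S : R -> R} {N : nat} {p : nat -> R}.
Context {F F' : 'I_N.+1 -> R -> R} {c lam : R}.
Hypothesis ml : markov_lift R S N p F F' c lam.
Implicit Types (k l : 'I_N.+1) (w : seq 'I_N.+1).

Lemma p_mono i j : (i < j <= N.+1)%N -> p i < p j.
Proof.
elim: j => // j IH /andP[]; rewrite !ltnS leq_eqVlt => /predU1P[->|ij] jN.
  exact: (ml_lt ml).
apply: lt_trans (ml_lt ml _ jN).
by apply: IH; rewrite ij/= leqW.
Qed.

Lemma p_le i j : (i <= j <= N.+1)%N -> p i <= p j.
Proof.
by case/andP; rewrite leq_eqVlt => /predU1P[->//|ij jN]; apply/ltW/p_mono; rewrite ij.
Qed.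

Lemma itv_period k t : t \in `]p k, p k.+1[ -> p 0%N < t < p 0%N + 1.
Proof.
rewrite in_itv/= => /andP[h1 h2]; rewrite -(ml_per ml).
apply/andP; split.
  by apply: le_lt_trans h1; apply: p_le; rewrite /= ltnW// ltnS ltnW.
by apply: lt_le_trans h2 _; apply: p_le; rewrite ltn_ord leqnn.
Qed.

Lemma mono_int_circ k t : t \in `]p k, p k.+1[ -> mono_int p k (circ t).
Proof. by move=> h; exists t. Qed.

Lemma mono_int_circle k v : mono_int p k v -> circle R v.
Proof. by move=> [t _ <-]; exact: circ_circle. Qed.

Lemma itv_circ_inj k l t u : t \in `]p k, p k.+1[ -> u \in `]p l, p l.+1[ ->
  circ t = circ u -> t = u /\ k = l.
Proof.
move=> tk ul tu; have e := circ_inj_chart _ _ _ (itv_period _ _ tk) (itv_period _ _ ul) tu.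
split=> //; subst u; apply/val_inj => /=.
wlog kl : k l tk ul / (k < l)%N.
  by move=> H; have [h|h|//] := ltngtP k l; [exact: (H k l)|exact/esym/(H l k)].
move: tk ul; rewrite !in_itv/= => /andP[_ h1] /andP[h2 _].
have : p k.+1 <= p l by apply: p_le; rewrite kl/= ltnW// ltnS ltnW.
by move=> /(lt_le_trans h1)/(lt_trans h2); rewrite ltxx.
Qed.

Lemma mono_int_inj k l v : mono_int p k v -> mono_int p l v -> k = l.
Proof. by move=> [t tk <-] [u ul /esym e]; have [] := itv_circ_inj k l t u tk ul e. Qed.

Lemma mono_int_endpoints k v : mono_int p k v -> ~ endpoints N p v.
Proof.
move=> [t tk <-] [i iN e].
have tp := itv_period _ _ tk; move: tk; rewrite /= in_itv/= => /andP[h1 h2].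
have pi : p 0%N <= p i by apply: p_le; rewrite leq0n leqW.
have pi1 : p i < p 0%N + 1 by rewrite -(ml_per ml); apply: p_mono; rewrite ltnS iN /=.
have {}e : t = p i.
  by apply: circ_eq_lt => //; move: tp => /andP[? ?]; rewrite ltr_norml; apply/andP; split; lra.
have [ik|ki] := leqP i k.
  have : p i <= p k by apply: p_le; rewrite ik ltnW.
  by rewrite -e => /(lt_le_trans h1); rewrite ltxx.
have : p k.+1 <= p i by apply: p_le; rewrite ki leqW.
by rewrite -e => /(lt_le_trans h2); rewrite ltxx.
Qed.

Lemma circle_cover v : circle R v -> endpoints N p v \/ exists k, mono_int p k v.
Proof.
move=> cv; pose t := p 0%N + circ (v - p 0%N).
have tv : circ t = v.
  rewrite /t /circ -/(circ _) -[RHS]circ_id// -(circB v (Num.floor (v - p 0%N))).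
  by congr (circ _); lra.
have /= := circ_circle (v - p 0%N); rewrite /circle /= in_itv/= => /andP[t0 t1].
have {}t0 : p 0%N <= t by rewrite /t; lra.
have {}t1 : t < p N.+1 by rewrite (ml_per ml) /t; lra.
have hP n : (n <= N)%N -> t < p n.+1 -> exists i, [/\ (i <= N)%N, p i <= t & t < p i.+1].
  elim: n => [|n IH] nN tn; first by exists 0%N.
  have [h|h] := ltP t (p n.+1).
    by have [i [iN h1 h2]] := IH (ltnW nN) h; exists i; split=> //; exact: leqW.
  by exists n.+1.
have [i [iN hi hi1]] := hP N (leqnn N) t1.
move: hi; rewrite le_eqVlt => /predU1P[e|hi]; first by left; exists i => //; rewrite e.
right; exists (Ordinal (iN : (i < N.+1)%N)); exists t => //=.
by rewrite in_itv/= hi.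
Qed.

Definition trans k l := mono_int p l `<=` S @` mono_int p k.

(** The Markov property: up to partition points the image of a branch is a union of partition
    intervals, so it covers each one that it meets. *)
Lemma transP k l v : mono_int p k v -> mono_int p l (S v) -> trans k l.
Proof.
move=> kv lSv; have [A hA] := ml_markov ml k.
have : (S @` mono_int p k `\` endpoints N p) (S v).
  by split; [exists v|exact: mono_int_endpoints lSv].
rewrite hA => -[l' l'A /(mono_int_inj _ _ _ lSv) e]; subst l'.
by move=> u lu; have : (\bigcup_(l in [set` A]) mono_int p l) u; [exists l|rewrite -hA => -[]].
Qed.

Lemma itv_is_interval k : is_interval [set` `]p k, p k.+1[].
Proof. exact: interval_is_interval. Qed.

Lemma F_inj k t u : t \in `]p k, p k.+1[ -> u \in `]p k, p k.+1[ -> F k t = F k u -> t = u.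
Proof.
move=> tk uk e.
have [x xk] := MVT_interval (F k) (F' k) _ t u (itv_is_interval k) (ml_der ml k) tk uk.
move/eqP; rewrite e subrr eq_sym mulf_eq0 (negbTE (ml_neq0 ml k _ xk))/= subr_eq0.
by move/eqP.
Qed.

(* As the image of a branch lies in a chart, it contains a covered partition
   interval in a single translate. *)
Lemma trans_lift k l : trans k l -> exists j : int,
  (forall t, t \in `]p k, p k.+1[ -> mono_int p l (circ (F k t)) ->
     F k t - j%:~R \in `]p l, p l.+1[) /\
  (forall u, u \in `]p l, p l.+1[ -> exists2 t, t \in `]p k, p k.+1[ & F k t = u + j%:~R).
Proof.
move=> kl; have [q hq] := ml_chart ml k.
have cov u : u \in `]p l, p l.+1[ -> exists2 t, t \in `]p k, p k.+1[ & exists i : int, F k t = u + i%:~R.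
  move=> /mono_int_circ /kl [_ [t tk <-]]; rewrite (ml_F ml _ _ tk) => /circ_eq h.
  by exists t.
have p_l : p l < p l.+1 by apply: (ml_lt ml); rewrite -ltnS.
have [u0 u0l] : exists u0, u0 \in `]p l, p l.+1[.
  by exists ((p l + p l.+1) / 2); rewrite in_itv/=; apply/andP; split; lra.
have [t0 t0k [j e0]] := cov _ u0l.
have key t i u : t \in `]p k, p k.+1[ -> u \in `]p l, p l.+1[ -> F k t = u + i%:~R -> i = j.
  wlog: t0 u0 j t i u t0k u0l e0 / (j <= i)%R.
    move=> H tk ul e; have [h|h] := leP j i; first exact: (H t0 u0 j t i u).
    by apply/esym/(H t u i t0 j u0) => //; rewrite ltW.
  rewrite le_eqVlt => /predU1P[//|ji] tk ul e; exfalso.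
  have ji1 : j%:~R + 1 <= i%:~R :> R by rewrite -[1]/(1%:~R) -intrD ler_int lezD1.
  have /andP[h1 h2] := hq _ t0k; have /andP[h3 h4] := hq _ tk.
  rewrite e0 in h1 h2; rewrite e in h3 h4.
  (* Two different translates would enclose an end of the chart: [q] would be a translate of a point
     of the covered interval, and the lift of that point would be [q] plus an integer, strictly
     between [q] and [q + 1]. *)
  have zl : q - j%:~R \in `]p l, p l.+1[.
    move: u0l ul; rewrite !in_itv/= => /andP[? ?] /andP[? ?]; apply/andP; split; lra.
  have [t1 t1k [i' e1]] := cov _ zl.
  have /andP[] := hq _ t1k; rewrite e1.
  have -> : q - j%:~R + i'%:~R = q + (i' - j)%:~R :> R by rewrite intrB; lra.
  rewrite ltrDl ltrD2l -[1]/(1%:~R) ltr0z ltr_int.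
  by case: (i' - j) => [[|n]|n].
exists j; split=> [t tk [u ul] /esym/circ_eq[i e]|u ul].
  by rewrite e (key t i u)// addrK.
by have [t tk [i e]] := cov u ul; exists t => //; rewrite e (key t i u).
Qed.

Fixpoint word_cyl w : set R :=
  if w is k :: w' then [set v | mono_int p k v /\ word_cyl w' (S v)] else circle R.

Lemma word_cylP w v : word_cyl w v <-> circle R v /\
  forall i, (i < size w)%N -> mono_int p (nth ord0 w i) (iter i S v).
Proof.
elim: w v => [|k w IH] v /=; first by split=> [|[]].
split=> [[kv /IH[_ h]]|[cv h]].
  by split=> [|[|i] iw]; [exact: mono_int_circle kv| |rewrite iterSr; exact: h].
split; first exact: (h 0%N).
apply/IH; split=> [|i iw]; first exact: (ml_circle ml).
by have := h i.+1 iw; rewrite /= -iterS iterSr.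
Qed.

Lemma cylinder_word n (w : n.-tuple 'I_N.+1) : cylinder S p w = word_cyl w.
Proof.
apply/seteqP; split=> v => [[cv h]|/word_cylP[cv h]].
  apply/word_cylP; split=> // i; rewrite size_tuple => iw.
  by have := h (Ordinal iw); rewrite (tnth_nth ord0).
by split=> // i; rewrite (tnth_nth ord0); apply: h; rewrite size_tuple.
Qed.

Lemma word_cyl_circle w v : word_cyl w v -> circle R v.
Proof. by case: w => //= k w [/mono_int_circle]. Qed.

Lemma word_cyl_cat w1 w2 v :
  word_cyl (w1 ++ w2) v <-> word_cyl w1 v /\ word_cyl w2 (iter (size w1) S v).
Proof.
elim: w1 v => [|k w1 IH] v.
  by split=> [h|[]//]; split => //; exact: word_cyl_circle h.
by rewrite /= -iterS iterSr; split=> [[? /IH[]]//|[[? ?] ?]]; split=> //; exact/IH.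
Qed.

(** On [n]-cylinders this is the modulus of the derivative of the [n]-th iterate, by the chain rule,
    in a form that is multiplicative along orbits by construction. *)
Definition expansion (n : nat) (v : R) := \prod_(i < n) `|cderiv S (iter i S v)|.

Lemma expansionS n v : expansion n.+1 v = `|cderiv S v| * expansion n (S v).
Proof.
rewrite /expansion big_ord_recl/=; congr (_ * _); apply: eq_bigr => i _.
by rewrite -iterS iterSr.
Qed.

Lemma expansion_cat (n i : nat) v : expansion (n + i) v = expansion n v * expansion i (iter n S v).
Proof.
elim: n v => [|n IH] v; first by rewrite /expansion big_ord0 mul1r.
by rewrite addSn !expansionS IH mulrA -iterSr.
Qed.

(** The cylinder lifted to the line; its first letter selects the lift inside []p 0, p 0 + 1[]. The
    value at the empty word is junk. *)
Definition word_itv w : set R :=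
  if w is k :: _ then [set t | (t \in `]p k, p k.+1[) /\ word_cyl w (circ t)] else setT.

Lemma word_itv_circ k w : circ @` word_itv (k :: w) = word_cyl (k :: w).
Proof.
apply/seteqP; split=> [_ [t [_ h] <-]//|v /[dup] h [[t tk e] _]].
by exists t => //; split => //; rewrite e.
Qed.

Lemma open_branch k : open [set` `]p k, p k.+1[].
Proof. exact: interval_open. Qed.

Lemma cderiv_F k t : t \in `]p k, p k.+1[ -> cderiv S (circ t) = F' k t.
Proof.
move=> tk; apply: (cderiv_lift _ (F k) _ [set` `]p k, p k.+1[]) => //.
- exact: (ml_F ml).
- exact: (ml_der ml).
Qed.

(** The lift of an iterate to a cylinder. [wl_img] is the Markov property in its iterated form: the
    image depends on the last letter only, so however short the cylinder is, it is stretched to one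
    of finitely many sizes. *)
Record word_lift k w (G G' : R -> R) : Prop := WordLift {
  wl_itv : is_interval (word_itv (k :: w));
  wl_open : open (word_itv (k :: w));
  wl_S : forall t, word_itv (k :: w) t -> iter (size w).+1 S (circ t) = circ (G t);
  wl_der : forall t, word_itv (k :: w) t -> is_derive t 1 G (G' t);
  wl_cont : forall t, word_itv (k :: w) t -> {for t, continuous G'};
  wl_abs : forall t, word_itv (k :: w) t -> `|G' t| = expansion (size w).+1 (circ t);
  wl_neq0 : forall t, word_itv (k :: w) t -> G' t != 0;
  wl_img : G @` word_itv (k :: w) = F (last k w) @` [set` `]p (last k w), p (last k w).+1[] }.

Arguments wl_itv {k w G G'} _.
Arguments wl_open {k w G G'} _.
Arguments wl_S {k w G G'} _.
Arguments wl_der {k w G G'} _.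
Arguments wl_cont {k w G G'} _.
Arguments wl_abs {k w G G'} _.
Arguments wl_neq0 {k w G G'} _.
Arguments wl_img {k w G G'} _.

(** Letters are added in front. The integer [j] of [trans_lift] moves the image of the first branch
    onto the interval where the lift [G] of the remaining word lives, so the new lift is [G] after
    [F k - j]. *)
Lemma word_lift_exists k w : word_cyl (k :: w) !=set0 -> exists G G', word_lift k w G G'.
Proof.
elim: w k => [|l w IH] k [v0 hv0].
  exists (F k), (F' k).
  have e : word_itv [:: k] = [set` `]p k, p k.+1[].
    apply/seteqP; split=> [t []//|t tk]; split => //; split; first exact: mono_int_circ.
    by apply: (ml_circle ml); exact: circ_circle.
  split; rewrite ?e //=.
  - exact: itv_is_interval.
  - exact: (ml_F ml).
  - exact: (ml_der ml).
  - exact: (ml_cont ml).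
  - by move=> t tk; rewrite expansionS /expansion big_ord0 mulr1 (cderiv_F _ _ tk).
  - exact: (ml_neq0 ml).
have [kv0 lv0] := hv0.
have [G [G' GG']] : exists G G', word_lift l w G G' by apply: IH; exists (S v0).
have kl : trans k l by apply: transP kv0 _; case: lv0.
have [j [hj1 hj2]] := trans_lift _ _ kl.
have itvE t : word_itv [:: k, l & w] t <->
    (t \in `]p k, p k.+1[) /\ word_itv (l :: w) (F k t - j%:~R).
  split=> [[tk [_ h]]|[tk [h1 h2]]]; split => //.
    rewrite (ml_F ml _ _ tk) in h.
    split; first by apply: hj1 => //; case: h.
    by rewrite circB.
  split; first exact: mono_int_circ.
  by rewrite (ml_F ml _ _ tk) -(circB _ j).
pose G1 t := G (F k t - j%:~R); pose G1' t := G' (F k t - j%:~R) * F' k t.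
have dFj t : t \in `]p k, p k.+1[ -> is_derive t 1 (fun t => F k t - j%:~R) (F' k t).
  move=> tk; rewrite -[F' k t]subr0.
  apply: (@is_deriveB _ _ _ (F k) (cst (j%:~R : R))).
  exact: (ml_der ml).
have cFj t : t \in `]p k, p k.+1[ -> {for t, continuous (fun t => F k t - j%:~R)}.
  by move=> tk; apply: differentiable_continuous; apply/derivable1_diffP; case: (dFj t tk).
exists G1, G1'; split.
- move=> x y /itvE[xk xl] /itvE[yk yl] z xzy.
  have zk : z \in `]p k, p k.+1[ := itv_is_interval k x y xk yk z xzy.
  have /andP[] := xzy; rewrite le_eqVlt => /predU1P[<- _|xz]; first exact/itvE.
  rewrite le_eqVlt => /predU1P[->|zy]; first exact/itvE.
  apply/itvE; split=> //.
  have [|/andP[h1 h2]|/andP[h1 h2]] := between_image (F k) (F' k) _ x y z (itv_is_interval k)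
    (ml_der ml k) (ml_neq0 ml k) xk yk.
  + by rewrite xz.
  + by apply: (wl_itv GG' _ _ xl yl); rewrite !lerD2r !ltW.
  + by apply: (wl_itv GG' _ _ yl xl); rewrite !lerD2r !ltW.
- rewrite openE => t /itvE[tk tl].
  have h1 : \forall u \near t, u \in `]p k, p k.+1[ by exact: (open_nbhs_nbhs (conj (open_branch k) tk)).
  have h2 : \forall u \near t, word_itv (l :: w) (F k u - j%:~R).
    by apply: (cFj _ tk); apply: open_nbhs_nbhs; split => //; exact: (wl_open GG').
  by rewrite /interior; near=> u; apply/itvE; split; near: u.
- move=> t /itvE[tk tl]; rewrite iterSr (ml_F ml _ _ tk) -(circB _ j).
  exact: (wl_S GG').
- move=> t /itvE[tk tl]; apply: (is_derive1_comp (f := G)); first exact: (wl_der GG').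
  exact: dFj.
- move=> t /itvE[tk tl]; apply: continuousM; last exact: (ml_cont ml).
  apply: (continuous_comp (f := fun t => F k t - j%:~R)); first exact: cFj.
  exact: (wl_cont GG').
- move=> t /itvE[tk tl]; rewrite normrM expansionS (cderiv_F _ _ tk) mulrC.
  congr (_ * _); rewrite (ml_F ml _ _ tk) -(circB _ j).
  exact: (wl_abs GG').
- move=> t /itvE[tk tl]; rewrite mulf_neq0//; first exact: (wl_neq0 GG').
  exact: (ml_neq0 ml).
- have -> : last k (l :: w) = last l w by [].
  rewrite -(wl_img GG'); apply/seteqP; split=> [_ [t /itvE[tk tl] <-]|_ [u ul <-]].
    by exists (F k t - j%:~R).
  have [t tk e] := hj2 u (proj1 ul); exists t; last by rewrite /G1 e addrK.
  by apply/itvE; rewrite e addrK.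
Unshelve. all: by end_near. Qed.

End Lifts.

Arguments wl_itv {R S N p F k w G G'} _.
Arguments wl_open {R S N p F k w G G'} _.
Arguments wl_S {R S N p F k w G G'} _.
Arguments wl_der {R S N p F k w G G'} _.
Arguments wl_cont {R S N p F k w G G'} _.
Arguments wl_abs {R S N p F k w G G'} _.
Arguments wl_neq0 {R S N p F k w G G'} _.
Arguments wl_img {R S N p F k w G G'} _.

(** * Distortion and masses of cylinders *)

Lemma bigsetU_seqP (I : eqType) (T : Type) (r : seq I) (P : pred I) (F : I -> set T) x :
  (\big[setU/set0]_(i <- r | P i) F i) x <-> exists i, [/\ i \in r, P i & F i x].
Proof.
elim: r => [|i r IH]; first by rewrite big_nil; split=> // -[j []].
rewrite big_cons; case: ifPn => Pi.
  split=> [[Fx|/IH[j [jr Pj Fj]]]|[j []]].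
  - by exists i; rewrite mem_head.
  - by exists j; rewrite in_cons jr orbT.
  - rewrite in_cons => /predU1P[-> _ Fx|jr Pj Fj]; first by left.
    by right; apply/IH; exists j.
split=> [/IH[j [jr Pj Fj]]|[j []]].
  by exists j; rewrite in_cons jr orbT.
rewrite in_cons => /predU1P[-> Pj|jr Pj Fj]; first by rewrite Pj in Pi.
by apply/IH; exists j.
Qed.

Lemma measure_finite_partition (R : realType) d (T : measurableType d)
    (mu : {measure set T -> \bar R}) (I : finType) (P : pred I) (F : I -> set T)
    (A : set T) :
  (forall i, measurable (F i)) ->
  (forall i j x, F i x -> F j x -> i = j) ->
  (forall x, A x <-> exists2 i, P i & F i x) ->
  measurable A /\ mu A = (\sum_(i | P i) mu (F i))%E.
Proof.
move=> mF dF hA.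
have -> : A = \big[setU/set0]_(i <- index_enum I | P i) F i.
  apply/seteqP; split=> x.
    by move=> /hA[i Pi Fx]; apply/bigsetU_seqP; exists i; rewrite mem_index_enum.
  by move=> /bigsetU_seqP[i [_ Pi Fx]]; apply/hA; exists i.
have : uniq (index_enum I) by exact: index_enum_uniq.
elim: (index_enum I) => [_|i r IH /= /andP[ir ur]]; first by rewrite !big_nil measure0.
rewrite !big_cons; have [mr er] := IH ur; case: ifPn => // Pi.
split; first exact: measurableU.
rewrite -er; apply: measureU => //; apply/seteqP; split=> // x.
move=> [Fi /bigsetU_seqP[j [jr _ Fj]]].
by move: ir; rewrite (dF _ _ _ Fi Fj) jr.
Qed.

Section Measure.
Context {R : realType} {S : R -> R} {N : nat} {p : nat -> R}.
Context {F F' : 'I_N.+1 -> R -> R} {c lam : R}.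
Hypothesis ml : markov_lift R S N p F F' c lam.
Implicit Types (k l : 'I_N.+1) (w : seq 'I_N.+1).
Local Notation word_cyl := (@word_cyl R S N p).
Local Notation word_itv := (@word_itv R S N p).
Local Notation word_lift := (@word_lift R S N p F).
Local Notation expansion := (@expansion R S).
Local Notation trans := (@trans R S N p).

Let c0 : 0 < c := ml_c ml.
Let lam0 : 0 < lam. Proof. exact: lt_trans ltr01 (ml_lam ml). Qed.

Lemma expansion_ge k w v : word_cyl (k :: w) v ->
  c * lam ^+ (size w).+1 <= expansion (size w).+1 v.
Proof.
move=> hv; have [|G [G' GG]] := word_lift_exists ml k w; first by exists v.
have [t ht <-] : (circ @` word_itv (k :: w)) v by rewrite word_itv_circ.
rewrite -(wl_abs GG)// -(cderiv_lift _ G (G' t) _ _ (wl_open GG) ht (wl_S GG) (wl_der GG _ ht)).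
apply: (ml_exp ml _ (in_tuple (k :: w))) => //.
by rewrite (cylinder_word ml)//; case: ht.
Qed.

Lemma lift_chart k w G G' : word_lift k w G G' ->
  exists q, forall t, word_itv (k :: w) t -> q < G t < q + 1.
Proof.
move=> GG; have [q hq] := ml_chart ml (last k w); exists q => t ht.
have [u uk <-] : (F (last k w) @` [set` `]p (last k w), p (last k w).+1[]) (G t).
  by rewrite -(wl_img GG); exists t.
exact: hq.
Qed.

(** The image under the lift lies in a chart of length 1, while the derivative is at least
    [c lam^n]. *)
Lemma word_itv_dist k w t u : word_itv (k :: w) t -> word_itv (k :: w) u ->
  `|t - u| <= (c * lam ^+ (size w).+1)^-1.
Proof.
move=> ht hu; have [|G [G' GG]] := word_lift_exists ml k w.
  by exists (circ t); case: ht.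
have [q hq] := lift_chart _ _ _ _ GG.
have [x hx e] := MVT_interval _ _ _ t u (wl_itv GG) (wl_der GG) ht hu.
have cl0 : 0 < c * lam ^+ (size w).+1 by rewrite mulr_gt0// exprn_gt0.
rewrite -[leRHS]mul1r ler_pdivlMr//.
have : `|G t - G u| <= 1.
  by move: (hq _ ht) (hq _ hu) => /andP[? ?] /andP[? ?]; rewrite ler_norml; apply/andP; split; lra.
apply: le_trans; rewrite e normrM (wl_abs GG)// mulrC ler_wpM2r//.
exact: (expansion_ge _ _ _ (proj2 hx)).
Qed.

Lemma word_cyl1 k v : mono_int p k v -> word_cyl [:: k] v.
Proof. by move=> kv; split => //; apply: (ml_circle ml); exact: mono_int_circle kv. Qed.

(** Dividing the Hoelder bound on [F'] by the lower bound [c * lam] on its modulus gives a ratio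
    [1 + b |t - u|^a], dominated by an exponential so that it multiplies along orbits. *)
Lemma branch_distortion k : exists a b, [/\ 0 < a, 0 <= b &
  forall t u, t \in `]p k, p k.+1[ -> u \in `]p k, p k.+1[ ->
    `|F' k t| <= `|F' k u| * expR (b * `|t - u| `^ a)].
Proof.
have [a [C [a0 a1 hC]]] := ml_hoelder ml k.
have cl0 : 0 < c * lam by rewrite mulr_gt0.
exists a, (`|C| / (c * lam)); split=> //; first by rewrite (divr_ge0 (normr_ge0 _) (ltW cl0)).
move=> t u tk uk.
have Fu : c * lam <= `|F' k u|.
  rewrite -(cderiv_F ml k u uk).
  have := @expansion_ge k [::] (circ u); rewrite expr1 expansionS /expansion big_ord0 mulr1.
  by apply; apply: word_cyl1; exact: mono_int_circ.
set X := `|t - u| `^ a; have X0 : 0 <= X by exact: powR_ge0.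
have h1 : `|F' k t - F' k u| <= `|C| * X.
  by apply: (le_trans (hC _ _ tk uk)); rewrite ler_wpM2r// ler_norm.
apply: (@le_trans _ _ (`|F' k u| * (1 + `|C| / (c * lam) * X))); last first.
  by rewrite ler_wpM2l// expR_ge1Dx.
have h2 : `|F' k t| <= `|F' k u| + `|C| * X.
  by rewrite -[X in `|X| <= _](subrK (F' k u)) addrC (le_trans (ler_normD _ _))// lerD2l.
apply: (le_trans h2); rewrite mulrDr mulr1 lerD2l.
have -> : `|F' k u| * (`|C| / (c * lam) * X) = (`|F' k u| / (c * lam)) * (`|C| * X).
  by field; rewrite !gt_eqF.
by rewrite ler_peMl ?mulr_ge0// ler_pdivlMr// mul1r.
Qed.

(** [e n] bounds the oscillation of the logarithm of the derivative at the scale of [n]-cylinders,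
    for all branches at once; it is summable because that scale shrinks geometrically. *)
Lemma branch_osc : exists e : nat -> R, [/\ (forall n, 0 <= e n),
  (exists E, forall n, \sum_(i < n) e i.+1 <= E) &
  forall k n t u, t \in `]p k, p k.+1[ -> u \in `]p k, p k.+1[ ->
    `|t - u| <= (c * lam ^+ n)^-1 -> `|F' k t| <= `|F' k u| * expR (e n)].
Proof.
have [a ha] := choice branch_distortion.
have [b hb] := choice ha.
pose e n : R := \sum_k b k * ((c * lam ^+ n)^-1) `^ a k.
have cl0 n : 0 < (c * lam ^+ n)^-1 by rewrite invr_gt0 mulr_gt0// exprn_gt0.
have e0 k n : 0 <= b k * ((c * lam ^+ n)^-1) `^ a k.
  by have [_ h _] := hb k; rewrite mulr_ge0 ?powR_ge0.
exists e; split.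
- by move=> n; apply: sumr_ge0.
- pose q k := expR (- (a k * ln lam)).
  have llam : 0 < ln lam by rewrite ln_gt0//; exact: (ml_lam ml).
  have q1 k : q k < 1.
    have [h _ _] := hb k; rewrite -[ltRHS]expR0 ltr_expR oppr_lt0; exact: mulr_gt0.
  have q0 k : 0 < q k by exact: expR_gt0.
  exists (\sum_k b k * expR (- (a k * ln c)) / (1 - q k)) => n.
  rewrite exchange_big; apply: ler_sum => k _ /=.
  have [_ b0 _] := hb k.
  have -> : \sum_(i < n) b k * ((c * lam ^+ i.+1)^-1) `^ a k =
     \sum_(i < n) (b k * expR (- (a k * ln c))) * q k ^+ i.+1.
    apply: eq_bigr => i _; rewrite -mulrA; congr (_ * _).
    rewrite /powR gt_eqF// lnV ?posrE ?mulr_gt0 ?exprn_gt0// lnM ?posrE ?exprn_gt0//.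
    by rewrite lnXn// /q -expRM_natr -expRD -mulr_natr; congr expR; ring.
  rewrite -mulr_sumr ler_wpM2l ?mulr_ge0 ?expR_ge0//.
  have := subrX1 (q k) n; set s := \sum_(i < n) _ => e1.
  have : (1 - q k) * s <= 1.
    by have := exprn_ge0 n (ltW (q0 k)); rewrite -opprB mulNr -e1; lra.
  rewrite mulrC -ler_pdivlMr; last by rewrite subr_gt0.
  rewrite div1r; apply: le_trans.
  by apply: ler_sum => i _; rewrite exprS ler_piMl ?exprn_ge0// ltW.
- move=> k n t u tk uk tu; have [a0 b0 h] := hb k.
  apply: (le_trans (h _ _ tk uk)); rewrite ler_wpM2l// ler_expR.
  apply: (@le_trans _ _ (b k * ((c * lam ^+ n)^-1) `^ a k)).
    by rewrite ler_wpM2l// ge0_ler_powR// ?nnegrE// ltW.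
  by rewrite /e (bigD1 k)//= lerDl sumr_ge0.
Qed.

Lemma expansion_gt0 w v : word_cyl w v -> 0 < expansion (size w) v.
Proof.
case: w => [_|k w hv]; first by rewrite /expansion big_ord0.
by apply: lt_le_trans (expansion_ge _ _ _ hv); rewrite mulr_gt0// exprn_gt0.
Qed.

(** Along the orbits of two points of a cylinder the [i]-th iterates share a cylinder of length
    [n - i]. The logarithmic errors thus add up to a partial sum of [e], bounded by [E] for all
    words. *)
Lemma expansion_distortion : exists2 M : R, 1 <= M & forall w v v',
  word_cyl w v -> word_cyl w v' -> expansion (size w) v <= M * expansion (size w) v'.
Proof.
have [e [e0 [E hE] he]] := branch_osc.
have E0 : 0 <= E by apply: le_trans (hE 0%N); rewrite big_ord0.
exists (expR E); first by rewrite -[leLHS]expR0 ler_expR.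
have H w v v' : word_cyl w v -> word_cyl w v' ->
   expansion (size w) v <= expR (\sum_(i < size w) e i.+1) * expansion (size w) v'.
  elim: w v v' => [|k w IH] v v'.
    by rewrite /expansion !big_ord0 expR0 mulr1.
  move=> /[dup] hv [kv Sv] /[dup] hv' [kv' Sv'].
  rewrite !expansionS big_ord_recr /= expRD.
  have [t ht tv] : (circ @` word_itv (k :: w)) v by rewrite word_itv_circ.
  have [u hu uv] : (circ @` word_itv (k :: w)) v' by rewrite word_itv_circ.
  have tk := proj1 ht; have uk := proj1 hu.
  have d := he k _ t u tk uk (word_itv_dist _ _ _ _ ht hu).
  rewrite -(cderiv_F ml k t tk) -(cderiv_F ml k u uk) tv uv in d.
  have := ler_pM (normr_ge0 _) (ltW (expansion_gt0 _ _ Sv)) d (IH _ _ Sv Sv').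
  move=> /le_trans; apply; rewrite le_eqVlt; apply/orP; left; apply/eqP; ring.
move=> w v v' hv hv'; apply: (le_trans (H _ _ _ hv hv')).
rewrite ler_wpM2r ?ler_expR//; exact/ltW/expansion_gt0.
Qed.

Definition mass w : R := fine (lebesgue_measure (word_cyl w : set (measurableTypeR R))).

Lemma word_cyl_itv k w : word_cyl (k :: w) !=set0 -> exists a b, [/\ a < b, b <= a + 1 &
  word_itv (k :: w) = `]a, b[%classic].
Proof.
move=> h; have [G [G' GG]] := word_lift_exists ml k w h.
have pk : p k <= p k.+1 by apply/ltW/(ml_lt ml); rewrite -ltnS.
have pk1 : p k.+1 <= p k + 1.
  have h1 : p k.+1 <= p N.+1 by apply: (p_le ml); rewrite ltn_ord leqnn.
  have h2 : p 0%N <= p k by apply: (p_le ml); rewrite leq0n/= ltnW// ltnS ltnW.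
  by apply: (le_trans h1); rewrite (ml_per ml); lra.
have sub t : word_itv (k :: w) t -> p k < t < p k.+1 by case; rewrite in_itv.
have lb : lbound (word_itv (k :: w)) (p k) by move=> t /sub /andP[/ltW].
have ub : ubound (word_itv (k :: w)) (p k.+1) by move=> t /sub /andP[_ /ltW].
have e := open_intervalE _ (wl_open GG) (wl_itv GG) (ex_intro _ _ lb) (ex_intro _ _ ub).
have [v] := h; rewrite -(word_itv_circ) => -[t ht _].
have ne : word_itv (k :: w) !=set0 by exists t.
exists (inf (word_itv (k :: w))), (sup (word_itv (k :: w))); split=> //.
  by move: ht; rewrite {1}e /= in_itv/= => /andP[]; exact: lt_trans.
have := lb_le_inf ne lb; have := ge_sup ne ub; lra.
Qed.

Lemma word_cyl_measure k w a b : a < b -> b <= a + 1 -> word_itv (k :: w) = `]a, b[%classic ->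
  measurable (word_cyl (k :: w) : set (measurableTypeR R)) /\
  lebesgue_measure (word_cyl (k :: w) : set (measurableTypeR R)) = (b - a)%:E.
Proof.
by move=> ab b1 e; rewrite -(word_itv_circ) e; exact: circ_image_itv.
Qed.

Lemma lebesgue_circle : lebesgue_measure (circle R : set (measurableTypeR R)) = 1%E.
Proof. by rewrite /circle lebesgue_measure_itv/= lte_fin ltr01 oppr0 adde0. Qed.

Lemma word_cyl_measurable w : measurable (word_cyl w : set (measurableTypeR R)).
Proof.
case: w => [|k w]; first exact: measurable_itv.
have [/word_cyl_itv[a [b [h1 h2 h3]]]|/set0P/negP/negPn/eqP->] := pselect (word_cyl (k :: w) !=set0).
  by have [] := word_cyl_measure _ _ _ _ h1 h2 h3.
exact: measurable0.
Qed.

Lemma massE w : lebesgue_measure (word_cyl w : set (measurableTypeR R)) = (mass w)%:E.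
Proof.
rewrite /mass; case: w => [|k w]; first by rewrite lebesgue_circle.
have [/word_cyl_itv[a [b [h1 h2 h3]]]|/set0P/negP/negPn/eqP->] := pselect (word_cyl (k :: w) !=set0).
  by have [_ ->] := word_cyl_measure _ _ _ _ h1 h2 h3.
by rewrite measure0.
Qed.

Lemma mass_ge0 w : 0 <= mass w.
Proof. by rewrite -lee_fin -massE measure_ge0. Qed.

Lemma mass_set0 w : word_cyl w = set0 -> mass w = 0.
Proof. by rewrite /mass => ->; rewrite measure0. Qed.

Lemma mass_nil : mass [::] = 1.
Proof. by rewrite /mass lebesgue_circle. Qed.

(** By the mean value theorem the lift stretches the cylinder by its expansion, up to the distortion
    [M]. The image has length at most 1, lying in a chart, and at least [d (last k w)], being the
    full image of the last branch. *)
Lemma mass_expansion : exists2 C : R, 1 <= C & forall w v, word_cyl w v ->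
  C^-1 <= mass w * expansion (size w) v <= C.
Proof.
have [M M1 hM] := expansion_distortion.
have M0 : 0 < M by exact: lt_le_trans ltr01 M1.
have hd k : exists d : R, 0 < d /\ exists x y, [/\ x \in `]p k, p k.+1[, y \in `]p k, p k.+1[ &
    d <= `|F k x - F k y|].
  have pk : p k < p k.+1 by apply: (ml_lt ml); rewrite -ltnS.
  pose x := (p k + (p k + p k.+1) / 2) / 2; pose y := (p k + p k.+1) / 2.
  have xk : x \in `]p k, p k.+1[ by rewrite in_itv/= /x; apply/andP; split; lra.
  have yk : y \in `]p k, p k.+1[ by rewrite in_itv/= /y; apply/andP; split; lra.
  exists `|F k x - F k y|; split; last by exists x, y.
  rewrite normr_gt0 subr_eq0; apply/eqP => /(F_inj ml _ _ _ xk yk).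
  rewrite /x /y; lra.
have [d hd'] := choice hd.
have d0 k : 0 < d k by case: (hd' k).
pose C := M * (1 + \sum_k (d k)^-1).
have s0 : 0 <= \sum_k (d k)^-1 by apply: sumr_ge0 => k _; rewrite invr_ge0 ltW.
have dC k : M / d k <= C.
  rewrite ler_pM2l// (bigD1 k)//= addrCA lerDl addr_ge0// sumr_ge0// => l _.
  by rewrite invr_ge0 ltW.
have MC : M <= C by rewrite ler_pMr// lerDl.
have C1 : 1 <= C by exact: le_trans MC.
have C0 : 0 < C by exact: lt_le_trans MC.
exists C => // -[|k w] v hv.
  by rewrite mass_nil mul1r /expansion big_ord0 invf_le1// C1.
have [|a [b [h1 h2 h3]]] := word_cyl_itv k w; first by exists v.
have -> : mass (k :: w) = b - a.
  by rewrite /mass; have [_ ->] := word_cyl_measure _ _ _ _ h1 h2 h3.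
have [|G [G' GG]] := word_lift_exists ml k w; first by exists v.
have [q hq] := lift_chart _ _ _ _ GG.
set e := expansion _ v; have e0 : 0 < e by exact: expansion_gt0 hv.
have key t u : word_itv (k :: w) t -> word_itv (k :: w) u ->
    e / M * `|t - u| <= `|G t - G u| <= M * e * `|t - u|.
  move=> ht hu; have [x hx ->] := MVT_interval _ _ _ t u (wl_itv GG) (wl_der GG) ht hu.
  have hx' : word_cyl (k :: w) (circ x) by case: hx.
  rewrite normrM (wl_abs GG)//; apply/andP; split; apply: ler_wpM2r => //.
    by rewrite ler_pdivrMr// mulrC; exact: (hM (k :: w)).
  exact: (hM (k :: w)).
apply/andP; split.
  have [_ [x [y [xl yl hxy]]]] := hd' (last k w).
  have hF z : z \in `]p (last k w), p (last k w).+1[ -> exists2 t, word_itv (k :: w) t & G t = F (last k w) z.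
    move=> zl; have : (F (last k w) @` [set` `]p (last k w), p (last k w).+1[]) (F (last k w) z) by exists z.
    by rewrite -(wl_img GG) => -[t ht <-]; exists t.
  have [t ht et] := hF x xl; have [u hu eu] := hF y yl.
  have /andP[_ h4] := key t u ht hu; rewrite et eu in h4.
  have h5 : `|t - u| <= b - a.
    move: ht hu; rewrite h3 /= !in_itv/= => /andP[? ?] /andP[? ?].
    by rewrite ler_norml; apply/andP; split; lra.
  rewrite -[leLHS]mul1r ler_pdivrMr//.
  have h6 : d (last k w) <= M * e * (b - a).
    by apply: (le_trans hxy); apply: (le_trans h4); rewrite ler_wpM2l// mulr_ge0// ltW.
  have := dC (last k w); rewrite ler_pdivrMr// => h7.
  have h8 : 0 <= (b - a) * e by rewrite mulr_ge0 ?(ltW e0)// subr_ge0 ltW.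
  rewrite -(ler_pM2l M0) mulr1; apply: (le_trans h7).
  apply: (le_trans (ler_wpM2l (ltW C0) h6)).
  by rewrite le_eqVlt; apply/orP; left; apply/eqP; ring.
suff : b - a <= M / e.
  by rewrite ler_pdivlMr// => /le_trans; apply.
have [//|h4] := leP (b - a) (M / e); exfalso.
have Me0 : 0 < M / e by exact: divr_gt0.
(* A quarter of the excess: the points [a + r] and [b - r] lie in the open interval and are still
   more than [M / e] apart. *)
pose r := (b - a - M / e) / 4.
have r0 : 0 < r by rewrite /r divr_gt0// subr_gt0.
have ht : word_itv (k :: w) (a + r).
  by rewrite h3 /= in_itv/=; apply/andP; rewrite /r; split; lra.
have hu : word_itv (k :: w) (b - r).
  by rewrite h3 /= in_itv/=; apply/andP; rewrite /r; split; lra.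
have /andP[h5 _] := key _ _ ht hu.
have h6 : `|G (a + r) - G (b - r)| <= 1.
  by move: (hq _ ht) (hq _ hu) => /andP[? ?] /andP[? ?]; rewrite ler_norml; apply/andP; split; lra.
have := le_trans h5 h6; rewrite -ler_pdivlMl ?divr_gt0// mulr1 invf_div distrC ger0_norm.
  by rewrite /r; lra.
by rewrite /r; lra.
Qed.

End Measure.

Lemma slope_is_derive (R : realType) (f : R -> R) (x l : R) :
  (f y - f x) / (y - x) @[y --> x^'] --> l <-> is_derive x 1 f l.
Proof.
split.
  move=> h.
  have h' : (fun t => t^-1 *: (f (t *: 1 + x) - f x)) @ 0^' --> l.
    apply/cvgrPdist_lt => e e0; move/cvgrPdist_lt: h => /(_ e e0).
    move=> /nbhs_ballP[d /= d0 hd].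
    apply/nbhs_ballP; exists d => //= t; rewrite /ball/= sub0r normrN => td t0.
    have := hd (t + x); rewrite /ball/= addrK.
    rewrite /GRing.scale/= mulr1 mulrC; apply.
      by rewrite opprD addrCA subrr addr0 normrN.
    by apply: contra t0 => /eqP/(canRL (addrK x)); rewrite subrr => ->.
  apply: DeriveDef; first by apply/cvg_ex; exists l.
  exact: cvg_lim h'.
move=> [/cvg_ex[l' hl'] dl]; have {dl} el : l' = l by rewrite -dl; apply/esym/cvg_lim.
subst l'; apply/cvgrPdist_lt => e e0; move/cvgrPdist_lt: hl' => /(_ e e0).
move=> /nbhs_ballP[d /= d0 hd].
apply/nbhs_ballP; exists d => //= y; rewrite /ball/= => yd y0.
have := hd (y - x); rewrite /ball/= sub0r normrN.
rewrite /GRing.scale/= mulr1 subrK mulrC; apply; first by rewrite distrC.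
by rewrite subr_eq0.
Qed.

Lemma deriv_within_open (R : realType) (I : set R) (f df : R -> R) : open I ->
  deriv_within I f df <-> forall x, I x -> is_derive x 1 f (df x).
Proof.
move=> oI; split=> h x Ix.
  apply/slope_is_derive => A /(h x Ix) hA.
  have {}hA : nbhs x (fun y => y != x -> I y -> A ((f y - f x) / (y - x))) := hA.
  have nI : nbhs x I by exact: open_nbhs_nbhs.
  change (nbhs x (fun y => y != x -> A ((f y - f x) / (y - x)))).
  by apply: filterS2 hA nI => y h1 Iy yx; exact: h1.
move=> A hA; have /slope_is_derive := h x Ix.
move=> /(_ A hA) hB.
have {}hB : nbhs x (fun y => y != x -> A ((f y - f x) / (y - x))) := hB.
change (nbhs x (fun y => y != x -> I y -> A ((f y - f x) / (y - x)))).
by apply: filterS hB => y h1 h2 _; exact: h1.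
Qed.

(** * Itineraries, exceptional points and admissible words *)

Section Exceptional.
Context {R : realType} {S : R -> R} {N : nat} {p : nat -> R}.
Context {F F' : 'I_N.+1 -> R -> R} {c lam : R}.
Hypothesis ml : markov_lift R S N p F F' c lam.
Implicit Types (k l : 'I_N.+1) (w : seq 'I_N.+1).
Local Notation word_cyl := (@word_cyl R S N p).
Local Notation word_itv := (@word_itv R S N p).
Local Notation word_lift := (@word_lift R S N p F).
Local Notation trans := (@trans R S N p).
Local Notation mass := (@mass R S N p).

Lemma S_inj k v v' : mono_int p k v -> mono_int p k v' -> S v = S v' -> v = v'.
Proof.
move=> [t tk <-] [u uk <-]; rewrite !(ml_F ml k)// => e.
have [q hq] := ml_chart ml k.
have eF := circ_inj_chart q _ _ (hq _ tk) (hq _ uk) e.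
by rewrite (F_inj ml k t u).
Qed.

Lemma endpoints_finite : finite_set (endpoints N p).
Proof.
apply: (@sub_finite_set _ _ ((circ \o p) @` `I_N.+1)).
  by move=> v [k kN ->]; exists k.
exact: finite_image.
Qed.

(** Each branch is injective; since the values of [S] at the partition points are arbitrary, all of
    these are thrown in. *)
Lemma preimage_finite (X : set R) : finite_set X ->
  finite_set [set v | circle R v /\ X (S v)].
Proof.
move=> fX; apply: (@sub_finite_set _ _ (endpoints N p `|`
   \bigcup_(k in [set: 'I_N.+1]) [set v | mono_int p k v /\ X (S v)])).
  move=> v [cv Xv]; have [|[k kv]] := circle_cover ml v cv; first by left.
  by right; exists k.
rewrite finite_setU; split; first exact: endpoints_finite.
apply: bigcup_finite; first exact: finite_finset.
move=> k _.
pose inv y := xget 0 [set v | mono_int p k v /\ S v = y].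
apply: (@sub_finite_set _ _ (inv @` X)); last exact: finite_image.
move=> v [kv Xv]; exists (S v) => //; rewrite /inv; case: xgetP => [_ -> [kv' e]|h].
  exact: (S_inj k).
by case: (h v).
Qed.

(** The points without an itinerary of length [n]. *)
Definition exceptional (n : nat) : set R :=
  [set v | circle R v /\ exists2 i, (i < n)%N & endpoints N p (iter i S v)].

Lemma exceptional_finite n : finite_set (exceptional n).
Proof.
elim: n => [|n IH]; first by apply: sub_finite_set (finite_set0 _) => v [_ [i]].
apply: (@sub_finite_set _ _ (endpoints N p `|` [set v | circle R v /\ exceptional n (S v)])).
  move=> v [cv [[|i] iN h]]; [by left|right; split => //; split; first exact: (ml_circle ml)].
  by exists i => //; rewrite -iterSr.
by rewrite finite_setU; split; [exact: endpoints_finite|exact: preimage_finite].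
Qed.

Lemma exceptional_negligible n : measurable (exceptional n : set (measurableTypeR R)) /\
  lebesgue_measure (exceptional n : set (measurableTypeR R)) = 0%E.
Proof.
have f := exceptional_finite n; have ct := finite_set_countable f; split.
  exact: countable_measurable.
exact: countable_lebesgue_measure0.
Qed.

Lemma word_cyl_cover n v : circle R v -> ~ exceptional n v ->
  exists w : n.-tuple 'I_N.+1, word_cyl w v.
Proof.
move=> cv hv; have : forall i, (i <= n)%N -> circle R (iter i S v).
  by elim=> // i IH iN; apply: (ml_circle ml); apply: IH; exact: ltnW.
elim: n v cv hv => [|n IH] v cv hv ci; first by exists [tuple].
have [e|[k kv]] := circle_cover ml v cv.
  by exfalso; apply: hv; split => //; exists 0%N.
have [|||w hw] := IH (S v).
- exact: (ml_circle ml).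
- by move=> [_ [i iN h]]; apply: hv; split => //; exists i.+1; rewrite ?iterSr.
- by move=> i iN; rewrite -iterSr; exact: ci.
by exists [tuple of k :: w].
Qed.

Lemma word_cyl_inj n (u w : n.-tuple 'I_N.+1) v : word_cyl u v -> word_cyl w v -> u = w.
Proof.
move=> hu hw; apply/val_inj => /=.
have : size u = size w by rewrite !size_tuple.
elim: (tval u) (tval w) v hu hw => [|k u' IH] [|l w'] //= v [ku hu] [lw hw] [e].
by rewrite (mono_int_inj ml _ _ _ ku lw) (IH _ _ hu hw e).
Qed.

(** The longer cylinders are disjoint and fill that of [u] up to exceptional points, which are
    finitely many and hence null. *)
Lemma mass_partition u n : \sum_(w : n.-tuple 'I_N.+1) mass (u ++ w) = mass u.
Proof.
pose A : set (measurableTypeR R) := \bigcup_(w in [set: n.-tuple 'I_N.+1]) word_cyl (u ++ w).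
have mc w := word_cyl_measurable ml w.
have [mA eA] : measurable A /\ lebesgue_measure A =
    (\sum_(w : n.-tuple 'I_N.+1) lebesgue_measure (word_cyl (u ++ w) : set (measurableTypeR R)))%E.
  apply: measure_finite_partition => [w|w1 w2 x h1 h2|x]; first exact: mc.
    apply: (@word_cyl_inj n _ _ (iter (size u) S x)).
      by have [] := (word_cyl_cat u w1 x).1 h1.
    by have [] := (word_cyl_cat u w2 x).1 h2.
  by split=> [[w _ h]|[w _ h]]; exists w.
have [mE eE] := exceptional_negligible (size u + n).
have AE : A `|` ((exceptional (size u + n) : set (measurableTypeR R)) `&` word_cyl u) = word_cyl u.
  apply/seteqP; split=> [v [[w _]|[]//]|v hv].
    by move=> h; have [] := (word_cyl_cat u w v).1 h.
  have cv : circle R v := word_cyl_circle _ _ hv.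
  have [Ev|nEv] := pselect (exceptional (size u + n) v); [by right|left].
  have [||w hw] := @word_cyl_cover n (iter (size u) S v).
  - by elim: (size u) => // i IH; apply: (ml_circle ml).
  - move=> [_ [i iN h]]; apply: nEv; split => //; exists (i + size u)%N; first by rewrite addnC ltn_add2l.
    by rewrite iterD.
  - by exists w => //; apply/word_cyl_cat.
have : lebesgue_measure (word_cyl u : set (measurableTypeR R)) = lebesgue_measure A.
  rewrite -AE; apply: measureU0 => //; first exact: measurableI.
  by apply: subset_measure0 eE => //; exact: measurableI.
rewrite eA (massE ml) => e; apply: EFin_inj; rewrite e -sumEFin; apply: eq_bigr => w _.
by rewrite (massE ml).
Qed.

Lemma word_cyl_prepend k l w : trans k l -> word_cyl (l :: w) !=set0 ->
  word_cyl [:: k, l & w] !=set0.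
Proof.
move=> kl [v hv]; have [x kx e] := kl _ (proj1 hv).
by exists x; split => //; rewrite e.
Qed.

(** By [wl_img] the cylinder of [k :: u] is mapped onto the whole image of its last branch, so any
    point reached from that branch is reached from the cylinder. *)
Lemma word_cyl_append k u l w : trans (last k u) l -> word_cyl (k :: u) !=set0 ->
  word_cyl (l :: w) !=set0 -> word_cyl (k :: u ++ l :: w) !=set0.
Proof.
move=> kl hu [x hx]; have [G [G' GG]] := word_lift_exists ml k u hu.
have [y [t tl ty] Sy] := kl _ (proj1 hx).
have : (F (last k u) @` [set` `]p (last k u), p (last k u).+1[]) (F (last k u) t) by exists t.
rewrite -(wl_img GG) => -[s hs es]; exists (circ s).
apply/(word_cyl_cat (k :: u)); split; first by case: hs.
by rewrite (wl_S GG)// es -(ml_F ml _ _ tl) ty Sy.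
Qed.

Lemma trans_mx_gt0 n k l : 0 < (trans_mx S N p ^+ n.+1) k l ->
  exists z : n.-tuple 'I_N.+1, path (fun i j => `[< trans i j >]) k (rcons z l).
Proof.
have A0 i j : 0 <= trans_mx S N p i j by rewrite mxE; exact: ler0n.
elim: n k => [|n IH] k.
  rewrite expr1 mxE => h; exists [tuple] => /=; rewrite andbT; apply: contraTT h.
  by rewrite /trans => /negbTE ->; rewrite ltxx.
rewrite exprS mxE => h.
have [j] : exists j, 0 < trans_mx S N p k j * (trans_mx S N p ^+ n.+1) j l.
  apply/not_existsP => hj; move: h; rewrite ltNge => /negP; apply.
  by apply: sumr_le0 => j _; rewrite leNgt; apply/negP/hj.
have [kj0|] := ltP 0 (trans_mx S N p k j); last first.
  by move=> kj; rewrite (_ : trans_mx S N p k j = 0) ?mul0r ?ltxx//; apply/eqP; rewrite eq_le kj A0.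
rewrite pmulr_rgt0// => /IH[z hz]; exists [tuple of j :: z] => /=.
rewrite hz andbT; move: kj0; rewrite mxE; apply: contraTT.
by rewrite /trans => /negbTE ->; rewrite ltxx.
Qed.

(** Mixing gives a threshold for each pair of letters, and the maximum over the finitely many pairs
    serves all. With [n] intermediate letters there are [n.+1] transitions. *)
Lemma trans_connect : exists n, forall k l, exists z : n.-tuple 'I_N.+1,
  path (fun i j => `[< trans i j >]) k (rcons z l).
Proof.
have [n hn] := choice (fun kl : 'I_N.+1 * 'I_N.+1 => ml_mixing ml kl.1 kl.2).
exists (\max_kl n kl) => k l; apply: trans_mx_gt0; apply: (hn (k, l)).
by rewrite leqW// (leq_bigmax (k, l)).
Qed.

Lemma word_cyl_letter k : word_cyl [:: k] !=set0.
Proof.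
have pk : p k < p k.+1 by apply: (ml_lt ml); rewrite -ltnS.
exists (circ ((p k + p k.+1) / 2)); apply: (word_cyl1 ml).
by apply: mono_int_circ; rewrite in_itv/=; apply/andP; split; lra.
Qed.

Lemma word_cyl_path z l w : path (fun i j => `[< trans i j >]) (head l z) (rcons (behead z) l) \/ z = [::] ->
  word_cyl (l :: w) !=set0 -> word_cyl (z ++ l :: w) !=set0.
Proof.
case: z => [|k z]; first by [].
case=> //=; elim: z k => [|j z IH] k /=.
  by rewrite andbT => /asboolP kl hl; exact: word_cyl_prepend.
by move=> /andP[/asboolP kj hz] hl; apply: word_cyl_prepend => //; exact: IH.
Qed.

Lemma word_cyl_join : exists n, forall u w, word_cyl u !=set0 -> word_cyl w !=set0 ->
  exists z : n.-tuple 'I_N.+1, word_cyl (u ++ z ++ w) !=set0.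
Proof.
have [n hn] := trans_connect; exists n => u w hu hw.
(* An empty [w] is replaced by the letter [ord0], which is dropped afterwards. An empty [u] is
   covered by the default in [last ord0 u], whose transition is then discarded. *)
wlog [l [w' ew]] : w hw / exists l w', w = l :: w'.
  move=> H; case: w hw => [_|l w' hw]; last by apply: H => //; exists l, w'.
  have [||z [v hz]] := H [:: ord0]; [exact: word_cyl_letter|by exists ord0, [::]|].
  exists z, v; rewrite cats0; move: hz; rewrite catA.
  by move=> /word_cyl_cat[].
subst w; have [z hz] := hn (last ord0 u) l; exists z.
have {}hw : word_cyl (z ++ l :: w') !=set0.
  apply: word_cyl_path => //; case: (tval z) hz => [|k z'] /=; first by right.
  by move=> /andP[_ ?]; left.
case: u hu hz => [//|k u] hu /=.
case: (tval z) hw => [|j z'] /= hw; first by rewrite andbT => /asboolP kl; exact: word_cyl_append.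
by move=> /andP[/asboolP kj _]; exact: word_cyl_append.
Qed.

End Exceptional.

(** * The multiplier on cylinders *)

Section Potential.
Context {R : realType} {S : R -> R} {N : nat} {p : nat -> R}.
Context {F F' : 'I_N.+1 -> R -> R} {c lam : R}.
Hypothesis ml : markov_lift R S N p F F' c lam.
Context {g : R -> R}.
Hypothesis g_gt0 : forall v, circle R v -> 0 < g v.
Hypothesis g_dist : bounded_distortion S g.
Implicit Types (k l : 'I_N.+1) (w : seq 'I_N.+1).
Local Notation word_cyl := (@word_cyl R S N p).
Local Notation word_itv := (@word_itv R S N p).
Local Notation word_lift := (@word_lift R S N p F).
Local Notation trans := (@trans R S N p).
Local Notation mass := (@mass R S N p).
Local Notation expansion := (@expansion R S).
Local Notation gprod := (gprod S g).

Lemma gprodS n v : gprod n.+1 v = g (S v) * gprod n (S v).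
Proof.
rewrite /Defs.gprod big_nat_recl//=; congr (_ * _).
by apply: eq_bigr => i _; rewrite -iterSr.
Qed.

Lemma gprod0 v : gprod 0 v = 1.
Proof. by rewrite /Defs.gprod big_nil. Qed.

Lemma gprod_cat (n i : nat) v : gprod (n + i) v = gprod n v * gprod i (iter n S v).
Proof.
elim: n v => [|n IH] v; first by rewrite gprod0 mul1r.
by rewrite addSn !gprodS IH mulrA -iterSr.
Qed.

Lemma circle_iter n v : circle R v -> circle R (iter n S v).
Proof. by move=> cv; elim: n => // n IH; apply: (ml_circle ml). Qed.

Lemma gprod_gt0 n v : circle R v -> 0 < gprod n v.
Proof.
by move=> cv; apply: prodr_gt0 => i _; apply: g_gt0; exact: circle_iter.
Qed.

(** This makes bounded distortion of [g_n] available on cylinders. *)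
Lemma word_diffeo_nbhds k w v : word_cyl (k :: w) v ->
  diffeo_nbhds S (size w).+1 v (word_cyl (k :: w)).
Proof.
move=> hv; have [|G [G' GG]] := word_lift_exists ml k w; first by exists v.
have oI := wl_open GG.
exists (word_itv (k :: w)); split.
- exact: (wl_itv GG).
- exists (p k) => t [tk _]; have pk : p k < p k.+1 by apply: (ml_lt ml); rewrite -ltnS.
  have h1 : p k.+1 <= p N.+1 by apply: (p_le ml); rewrite ltn_ord leqnn.
  have h2 : p 0%N <= p k by apply: (p_le ml); rewrite leq0n/= ltnW// ltnS ltnW.
  move: tk h1; rewrite (ml_per ml) /= !in_itv/= => /andP[? ?] ?; apply/andP; split; lra.
- by rewrite word_itv_circ.
- have [t ht <-] : (circ @` word_itv (k :: w)) v by rewrite word_itv_circ.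
  by exists t => //; rewrite (interior_id _).1.
- exists G, G'; split.
  + exact: (wl_S GG).
  + by apply/deriv_within_open => // t; exact: (wl_der GG).
  + rewrite continuous_open_subspace// => t; rewrite inE; exact: (wl_cont GG).
  + exact: (wl_neq0 GG).
  + have [q hq] := lift_chart ml _ _ _ _ GG; exists q => _ [t ht <-].
    by rewrite /= in_itv/= hq.
Qed.

(* The base point is an arbitrary point of the cylinder (junk if the cylinder is
   empty, but then its mass is 0). *)
Definition log_weight w : R := ln (gprod (size w) (xget 0 (word_cyl w))).

(** By bounded distortion the choice of the base point matters only up to [|ln D|]. *)
Lemma log_weightP : exists2 d : R, 0 <= d & forall w v, word_cyl w v ->
  `|log_weight w - ln (gprod (size w) v)| <= d.
Proof.
have [D D0 hD] := g_dist; exists `|ln D| => // -[|k w] v hv.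
  by rewrite /log_weight /= !gprod0 subrr normr0.
rewrite /log_weight; case: xgetP => [x _ hx|h]; last by case: (h v).
have cv := word_cyl_circle _ _ hv.
have cx := word_cyl_circle _ _ hx.
have := hD (size w).+1 v (word_cyl (k :: w)) x isT cv (word_diffeo_nbhds _ _ _ hv) hx.
have gx := gprod_gt0 (size w).+1 _ cx; have gv := gprod_gt0 (size w).+1 _ cv.
rewrite -ln_div ?posrE//; set q := _ / _ => /andP[h1 h2].
have q0 : 0 < q by exact: divr_gt0.
have h3 : ln q <= ln D by rewrite ler_ln ?posrE.
have h4 : - ln D <= ln q by rewrite -lnV ?posrE// ler_ln ?posrE ?invr_gt0.
have := ler_norm (ln D); rewrite ler_norml => h5; apply/andP; split; lra.
Qed.

(** The mass of a cylinder is comparable with the inverse of its expansion, which is multiplicative,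
    while [ln g_n] is additive along orbits. The power of [C] counts the comparisons, and [d *+ 4]
    the four words [u], [z], [w] and [u ++ z ++ w] evaluated at other base points. *)
Lemma quasi_bernoulli_mass : exists K C n0,
  @quasi_bernoulli R _ mass log_weight K C n0.
Proof.
have [d d0 hd] := log_weightP.
have [C C1 hC] := mass_expansion ml.
have C0 : 0 < C by exact: lt_le_trans ltr01 C1.
have [n hn] := word_cyl_join ml.
(* [Z] and [B] bound [1 / mass z] and [|log_weight z|] over the finitely many connecting words; a
   word of mass 0 adds 0 to [Z]. *)
pose Z := \sum_(z : n.-tuple 'I_N.+1) (mass z)^-1.
pose B := \sum_(z : n.-tuple 'I_N.+1) `|log_weight z|.
have m0 := mass_ge0 ml.
have Z0 : 0 <= Z by apply: sumr_ge0 => z _; rewrite invr_ge0.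
have B0 : 0 <= B by apply: sumr_ge0.
have neP w : 0 < mass w -> word_cyl w !=set0.
  by move=> mw; apply/set0P/eqP => e; move: mw; rewrite mass_set0// ltxx.
have mE w v : word_cyl w v -> mass w <= C / expansion (size w) v /\
    (C * expansion (size w) v)^-1 <= mass w.
  move=> hv; have e0 := expansion_gt0 ml _ _ hv.
  have /andP[h1 h2] := hC _ _ hv; split; first by rewrite ler_pdivlMr.
  by rewrite invfM ler_pdivrMr.
have C3 : 1 <= C ^+ 3 by rewrite exprn_ege1.
have C4 : C ^+ 3 <= C ^+ 4 * (1 + Z).
  have -> : C ^+ 4 * (1 + Z) = C ^+ 3 * (C * (1 + Z)) by ring.
  rewrite ler_peMr ?exprn_ge0 ?(ltW C0)// mulr_ege1//; lra.
exists (C ^+ 4 * (1 + Z)), (d *+ 4 + B), n; split.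
- by rewrite addr_ge0// mulrn_wge0.
- exact: le_trans C4.
- exact: m0.
- exact: mass_nil.
- by rewrite /log_weight /= gprod0 ln1.
- exact: (mass_partition ml).
- move=> u w.
  have [mv|] := ltP 0 (mass (u ++ w)); last first.
    move=> h; apply: (le_trans h); apply: mulr_ge0; last exact: mulr_ge0.
    exact: le_trans (exprn_ge0 3 (ltW C0)) C4.
  have [v /[dup] hv /word_cyl_cat[hu hw]] := neP _ mv.
  apply: (@le_trans _ _ (C ^+ 3 * (mass u * mass w))); last first.
    by apply: ler_wpM2r => //; rewrite mulr_ge0.
  apply: (le_trans (mE _ _ hv).1); rewrite size_cat expansion_cat.
  have eu := expansion_gt0 ml _ _ hu.
  have ew := expansion_gt0 ml _ _ hw.
  have -> : C / (expansion (size u) v * expansion (size w) (iter (size u) S v)) =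
    C ^+ 3 * ((C * expansion (size u) v)^-1 * (C * expansion (size w) (iter (size u) S v))^-1).
    by field; rewrite !gt_eqF.
  rewrite ler_pM2l ?exprn_gt0//; apply: ler_pM; rewrite ?invr_ge0 ?mulr_ge0 ?(ltW C0) ?(ltW eu) ?(ltW ew)//.
    exact: (mE _ _ hu).2.
  exact: (mE _ _ hw).2.
- move=> u w /neP[v /[dup] hv /word_cyl_cat[hu hw]].
  have cv := word_cyl_circle _ _ hv.
  have := hd _ _ hv; have := hd _ _ hu; have := hd _ _ hw.
  rewrite size_cat gprod_cat lnM ?posrE ?gprod_gt0//; last exact: circle_iter.
  rewrite !ler_norml => /andP[? ?] /andP[? ?] /andP[? ?].
  by apply/andP; split; lra.
- move=> u w /neP hu /neP hw; have [z [v hv]] := hn u w hu hw; exists z.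
  have [vu hzw] := (word_cyl_cat _ _ _).1 hv.
  have [vz vw] := (word_cyl_cat _ _ _).1 hzw.
  have cv := word_cyl_circle _ _ hv.
  have eu := expansion_gt0 ml _ _ vu.
  have ez := expansion_gt0 ml _ _ vz.
  have ew := expansion_gt0 ml _ _ vw.
  split.
    have := (mE _ _ hv).2; rewrite !size_cat !expansion_cat.
    have := (mE _ _ vz).1; have := (mE _ _ vu).1; have := (mE _ _ vw).1.
    move: eu ez ew; set a := expansion (size u) _; set b := expansion (size z) _; set e := expansion (size w) _.
    move=> a0 b0 e0 hw' hu' hz' huzw.
    have mz : 0 < mass z by apply: lt_le_trans (mE _ _ vz).2; rewrite invr_gt0 mulr_gt0.
    have bZ : b <= C * Z.
      rewrite -ler_pdivrMl// /Z (bigD1 z)//=.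
      apply: (@le_trans _ _ (mass z)^-1); last by rewrite lerDl sumr_ge0// => i _; rewrite invr_ge0.
      by move: hz'; rewrite -lef_pV2 ?posrE ?divr_gt0// invf_div mulrC.
    apply: (@le_trans _ _ ((C / a) * (C / e))); first exact: ler_pM.
    apply: (@le_trans _ _ (C ^+ 4 * Z * (C * (a * (b * e)))^-1)).
      have -> : C / a * (C / e) = C ^+ 3 * b * (C * (a * (b * e)))^-1 by field; rewrite !gt_eqF.
      rewrite ler_wpM2r ?invr_ge0 ?mulr_ge0 ?(ltW C0) ?(ltW a0) ?(ltW b0) ?(ltW e0)//.
      have -> : C ^+ 4 * Z = C ^+ 3 * (C * Z) by ring.
      by rewrite ler_wpM2l ?exprn_ge0// ltW.
    apply: ler_pM => //; rewrite ?mulr_ge0 ?exprn_ge0 ?invr_ge0 ?mulr_ge0 ?(ltW C0) ?(ltW a0) ?(ltW b0) ?(ltW e0)//.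
    by rewrite ler_wpM2l ?exprn_ge0 ?ltW// ltrDr.
  have := hd _ _ hv; have := hd _ _ vu; have := hd _ _ vw; have := hd _ _ vz.
  have lz : `|log_weight z| <= B by rewrite /B (bigD1 z)//= lerDl sumr_ge0.
  have c1 := circle_iter (size u) _ cv; have c2 := circle_iter (size z) _ c1.
  rewrite !size_cat !gprod_cat !lnM ?posrE ?mulr_gt0 ?gprod_gt0//.
  move: lz; rewrite !ler_norml => /andP[? ?] /andP[? ?] /andP[? ?] /andP[? ?] /andP[? ?].
  by apply/andP; split; lra.
Qed.

(** Distortion at [n = 1] controls [g] after [S] on each branch, hence [g] on the images of the
    branches. These cover all partition intervals by mixing, and the finitely many partition points
    are treated separately. *)
Lemma ln_g_bounded (M : R) : (forall v, circle R v -> g v <= M) ->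
  exists B, forall v, circle R v -> `|ln (g v)| <= B.
Proof.
move=> hM; have [d d0 hd] := log_weightP.
pose B1 := \sum_(i < N.+1) `|ln (g (circ (p i)))|.
pose B2 := \sum_(k : 'I_N.+1) `|log_weight [:: k]|.
have [n hn] := trans_connect ml.
have B10 : 0 <= B1 by apply: sumr_ge0.
have B20 : 0 <= B2 by apply: sumr_ge0.
exists (`|ln M| + (B1 + (B2 + d))) => v cv.
have up : ln (g v) <= `|ln M|.
  apply: le_trans (ler_norm _); rewrite ler_ln ?posrE ?g_gt0// ?hM//.
  exact: lt_le_trans (g_gt0 _ cv) (hM _ cv).
have M0 : 0 <= `|ln M| by [].
suff lo : - (B1 + (B2 + d)) <= ln (g v) by rewrite ler_norml; apply/andP; split; lra.
have [[i iN ->]|[l lv]] := circle_cover ml v cv.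
  have : `|ln (g (circ (p i)))| <= B1.
    by rewrite /B1 (bigD1 (Ordinal (iN : (i < N.+1)%N)))//= lerDl sumr_ge0.
  rewrite ler_norml => /andP[? ?]; lra.
have [z] := hn ord0 l; rewrite rcons_path => /andP[_ /asboolP /(_ v lv)[x xk e]].
have := hd _ _ (word_cyl1 ml _ _ xk).
rewrite /= gprodS gprod0 mulr1 e.
have : `|log_weight [:: last ord0 z]| <= B2.
  by rewrite /B2 (bigD1 (last ord0 z))//= lerDl sumr_ge0.
rewrite !ler_norml => /andP[? ?] /andP[? ?]; lra.
Qed.

End Potential.

(** * The pressure *)

(** Comparing [u (m n)] with [m u n] and with [n u m] puts every [(u n - C) / n] below every
    [(u m + C) / m]. The supremum of the former separates the two families, and the error stays
    bounded. *)
Lemma quasi_additive_limit (R : realType) (u : nat -> R) (C : R) :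
  (forall n k, `|u (n + k)%N - (u n + u k)| <= C) ->
  exists l, forall n, `|u n - l * n%:R| <= C.
Proof.
move=> hu; have C0 : 0 <= C by exact: le_trans (normr_ge0 _) (hu 0%N 0%N).
have mul m n : `|u (m.+1 * n)%N - m.+1%:R * u n| <= m%:R * C.
  elim: m => [|m IH]; first by rewrite !mul1n mul1r mul0r subrr normr0.
  have := hu n (m.+1 * n)%N; rewrite -mulSn; move: IH.
  rewrite -(natr1 m.+1) -(natr1 m) !ler_norml => /andP[? ?] /andP[? ?]; apply/andP; split; lra.
have cross m n : (u n.+1 - C) / n.+1%:R <= (u m.+1 + C) / m.+1%:R.
  rewrite ler_pdivrMr ?ltr0n// mulrAC ler_pdivlMr ?ltr0n//.
  have := mul m n.+1; have := mul n m.+1; rewrite [(n.+1 * _)%N]mulnC.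
  rewrite -(natr1 n) -(natr1 m) !ler_norml => /andP[? ?] /andP[? ?].
  lra.
pose A : set R := range (fun n => (u n.+1 - C) / n.+1%:R).
have A0 : A !=set0 by exists ((u 1 - C) / 1); exists 0%N.
have ubA m : ubound A ((u m.+1 + C) / m.+1%:R) by move=> _ [n _ <-]; exact: cross.
exists (sup A) => -[|n].
  rewrite mulr0 subr0; have := hu 0%N 0%N; rewrite addn0 !ler_norml => /andP[? ?]; apply/andP; split; lra.
have h1 : (u n.+1 - C) / n.+1%:R <= sup A.
  by apply: ub_le_sup; [exists ((u 1 + C) / 1); exact: (ubA 0%N)|exists n].
have h2 : sup A <= (u n.+1 + C) / n.+1%:R by apply: ge_sup.
rewrite ler_pdivrMr ?ltr0n// in h1; rewrite ler_pdivlMr ?ltr0n// in h2.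
rewrite ler_norml; apply/andP; split; lra.
Qed.

Lemma ereal_sup_bounded (R : realType) (X : set \bar R) (a b : R) : X !=set0 ->
  (forall x, X x -> exists2 r, x = r%:E & a <= r <= b) ->
  exists2 r, ereal_sup X = r%:E & a <= r <= b.
Proof.
move=> [x0 Xx0] hX.
have h1 : (ereal_sup X <= b%:E)%E.
  by apply: ge_ereal_sup => x /hX[r -> /andP[_ ?]]; rewrite lee_fin.
have h2 : (a%:E <= ereal_sup X)%E.
  have [r e /andP[ar _]] := hX _ Xx0.
  apply: (@le_trans _ _ x0); first by rewrite e lee_fin.
  exact: ereal_sup_ubound.
move: h1 h2; case: (ereal_sup X) => [r||] //=; rewrite !lee_fin => h1 h2.
by exists r => //; rewrite h1 h2.
Qed.

Section Pressure.
Context {R : realType} {S : R -> R} {N : nat} {p : nat -> R}.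
Context {F F' : 'I_N.+1 -> R -> R} {c lam : R}.
Hypothesis ml : markov_lift R S N p F F' c lam.
Context {g : R -> R}.
Hypothesis g_gt0 : forall v, circle R v -> 0 < g v.
Hypothesis g_dist : bounded_distortion S g.
Hypothesis g_bounded : exists B, forall v, circle R v -> `|ln (g v)| <= B.
Implicit Types (k l : 'I_N.+1) (w : seq 'I_N.+1).
Local Notation word_cyl := (@word_cyl R S N p).
Local Notation word_itv := (@word_itv R S N p).
Local Notation mass := (@mass R S N p).
Local Notation expansion := (@expansion R S).
Local Notation gprod := (gprod S g).
Local Notation log_weight := (@log_weight R S N p g).
Local Notation psum := (@psum R 'I_N.+1 mass log_weight).

Lemma cderiv_iter k w v : word_cyl (k :: w) v ->
  `|cderiv (iter (size w).+1 S) v| = expansion (size w).+1 v.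
Proof.
move=> hv; have [|G [G' GG]] := word_lift_exists ml k w; first by exists v.
have [t ht <-] : (circ @` word_itv (k :: w)) v by rewrite word_itv_circ.
by rewrite -(wl_abs GG)// -(cderiv_lift _ G (G' t) _ _ (wl_open GG) ht (wl_S GG) (wl_der GG _ ht)).
Qed.

(** The pressure multiplies [g] over the times [0, ..., n - 1], whereas [g_n] uses [1, ..., n]; the
    two differ by boundary terms. *)
Lemma gprod_shift n v : circle R v ->
  \sum_(i < n) ln (g (iter i S v)) + ln (g (iter n S v)) = ln (g v) + ln (gprod n v).
Proof.
move=> cv; elim: n => [|n IH]; first by rewrite big_ord0 gprod0 ln1 addrC.
rewrite big_ord_recr /= IH -addrA; congr (_ + _).
rewrite [in RHS]/Defs.gprod big_nat_recr//= lnM// posrE; first exact: (gprod_gt0 ml).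
by apply: g_gt0; exact: (circle_iter ml n.+1).
Qed.

(** The terms are comparable cylinder by cylinder: [C] replaces the inverse derivative by the mass,
    and in [Y] the term [B *+ 2] pays for the shift of times and [d] for the base point. *)
Lemma pressure_sum_psum s : 0 <= s -> exists2 A : R, 0 < A & forall n, exists2 x,
  pressure_sum S g N p s n.+1 = x%:E & A^-1 * psum n.+1 s <= x <= A * psum n.+1 s.
Proof.
move=> s0; have [B hB] := g_bounded.
have [d d0 hd] := log_weightP ml g_gt0 g_dist.
have [C C1 hC] := mass_expansion ml.
have C0 : 0 < C by exact: lt_le_trans ltr01 C1.
pose Y := expR (s * (B *+ 2 + d)).
have Y0 : 0 < Y by exact: expR_gt0.
have A0 : 0 < C * Y by rewrite mulr_gt0.
pose M w := mass w * expR (- (s * log_weight w)).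
exists (C * Y) => // n.
pose f v : R := (\prod_(i < n.+1) g (iter i S v) `^ (- s)) / `|cderiv (iter n.+1 S) v|.
have key (w : n.+1.-tuple 'I_N.+1) v : cylinder S p w v ->
    (C * Y)^-1 * M w <= f v <= C * Y * M w.
  rewrite (cylinder_word ml) /f => hv.
  have hs := size_tuple w; case: (tval w) hs hv => [//|k w'] [sw] hv.
  have cv := word_cyl_circle _ _ hv.
  rewrite -sw (cderiv_iter k w')//.
  have e0 := expansion_gt0 ml _ _ hv.
  have /andP[h1 h2] := hC _ _ hv; have := hd _ _ hv.
  have := gprod_shift (size w').+1 _ cv.
  have := hB _ cv; have := hB _ (circle_iter ml (size w').+1 _ cv).
  move: e0 h1 h2; rewrite [size (k :: w')]/=.
  set e := expansion _ v => e0 h1 h2.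
  set s1 := \sum_(i < (size w').+1) _.
  have -> : \prod_(i < (size w').+1) g (iter i S v) `^ (- s) = expR (- (s * s1)).
    rewrite -mulNr /s1 mulr_sumr expR_sum; apply: eq_bigr => i _.
    by rewrite /powR gt_eqF// g_gt0//; exact: (circle_iter ml i).
  rewrite !ler_norml => /andP[? ?] /andP[? ?] hs /andP[? ?].
  have s1L : `|s1 - log_weight (k :: w')| <= B *+ 2 + d.
    by rewrite ler_norml; apply/andP; split; lra.
  have := ler_wpM2l s0 s1L; rewrite -[in X in X * `|_|](ger0_norm s0) -normrM ler_norml => /andP[l1 l2].
  have -> : expR (- (s * s1)) / e = (e^-1) * expR (- (s * s1)) by rewrite mulrC.
  rewrite /M; apply/andP; split.
    have -> : (C * Y)^-1 * (mass (k :: w') * expR (- (s * log_weight (k :: w')))) =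
      (mass (k :: w') / C) * expR (- (s * log_weight (k :: w')) - s * (B *+ 2 + d)).
      rewrite expRD [expR (- (s * (B *+ 2 + d)))]expRN -/Y; field.
      by rewrite !gt_eqF.
    apply: ler_pM; rewrite ?expR_ge0 ?divr_ge0 ?(mass_ge0 ml) ?(ltW C0)//.
      by rewrite ler_pdivrMr// mulrC ler_pdivlMr.
    by rewrite ler_expR; lra.
  have -> : C * Y * (mass (k :: w') * expR (- (s * log_weight (k :: w')))) =
      (C * mass (k :: w')) * expR (- (s * log_weight (k :: w')) + s * (B *+ 2 + d)).
    by rewrite expRD -/Y; ring.
  apply: ler_pM; rewrite ?expR_ge0 ?invr_ge0 ?(ltW e0)//.
    by rewrite -[leLHS]mul1r ler_pdivrMr// -mulrA -ler_pdivrMl// mulr1.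
  by rewrite ler_expR; lra.
have hx (w : n.+1.-tuple 'I_N.+1) : exists r : R, cylinder S p w != set0 ->
   ereal_sup [set (f v)%:E | v in cylinder S p w] = r%:E /\
   (C * Y)^-1 * M w <= r <= C * Y * M w.
  have [/set0P[v hv]|_] := boolP (cylinder S p w != set0); last by exists 0.
  have [||r e hr] := @ereal_sup_bounded R [set (f v)%:E | v in cylinder S p w] ((C * Y)^-1 * M w) (C * Y * M w).
  - by exists (f v)%:E; exists v.
  - by move=> _ [u hu <-]; exists (f u) => //; exact: key.
  by exists r.
have [x hx'] := choice hx.
exists (\sum_(w : n.+1.-tuple 'I_N.+1 | cylinder S p w != set0) x w).
  rewrite /pressure_sum -sumEFin; apply: eq_bigr => w /hx'[<- _].
  by congr ereal_sup; apply/seteqP; split.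
have -> : psum n.+1 s = \sum_(w : n.+1.-tuple 'I_N.+1 | cylinder S p w != set0) M w.
  rewrite [RHS]big_mkcond; apply: eq_bigr => w _; case: ifPn => // /negPn/eqP.
  by rewrite (cylinder_word ml) => /mass_set0; rewrite /M => ->; rewrite mul0r.
rewrite !mulr_sumr; apply/andP; split; apply: ler_sum => w /hx'[_ /andP[]//].
Qed.

(** The pressure is the slope [l] of the quasi-additive sequence [ln (psum n s)]. When it vanishes,
    what remains is the bounded error. *)
Lemma pressure_zero_bounded s : 0 <= s -> pressure S g N p s = 0%E ->
  exists C, forall n, `|ln (psum n s)| <= C.
Proof.
move=> s0; have [K [C [n0 qb]]] := quasi_bernoulli_mass ml g_gt0 g_dist.
have [C' hC] := psum_quasi_additive qb s s0.
have [l hl] := quasi_additive_limit _ (fun n => ln (psum n s)) _ hC.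
have [A A0 hA] := pressure_sum_psum s s0.
have p0 n : 0 < psum n s := psum_gt0 qb n s.
suff cv : (fun n => (n%:R^-1)%:E * lne (pressure_sum S g N p s n))%E @ \oo --> l%:E.
  rewrite /pressure (cvg_lim _ cv)// => -[l0].
  by exists C' => n; have := hl n; rewrite l0 mul0r subr0.
rewrite -(cvg_shiftn 1)/=.
have [y hy] := choice (fun n => let: ex_intro2 x h1 h2 := hA n in ex_intro (fun x =>
   pressure_sum S g N p s n.+1 = x%:E /\ A^-1 * psum n.+1 s <= x <= A * psum n.+1 s) x (conj h1 h2)).
have y0 n : 0 < y n.
  have [_ /andP[h _]] := hy n; apply: lt_le_trans h; by rewrite mulr_gt0// invr_gt0.
have -> : (fun n => ((n + 1)%:R^-1)%:E * lne (pressure_sum S g N p s (n + 1)))%E =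
   (fun n => (n.+1%:R^-1 * ln (y n))%:E).
  apply/funext => n; rewrite addn1; have [-> _] := hy n.
  by rewrite lne_EFin// EFinM.
apply: cvg_EFin; first by apply: nearW.
have -> : fine \o (fun n => (n.+1%:R^-1 * ln (y n))%:E) = (fun n => n.+1%:R^-1 * ln (y n)) by [].
pose b := C' + `|ln A|.
have hyl n : `|ln (y n) - l * n.+1%:R| <= b.
  have [_ /andP[h1 h2]] := hy n; have := hl n.+1.
  have h3 : ln (y n) <= ln A + ln (psum n.+1 s).
    by rewrite -lnM ?posrE// ler_ln ?posrE ?mulr_gt0.
  have h4 : - ln A + ln (psum n.+1 s) <= ln (y n).
    by rewrite -lnV ?posrE// -lnM ?posrE ?invr_gt0// ler_ln ?posrE ?mulr_gt0 ?invr_gt0.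
  have := ler_norm (ln A).
  rewrite /b !ler_norml => ? /andP[? ?]; apply/andP; split; lra.
apply/cvgrPdist_le => e e0.
have b0 : 0 <= b by exact: le_trans (normr_ge0 _) (hyl 0%N).
exists (Num.truncn (b / e)).+1 => // n /= hn.
have -> : l - n.+1%:R^-1 * ln (y n) = n.+1%:R^-1 * (l * n.+1%:R - ln (y n)).
  by rewrite mulrBr mulrCA mulVf ?mulr1// pnatr_eq0.
rewrite normrM ger0_norm// distrC -ler_pdivlMl ?invr_gt0 ?ltr0n// invrK.
apply: (le_trans (hyl n)); rewrite -ler_pdivrMr//.
apply: (le_trans (ltW (truncnS_gt _))).
by rewrite ler_nat; exact: leqW.
Qed.

End Pressure.

(** * The drift given by the invariant density *)

(** Absolute continuity in its epsilon-delta form, through the variation of [mu] viewed as a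
    charge. *)
Lemma dominated_small (R : realType) (mu : probability (measurableTypeR R) R) :
  mu `<< lebesgue_measure -> forall e : R, 0 < e -> exists2 d : R, 0 < d &
  forall A, measurable A -> (lebesgue_measure A < d%:E)%E -> (mu A < e%:E)%E.
Proof.
move=> dom e e0.
pose nu := charge_of_finite_measure mu.
have [P [Q PQ]] := Hahn_decomposition nu.
have [d [d0 hd]] := charge_variation_continuous (nu := nu) PQ (mu := lebesgue_measure) dom e0.
exists d => // A mA /(hd A mA); apply: le_lt_trans.
apply: le_trans (abse_charge_variation PQ mA).
by rewrite /nu /charge_of_finite_measure lee_abs.
Qed.

Section Drift.
Context {R : realType} {S : R -> R} {N : nat} {p : nat -> R}.
Context {F F' : 'I_N.+1 -> R -> R} {c lam : R}.
Hypothesis ml : markov_lift R S N p F F' c lam.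
Context {g : R -> R}.
Hypothesis g_gt0 : forall v, circle R v -> 0 < g v.
Hypothesis g_meas : measurable_fun (circle R : set (measurableTypeR R))
    (g : measurableTypeR R -> measurableTypeR R).
Hypothesis g_dist : bounded_distortion S g.
Hypothesis g_bounded : exists B, forall v, circle R v -> `|ln (g v)| <= B.
Implicit Types (k l : 'I_N.+1) (w : seq 'I_N.+1).
Local Notation word_cyl := (@word_cyl R S N p).
Local Notation mass := (@mass R S N p).
Local Notation gprod := (gprod S g).
Local Notation log_weight := (@log_weight R S N p g).
Local Notation T := (measurableTypeR R).

Let mcircle : measurable (circle R : set T). Proof. exact: measurable_itv. Qed.

(** On [Q k j i] the map is [F k (v + j) - i]: the integer [j] lifts [v] to the branch [k] and [i]
    is the integer part of the image. With the partition points these countably many pieces make up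
    the circle. *)
Lemma S_measurable : measurable_fun (circle R : set T) (S : T -> T).
Proof.
pose Q k (j i : int) : set T := [set v | [/\ circle R v, v + j%:~R \in `]p k, p k.+1[ &
  i%:~R <= F k (v + j%:~R) < (i + 1)%:~R]].
pose piece (x : 'I_N.+1 * int * int + nat) : set T := match x with
  | inl (k, j, i) => Q k j i | inr i => [set circ (p i)] end.
pose E n : set T := oapp piece set0 (unpickle n).
have Pm k (j : int) : measurable_fun (`]p k - j%:~R, p k.+1 - j%:~R[%classic : set T)
    ((fun v => F k (v + j%:~R)) : T -> T).
  apply: open_continuous_measurable_fun; first exact: interval_open.
  move=> v; rewrite inE /= in_itv/= => /andP[h1 h2].
  have vk : v + j%:~R \in `]p k, p k.+1[ by rewrite in_itv/=; apply/andP; split; lra.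
  apply: (continuous_comp (f := fun v : R => v + j%:~R) (g := F k)).
    by apply: continuousD; [exact: cvg_id|exact: cst_continuous].
  by apply: differentiable_continuous; apply/derivable1_diffP; case: (ml_der ml k _ vk).
have Qm k j i : measurable (Q k j i).
  have -> : Q k j i = circle R `&` (`]p k - j%:~R, p k.+1 - j%:~R[%classic `&`
     (fun v => F k (v + j%:~R)) @^-1` [set` `[i%:~R, (i + 1)%:~R[]).
    apply/seteqP; split=> v /=.
      move=> [cv]; rewrite in_itv/= => /andP[h1 h2] h3.
      by split=> //; split; rewrite /= in_itv//=; apply/andP; split; lra.
    move=> [cv [+ h3]]; rewrite in_itv/= => /andP[h1 h2]; split => //.
    by rewrite in_itv/=; apply/andP; split; lra.
  apply: measurableI => //; apply: Pm; exact: measurable_itv.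
have Em n : measurable (E n).
  by rewrite /E; case: (unpickle n) => [[[[k j] i]|i]|]; rewrite /=.
have Epiece x v : piece x v -> (\bigcup_n E n) v.
  by move=> h; exists (pickle x); [exact: I|rewrite /E pickleK].
have hE : circle R = \bigcup_n E n.
  apply/seteqP; split=> v.
    move=> cv; have [[i iN ->]|[k [t tk tv]]] := circle_cover ml v cv.
      exact: (Epiece (inr i)).
    have e : v + (Num.floor t)%:~R = t by rewrite -tv /circ subrK.
    apply: (Epiece (inl (k, Num.floor t, Num.floor (F k t)))).
    by split; rewrite ?e//; exact: floor_itv.
  move=> [n _]; rewrite /E; case: (unpickle n) => [[[[k j] i]|i]|] //=.
    by case.
  by move=> ->; exact: circ_circle.
rewrite hE; apply/measurable_fun_bigcup => // n; rewrite /E.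
case: (unpickle n) => [[[[k j] i]|i]|] /=.
- apply: (eq_measurable_fun (fun v : T => F k (v + j%:~R) - i%:~R)).
    move=> v; rewrite inE => -[cv vk /floor_def Fi].
    have -> : S v = circ (F k (v + j%:~R)) by rewrite -(ml_F ml k _ vk) circD circ_id.
    by rewrite /circ Fi.
  apply: measurable_funB => //; apply: measurable_funS (Pm k j) => // v [_ + _].
  by rewrite /= !in_itv/= => /andP[h1 h2]; apply/andP; split; lra.
- exact: measurable_fun_set1.
- exact: measurable_fun_set0.
Qed.

Variable mu : probability T R.
Hypothesis mu_inv : invariant_prob S mu.
Hypothesis mu_ac : mu `<< lebesgue_measure.
Hypothesis mu_gap : (0 < log_integral g mu)%E.

(** Default values off the circle, a [mu]-null set, turn [S] and [ln g] into total functions, to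
    which the pushforward formula applies. *)
Let S1 : T -> T := S \_ (circle R).
Let X : T -> R := (fun v => ln (g v)) \_ (circle R).

Let S1E v : circle R v -> S1 v = S v.
Proof. by move=> cv; rewrite /S1 patchE mem_set. Qed.

Let S1_meas : measurable_fun setT S1.
Proof. exact: (measurable_restrictT (S : T -> T) mcircle).1 S_measurable. Qed.

Let X_meas : measurable_fun setT X.
Proof.
have mlg : measurable_fun (circle R : set T) ((@ln R : T -> T) \o (g : T -> T)).
  by apply: measurableT_comp g_meas; exact: measurable_ln.
exact: (measurable_restrictT _ mcircle).1 mlg.
Qed.

Let Sn_meas n : measurable_fun setT (iter n S1).
Proof. by elim: n => [|n IH] /=; [exact: measurable_id|exact: measurableT_comp]. Qed.

Let X_bound : exists2 B, 0 < B & forall v, `|X v| <= B.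
Proof.
have [B hB] := g_bounded; exists (`|B| + 1); first by rewrite ltr_wpDl.
move=> v; rewrite /X patchE; case: ifPn => [|_].
  by rewrite inE => /hB /le_trans; apply; rewrite (le_trans (ler_norm _))// lerDl.
by rewrite normr0 addr_ge0.
Qed.

Let bounded_integrable (f : T -> R) (B : R) : measurable_fun setT f ->
  (forall v, `|f v| <= B) -> mu.-integrable setT (EFin \o f).
Proof.
move=> mf hf; apply: measurable_bounded_integrable => //.
  by apply: (le_lt_trans (probability_le1 mu _)); rewrite ?ltry.
exists B; split => //; first exact: num_real.
by move=> M BM v _ /=; exact: le_trans (hf v) (ltW BM).
Qed.

(** Invariance passes to [S1] because the complement of the circle is null; a change of variables
    then removes one iterate at a time. *)
Let integral_invariant n :
  (\int[mu]_v (X (iter n S1 v))%:E = log_integral g mu)%E.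
Proof.
have [B B0 hB] := X_bound.
elim: n => [|n IH] /=.
  rewrite /log_integral [RHS]integral_mkcond; apply: eq_integral => v _.
  by rewrite /X !patchE; case: ifP.
rewrite -IH.
transitivity (\int[pushforward mu S1]_v (X (iter n S1 v))%:E)%E.
  rewrite integral_pushforward//.
  - by rewrite preimage_setT; apply: eq_integral => v _; rewrite /= -iterSr.
  - by apply/measurable_EFinP; exact: measurableT_comp.
  - rewrite preimage_setT; apply: (@bounded_integrable (fun v => X (iter n S1 (S1 v))) B).
      exact: (measurableT_comp X_meas (measurableT_comp (Sn_meas n) S1_meas)).
    by move=> v; exact: hB.
apply: eq_measure_integral => A mA _.
have [mu1 hmu] := mu_inv.
suff h : mu (S1 @^-1` A) = mu A by exact: h.
rewrite -(hmu A mA).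
have mS : measurable (S1 @^-1` A) by rewrite -[_ @^-1` _]setTI; exact: S1_meas.
have mC : mu (~` circle R) = 0%E.
  by rewrite probability_setC// mu1 -EFinB subrr.
have mD : mu (S1 @^-1` A `\` circle R) = 0%E.
  apply: subset_measure0 mC; [exact: measurableD|exact: measurableC|by move=> v []].
apply: (etrans (measureDI mu mS mcircle)).
apply: (etrans (f_equal2 (fun a b => (a + b)%E) mD erefl)).
rewrite add0e; congr (mu _); apply/seteqP; split=> v [h1 h2]; split => //.
  by move: h1; rewrite /preimage/= S1E.
by rewrite /preimage /= S1E.
Qed.

Let birkhoff n v : R := \sum_(i < n) X (iter i.+1 S1 v).

Let birkhoff_meas n : measurable_fun setT (birkhoff n).
Proof.
apply: measurable_sum => i; exact: (measurableT_comp X_meas (Sn_meas i.+1)).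
Qed.

Let birkhoffE n v : circle R v -> birkhoff n v = ln (gprod n v).
Proof.
move=> cv; have h i : iter i S1 v = iter i S v.
  by elim: i => //= i ->; rewrite S1E//; exact: (circle_iter ml).
elim: n => [|n IH]; first by rewrite /birkhoff big_ord0 gprod0 ln1.
rewrite /birkhoff big_ord_recr -/(birkhoff n v) IH.
have cn := circle_iter ml n.+1 _ cv.
have -> : gprod n.+1 v = gprod n v * g (iter n.+1 S v) by rewrite /Defs.gprod big_nat_recr.
rewrite lnM ?posrE; last 2 first.
- exact: (gprod_gt0 ml).
- exact: g_gt0.
by congr (_ + _); rewrite /X patchE mem_set ?h//; exact: cn.
Qed.

Let birkhoff_integral n (d : R) : log_integral g mu = d%:E ->
  (\int[mu]_v (birkhoff n v)%:E = (n%:R * d)%:E)%E.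
Proof.
move=> hd; have [B B0 hB] := X_bound.
under eq_integral do rewrite /birkhoff -sumEFin.
rewrite integral_sum//; last first.
  move=> i; apply: (@bounded_integrable (fun v => X (iter i.+1 S1 v)) B) => //.
  exact: (measurableT_comp X_meas (Sn_meas i.+1)).
under eq_bigr do rewrite integral_invariant hd.
by rewrite sumEFin sumr_const card_ord mulr_natl.
Qed.

(* The Birkhoff sums have mean [n d] and are at most [n B], so they exceed
   [n d / 2] with [mu]-probability at least [d / (2 B)]; absolute continuity turns
   this into a uniform lower bound for Lebesgue measure. *)
Lemma mass_drift : exists2 d : R, 0 < d & forall H, exists n,
  d <= \sum_(w : n.-tuple 'I_N.+1 | H <= log_weight w) mass w.
Proof.
have [B B0 hB] := X_bound.
have [d hd] : exists d : R, log_integral g mu = d%:E.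
  have := integral_invariant 0; have := @bounded_integrable X B X_meas hB.
  move=> /integrable_fin_num h <-; exists (fine (\int[mu]_v (X v)%:E)%E).
  by rewrite fineK// h.
have d0 : 0 < d by move: mu_gap; rewrite hd lte_fin.
have [e e0 he] := log_weightP ml g_gt0 g_dist.
pose q := d / (2 * B).
have q0 : 0 < q by rewrite divr_gt0// mulr_gt0.
have [eta eta0 heta] := dominated_small R mu mu_ac q q0.
exists eta => // H.
(* Makes half the mean, [n d / 2], at least [H + e]; the margin [e] pays for passing from Birkhoff
   sums to [log_weight]. *)
pose n := (Num.truncn (2 * (`|H| + e) / d)).+1.
have hn : H + e <= n%:R * (d / 2).
  have : 2 * (`|H| + e) / d < n%:R by apply: truncnS_gt.
  rewrite ltr_pdivrMr//; have := ler_norm H; lra.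
exists n; rewrite leNgt; apply/negP => small.
pose A : set T := [set v | n%:R * (d / 2) <= birkhoff n v].
have mA : measurable A.
  have -> : A = setT `&` birkhoff n @^-1` `[n%:R * (d / 2), +oo[%classic.
    by apply/seteqP; split=> v /=; rewrite in_itv/= andbT => // -[].
  by apply: birkhoff_meas => //; exact: measurable_itv.
have muA : (q%:E <= mu A)%E.
  have h : ((n%:R * d)%:E <= \int[mu]_v ((n%:R * (d / 2))%:E + ((n%:R * B) * \1_A v)%:E))%E.
    rewrite -(birkhoff_integral n d hd); apply: le_integral => //.
    - apply: (@bounded_integrable _ (n%:R * B)) => // v; rewrite /birkhoff.
      apply: (le_trans (ler_norm_sum _ _ _)).
      rewrite (_ : n%:R * B = \sum_(i < n) B); last by rewrite sumr_const card_ord mulr_natl.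
      by apply: ler_sum => i _; exact: hB.
    - apply: (@bounded_integrable (fun v => n%:R * (d / 2) + (n%:R * B) * \1_A v) (n%:R * (d / 2) + n%:R * B)).
        apply: measurable_funD => //; apply: measurable_funM => //.
      move=> v; have k1 : 0 <= n%:R * (d / 2) by rewrite mulr_ge0// divr_ge0// ltW.
      have k2 : 0 <= n%:R * B by rewrite mulr_ge0// ltW.
      rewrite indicE ger0_norm ?addr_ge0 ?mulr_ge0//; case: (v \in A); rewrite ?mulr1 ?mulr0; lra.
    - move=> v _; rewrite -EFinD lee_fin indicE; case: (boolP (v \in A)) => vA.
        rewrite mulr1; apply: (@le_trans _ _ (n%:R * B)); last first.
          by rewrite lerDr mulr_ge0// divr_ge0// ltW.
        rewrite /birkhoff (_ : n%:R * B = \sum_(i < n) B); last by rewrite sumr_const card_ord mulr_natl.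
        by apply: ler_sum => i _; exact: le_trans (ler_norm _) (hB _).
      rewrite mulr0 addr0 leNgt; apply/negP => h; move/negP: vA; apply; rewrite inE; exact: ltW.
  have e1 : (\int[mu]_v ((n%:R * (d / 2))%:E + ((n%:R * B) * \1_A v)%:E) =
     (n%:R * (d / 2))%:E + (n%:R * B)%:E * mu A)%E.
    rewrite integralD//; last 2 first.
    - by apply: (@bounded_integrable (cst (n%:R * (d / 2))) `|n%:R * (d / 2)|).
    - apply: (@bounded_integrable (fun v => (n%:R * B) * \1_A v) (n%:R * B)).
        by apply: measurable_funM.
      move=> v; have k2 : 0 <= n%:R * B by rewrite mulr_ge0// ltW.
      rewrite indicE ger0_norm ?mulr_ge0//; case: (v \in A); rewrite ?mulr1 ?mulr0; lra.
    congr (_ + _)%E.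
      by rewrite -[X in _ = X]mule1 -(@probability_setT _ _ _ mu) -integral_cst.
    under eq_integral do rewrite EFinM.
    rewrite integralZl//; last first.
      apply: (@bounded_integrable (\1_A : T -> R) 1) => // v.
      by rewrite indicE; case: (v \in A); rewrite ?normr1 ?normr0.
    by rewrite integral_indic// setIT.
  have fA : mu A \is a fin_num by rewrite fin_num_measure.
  move: h; rewrite e1 -(fineK fA) -EFinM -EFinD !lee_fin.
  have n0 : 0 < n%:R :> R by rewrite ltr0n.
  set x := fine _ => h; rewrite /q ler_pdivrMr ?mulr_gt0//.
  have : n%:R * d <= n%:R * (d / 2 + B * x) by lra.
  rewrite ler_pM2l//; lra.
pose W : set T := \bigcup_(w in [set w : n.-tuple 'I_N.+1 | H <= log_weight w]) word_cyl w.
have [mW eW] : measurable W /\ lebesgue_measure W =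
    (\sum_(w : n.-tuple 'I_N.+1 | (H <= log_weight w)%R) lebesgue_measure (word_cyl w : set T))%E.
  apply: measure_finite_partition => [w|w1 w2 x h1 h2|x].
  - exact: (word_cyl_measurable ml).
  - exact: (word_cyl_inj ml _ _ _ _ h1 h2).
  - by split=> [[w ? ?]|[w ? ?]]; exists w.
have muW : (mu W < q%:E)%E.
  apply: heta => //; rewrite eW.
  under eq_bigr do rewrite (massE ml).
  by rewrite sumEFin lte_fin.
have [mE eE] := exceptional_negligible ml n.
have muE : mu (@exceptional R S N p n : set T) = 0%E.
  by apply: (null_content_dominatesP mu lebesgue_measure).1.
have muC : mu (~` circle R : set T) = 0%E.
  by rewrite probability_setC// (proj1 mu_inv) -EFinB subrr.
suff : (mu A <= mu W)%E by move=> /(le_trans muA)/le_lt_trans/(_ muW); rewrite ltxx.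
have mCc : measurable (~` circle R : set T) by exact: measurableC.
(* A large Birkhoff sum forces a large [log_weight] of the cylinder; points without an itinerary or
   off the circle are [mu]-null. *)
have sub : A `<=` W `|` ((@exceptional R S N p n : set T) `|` ~` circle R).
  move=> v Av; have [cv|ncv] := pselect (circle R v); last by right; right.
  have [Ev|nEv] := pselect (@exceptional R S N p n v); first by right; left.
  have [w hw] := word_cyl_cover ml _ _ cv nEv.
  left; exists w => //=; have := he _ _ hw; rewrite size_tuple -birkhoffE//.
  rewrite ler_norml => /andP[h1 _]; move: Av; rewrite /A /= => Av; lra.
have mEC : measurable ((@exceptional R S N p n : set T) `|` ~` circle R) by exact: measurableU.
apply: (@le_trans _ _ (mu (W `|` ((@exceptional R S N p n : set T) `|` ~` circle R)))).
  by apply: le_measure; rewrite ?inE//; exact: measurableU.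
by rewrite measureU0//= measureU0.
Qed.

End Drift.

(** * The invariant graph *)

Section Fibre.
Context {R : realType} {a : R} {h S g : R -> R}.
Hypotheses (a_gt0 : 0 < a) (hh : fibre_map a h).
Hypothesis S_circle : forall v, circle R v -> circle R (S v).
Hypothesis g_pos : forall v, circle R v -> 0 < g v /\ g v * h a <= a.

Lemma fibre_scale (t x : R) : 0 <= t <= 1 -> 0 <= x <= a -> t * h x <= h (t * x).
Proof.
move=> t01 x0a; have [_ cv _ h0 _] := hh.
have /andP[t0 t1] := t01.
pose T : {i01 R} := Itv01 t0 t1.
have x_in : [set` `[0, a]] x by rewrite /= in_itv.
have z_in : [set` `[0, a]] 0 by rewrite /= in_itv/= lexx ltW.
have : - h (t * x + (1 - t) * 0) <= t * (- h x) + (1 - t) * (- h 0).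
  exact: cv T x 0 (mem_set x_in) (mem_set z_in).
by rewrite h0 oppr0 !mulr0 !addr0 mulrN lerN2.
Qed.

Lemma fibre_slope : forall e, 0 < e -> exists2 d, 0 < d &
  forall y, 0 < y <= a -> y < d -> `|h y / y - 1| <= e.
Proof.
move=> e e0; have [_ _ _ h0 [h' [dh _ h'0]]] := hh.
have : `[0, a]%classic 0 by rewrite /= in_itv/= lexx ltW.
move/(dh 0); rewrite h'0 h0 => /cvgrPdist_le/(_ e e0) hn.
have {}hn : nbhs (0 : R) (fun y => y != 0 -> `[0, a]%classic y -> `|1 - (h y - 0) / (y - 0)| <= e) := hn.
have [d /= d0 hd] := (nbhs_ballP _ _).1 hn; exists d => // y /andP[y0 ya] yd.
have := hd y; rewrite /ball /= sub0r normrN gtr0_norm// !subr0 distrC; apply => //.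
  by rewrite gt_eqF.
by rewrite in_itv/= ya ltW.
Qed.

(** By concavity and [h 0 = 0] the slope [h x / x] does not increase with [x], and it tends to
    [h' 0 = 1] at 0. *)
Lemma fibre_le_id x : 0 <= x <= a -> h x <= x.
Proof.
move=> /andP[]; rewrite le_eqVlt => /predU1P[<- _|x0 xa].
  by have [_ _ _ -> _] := hh.
rewrite -[leRHS]mul1r -ler_pdivrMr//; apply/ler_addgt0Pr => e e0.
have [d d0 hd] := fibre_slope e e0.
pose y := Num.min x (d / 2).
have y0 : 0 < y by rewrite lt_min x0 divr_gt0.
have yx : y <= x by rewrite ge_min lexx.
have yd : y < d by rewrite gt_min; apply/orP; right; lra.
have := hd y; rewrite y0 (le_trans yx xa) => /(_ isT yd); rewrite ler_norml => /andP[_ h1].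
have : (y / x) * h x <= h ((y / x) * x).
  apply: fibre_scale; last by rewrite xa ltW.
  by rewrite divr_ge0 ?(ltW y0) ?(ltW x0)//= ler_pdivrMr// mul1r.
rewrite divfK ?gt_eqF// => h2.
have : h x / x <= h y / y.
  by rewrite ler_pdivlMr//; rewrite (_ : h x / x * y = y / x * h x)//; ring.
lra.
Qed.

(** At a point [r] close to 0 the slope is at least [e^(-eta)]; concavity carries this to all
    smaller points, monotonicity bounds [h] by its value at [r] beyond. *)
Lemma fibre_ge_min eta : 0 < eta -> exists2 r, 0 < r <= a &
  forall x, 0 <= x <= a -> expR (- eta) * Num.min x r <= h x.
Proof.
move=> eta0; pose e := 1 - expR (- eta).
have e0 : 0 < e by rewrite subr_gt0 -[ltRHS]expR0 ltr_expR oppr_lt0.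
have [d d0 hd] := fibre_slope e e0.
pose r := Num.min a (d / 2).
have r0 : 0 < r by rewrite lt_min a_gt0 divr_gt0.
have ra : r <= a by rewrite ge_min lexx.
have rd : r < d by rewrite gt_min; apply/orP; right; lra.
have hr : expR (- eta) * r <= h r.
  have := hd r; rewrite r0 ra => /(_ isT rd); rewrite ler_norml => /andP[h1 _].
  by rewrite -ler_pdivlMr//; move: h1; rewrite /e; lra.
exists r; first by rewrite r0.
move=> x /andP[x0 xa]; have [xr|rx] := leP x r.
  apply: (@le_trans _ _ ((x / r) * h r)).
    have : expR (- eta) * r * (x / r) <= h r * (x / r).
      by rewrite ler_wpM2r// divr_ge0// ltW.
    have -> : expR (- eta) * r * (x / r) = expR (- eta) * x by field; rewrite gt_eqF.
    by rewrite [leRHS]mulrC.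
  have : (x / r) * h r <= h ((x / r) * r).
    apply: fibre_scale; last by rewrite ltW.
    by rewrite divr_ge0 ?(ltW r0)//= ler_pdivrMr// mul1r.
  by rewrite divfK ?gt_eqF.
apply: (le_trans hr); have [mono _ _ _ _] := hh.
by apply/ltW/mono => //; rewrite in_itv/= ?x0 ?xa// ltW//= ra.
Qed.

Let h_mono x y : 0 <= x -> x <= y -> y <= a -> h x <= h y.
Proof.
move=> x0; rewrite le_eqVlt => /predU1P[->//|xy] ya; have [mono _ _ _ _] := hh.
apply/ltW/mono => //; rewrite in_itv/= ?x0/=.
  exact: le_trans (ltW xy) ya.
by rewrite ya andbT (le_trans x0)// ltW.
Qed.

Let h_ge0 x : 0 <= x <= a -> 0 <= h x.
Proof. by move=> hx; have [_ _ + _ _] := hh; apply; rewrite in_itv. Qed.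

Lemma fiter_itv n v x : circle R v -> 0 <= x <= a -> 0 <= fiter h S g n v x <= a.
Proof.
elim: n v => [//|n IH] v cv hx /=.
have /andP[y0 ya] := IH _ (S_circle _ cv) hx.
have [g0 ga] := g_pos _ (S_circle _ cv).
rewrite mulr_ge0 ?(ltW g0)//= ?h_ge0 ?y0//; apply: le_trans ga.
by rewrite ler_pM2l//; exact: h_mono.
Qed.

Let a0a : 0 <= a <= a. Proof. by rewrite lexx ltW. Qed.

Lemma fiter_nonincreasing v : circle R v ->
  nonincreasing_seq (fun n => fiter h S g n v a).
Proof.
move=> cv; apply/nonincreasing_seqP => n; elim: n v cv => [|n IH] v cv.
  by have [_] := g_pos _ (S_circle _ cv).
have [g0 _] := g_pos _ (S_circle _ cv).
have cSv := S_circle _ cv.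
rewrite [leLHS]/= [leRHS]/= ler_pM2l//; apply: h_mono; [|exact: IH|].
  by have /andP[] := fiter_itv n.+1 _ _ cSv a0a.
by have /andP[] := fiter_itv n _ _ cSv a0a.
Qed.

Lemma phi_inf_cvg v : circle R v -> cvgn (fun n => fiter h S g n v a).
Proof.
move=> cv; apply: nonincreasing_is_cvgn; first exact: fiter_nonincreasing.
by exists 0 => _ [n _ <-]; have /andP[] := fiter_itv n _ _ cv a0a.
Qed.

Lemma phi_inf_ge0 v : circle R v -> 0 <= phi_inf a h S g v.
Proof.
move=> cv; apply: limr_ge; first exact: phi_inf_cvg.
by apply: nearW => n; have /andP[] := fiter_itv n _ _ cv a0a.
Qed.

Lemma phi_inf_le n v : circle R v -> phi_inf a h S g v <= fiter h S g n v a.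
Proof.
move=> cv; apply: nonincreasing_cvgn_ge; first exact: fiter_nonincreasing.
exact: phi_inf_cvg.
Qed.

Lemma phi_inf_lt v e : circle R v -> phi_inf a h S g v < e ->
  exists n, fiter h S g n v a < e.
Proof.
move=> cv pe; have /cvgrPdist_lt/(_ (e - phi_inf a h S g v)) := phi_inf_cvg _ cv.
rewrite subr_gt0 => /(_ pe)[n _ /(_ n (leqnn n))]; rewrite -/(phi_inf _ _ _ _ _) distrC => hn.
by exists n; have := ler_norm (fiter h S g n v a - phi_inf a h S g v); lra.
Qed.

Lemma fiter_le_gprod n v : circle R v -> fiter h S g n v a <= a * gprod S g n v.
Proof.
elim: n v => [|n IH] v cv; first by rewrite gprod0 mulr1.
have [g0 _] := g_pos _ (S_circle _ cv).
rewrite gprodS /= mulrCA ler_pM2l//; apply: le_trans (IH _ (S_circle _ cv)).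
exact/fibre_le_id/fiter_itv/a0a/S_circle.
Qed.

(** Whenever the inner iterate is at least [r], the estimate restarts from [r], whatever happened
    before. So [j] counts the steps since the last restart, each losing a factor [e^(-eta)]. *)
Lemma fiter_ge_gprod eta r n v : 0 < r <= a ->
  (forall x, 0 <= x <= a -> expR (- eta) * Num.min x r <= h x) -> circle R v ->
  exists j, r * expR (- (eta * j%:R)) * gprod S g j v <= fiter h S g n v a.
Proof.
move=> /andP[r0 ra] hr; elim: n v => [|n IH] v cv.
  by exists 0%N; rewrite mulr0 oppr0 expR0 gprod0 !mulr1.
have [g0 _] := g_pos _ (S_circle _ cv).
have y0a := fiter_itv n _ _ (S_circle _ cv) a0a.
have /= := hr _ y0a; set y := fiter h S g n (S v) a => hy.
have [ry|yr] := leP r y.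
  exists 1%N; rewrite mulr1 gprodS gprod0 mulr1 mulrC ler_pM2l// mulrC.
  by apply: le_trans hy; rewrite ler_wpM2l ?expR_ge0// le_min ry lexx.
have [j hj] := IH _ (S_circle _ cv); exists j.+1.
rewrite gprodS mulrCA ler_pM2l//; apply: le_trans hy.
have -> : Num.min y r = y by apply/min_idPl/ltW.
apply: le_trans (ler_wpM2l (expR_ge0 _) hj).
by rewrite -natr1 mulrDr mulr1 opprD expRD le_eqVlt; apply/orP; left; apply/eqP; ring.
Qed.

End Fibre.

(* [lebesgue_measure] is the Lebesgue outer measure, so these hold without
   measurability. *)
Lemma le_lebesgue (R : realType) (X Y : set (measurableTypeR R)) :
  X `<=` Y -> (lebesgue_measure X <= lebesgue_measure Y)%E.
Proof. by move=> XY; exact: (@le_mu_ext _ (ocitv_type R) R (wlength idfun) X Y XY). Qed.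

Lemma lebesgue_bigcup (R : realType) (X : (set (measurableTypeR R))^nat) :
  (lebesgue_measure (\bigcup_n X n) <= \sum_(n <oo) lebesgue_measure (X n))%E.
Proof. exact: (@mu_ext_sigma_subadditive _ (ocitv_type R) R (wlength idfun)). Qed.

Lemma nneseries_geometric_le (R : realType) (u : (\bar R)^nat) (C k : R) : 0 < k -> 0 <= C ->
  (forall n, (0 <= u n)%E) -> (forall n, (u n <= (C * expR (- (k * n%:R)))%:E)%E) ->
  (\sum_(n <oo) u n <= (C / (1 - expR (- k)))%:E)%E.
Proof.
move=> k0 C0 u0 hu; pose q := expR (- k).
have q0 : 0 < q by exact: expR_gt0.
have q1 : q < 1 by rewrite /q -[ltRHS]expR0 ltr_expR oppr_lt0.
apply: lime_le; first by apply: is_cvg_nneseries.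
apply: nearW => n; apply: (@le_trans _ _ (\sum_(i < n) C * q ^+ i)%:E).
  rewrite big_mkord -sumEFin; apply: lee_sum => i _.
  by rewrite /q -expRM_natr mulNr; exact: hu.
rewrite lee_fin -mulr_sumr ler_wpM2l// -/q.
have := subrX1 q n; set s := \sum_(i < n) _ => e1.
rewrite -[leRHS]mul1r ler_pdivlMr ?subr_gt0//.
have := exprn_ge0 n (ltW q0); rewrite -[1 - q]opprB mulrN mulrC -e1; lra.
Qed.

(** * Tail bounds for the graph *)

Section Tail.
Context {R : realType} {a : R} {h S g : R -> R} {N : nat} {p : nat -> R}.
Context {F F' : 'I_N.+1 -> R -> R} {c lam : R}.
Hypotheses (a_gt0 : 0 < a) (hh : fibre_map a h).
Hypothesis ml : markov_lift R S N p F F' c lam.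
Hypothesis g_pos : forall v, circle R v -> 0 < g v /\ g v * h a <= a.
Hypothesis g_dist : bounded_distortion S g.
Local Notation word_cyl := (@word_cyl R S N p).
Local Notation mass := (@mass R S N p).
Local Notation gprod := (gprod S g).
Local Notation log_weight := (@log_weight R S N p g).
Local Notation psums := (@psum R 'I_N.+1 mass log_weight).
Local Notation T := (measurableTypeR R).

Definition small_phi (e : R) : set T := [set v | circle R v /\ phi_inf a h S g v < e].

Let S_circle : forall v, circle R v -> circle R (S v) := ml_circle ml.
Let g_gt0 v : circle R v -> 0 < g v. Proof. by move=> /g_pos[]. Qed.

Lemma words_measure n (P : pred (n.-tuple 'I_N.+1)) :
  let W := \bigcup_(w in [set w | P w]) word_cyl (w : n.-tuple 'I_N.+1) : set T in
  lebesgue_measure W = (\sum_(w | P w) mass w)%:E.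
Proof.
move=> W; have [_ ->] : measurable W /\ lebesgue_measure W =
    (\sum_(w : n.-tuple 'I_N.+1 | P w) lebesgue_measure (word_cyl w : set T))%E.
  apply: measure_finite_partition => [w|w1 w2 x h1 h2|x].
  - exact: (word_cyl_measurable ml).
  - exact: (word_cyl_inj ml _ _ _ _ h1 h2).
  - by split=> [[w ? ?]|[w ? ?]]; exists w.
rewrite -sumEFin; apply: eq_bigr => w _; exact: (massE ml).
Qed.

Lemma tail_lower (s t : R) : 0 < s < t ->
  (forall t', s < t' -> exists x0, forall x, x0 <= x -> exists n,
    expR (- (t' * x)) <= \sum_(w : n.-tuple 'I_N.+1 | log_weight w <= - x) mass w) ->
  exists x0, forall x, x0 <= x ->
    ((expR (- (t * x)))%:E <= lebesgue_measure (small_phi (expR (- x))))%E.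
Proof.
move=> /andP[s0 st] dev; pose t' := (s + t) / 2.
have [st' t't] : s < t' /\ t' < t by rewrite /t'; split; lra.
have [x0 hx0] := dev t' st'.
have [d d0 hd] := log_weightP ml g_gt0 g_dist.
(* Absorbs the factor [a] and the change of base point; the 1 makes the inequality strict. *)
pose K := `|ln a| + d + 1.
have K0 : 0 <= K by rewrite !addr_ge0.
exists (Num.max x0 (t' * K / (t - t'))) => x; rewrite ge_max => /andP[x0x].
rewrite ler_pdivrMr ?subr_gt0// => xt.
have [|n hn] := hx0 (x + K); first by rewrite (le_trans x0x)// lerDl.
pose W : set T := \bigcup_(w in [set w : n.-tuple 'I_N.+1 | log_weight w <= - (x + K)]) word_cyl w.
apply: (@le_trans _ _ (lebesgue_measure W)).
  rewrite words_measure lee_fin; apply: le_trans hn.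
  rewrite ler_expR; move: xt; lra.
apply: le_lebesgue => v [w /= hw hv].
have cv := word_cyl_circle _ _ hv; split => //.
apply: le_lt_trans (phi_inf_le a_gt0 hh S_circle g_pos n v cv) _.
apply: le_lt_trans (fiter_le_gprod a_gt0 hh S_circle g_pos n v cv) _.
have gn := gprod_gt0 ml g_gt0 n v cv.
rewrite -ltr_ln ?posrE ?mulr_gt0 ?expR_gt0// lnM ?posrE// expRK.
have := hd _ _ hv; rewrite size_tuple ler_norml => /andP[h1 h2].
have := ler_norm (ln a); move: hw; rewrite /K; lra.
Qed.

(** A small value of the graph forces [L <= b j] at some time [j]. Chebyshev's inequality at [r]
    bounds each of these events, and the bounds are summed over [j]. *)
Lemma tail_upper (r C k : R) : 0 < r -> 0 < k -> 0 < C ->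
  (forall n, psums n r <= C * expR (- (k * n%:R))) ->
  exists2 C', 0 < C' & forall x,
    (lebesgue_measure (small_phi (expR (- x))) <= (C' * expR (- (r * x)))%:E)%E.
Proof.
move=> r0 k0 C0 hC.
have [d d0 hd] := log_weightP ml g_gt0 g_dist.
(* Then [r * eta = k / 2]: the loss in the lower bound for the graph uses up half of the decay rate
   [k], and the other half makes the series converge. *)
pose eta := k / (2 * r).
have eta0 : 0 < eta by rewrite divr_gt0// mulr_gt0.
have [rho /andP[rho0 rhoa] hrho] := fibre_ge_min a_gt0 hh eta eta0.
have k2 : 0 < k / 2 by rewrite divr_gt0.
have q1 : 0 < 1 - expR (- (k / 2)) by rewrite subr_gt0 -[ltRHS]expR0 ltr_expR oppr_lt0.
pose D := C * expR (r * (d - ln rho)).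
have D0 : 0 < D by rewrite mulr_gt0 ?expR_gt0.
exists (D / (1 - expR (- (k / 2)))); first exact: divr_gt0.
move=> x.
pose b j : R := eta * j%:R + d - ln rho - x.
pose W j : set T := \bigcup_(w in [set w : j.-tuple 'I_N.+1 | log_weight w <= b j]) word_cyl w.
pose Y j : set T := W j `|` @exceptional R S N p j.
have sub : small_phi (expR (- x)) `<=` \bigcup_j Y j.
  move=> v [cv /(phi_inf_lt a_gt0 hh S_circle g_pos v _ cv)[n hn]].
  have rr : 0 < rho <= a by rewrite rho0.
  have [j hj] := fiter_ge_gprod a_gt0 hh S_circle g_pos eta rho n v rr hrho cv.
  have {hn}hj := le_lt_trans hj hn; exists j => //.
  have [Ev|nEv] := pselect (@exceptional R S N p j v); [by right|left].
  have [w hw] := word_cyl_cover ml _ _ cv nEv.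
  exists w => //=; have gj := gprod_gt0 ml g_gt0 j v cv.
  move: hj; rewrite -ltr_ln ?posrE ?mulr_gt0 ?expR_gt0// !lnM ?posrE ?mulr_gt0 ?expR_gt0// !expRK.
  have := hd _ _ hw; rewrite size_tuple ler_norml => /andP[h1 h2].
  rewrite /b; lra.
apply: (le_trans (le_lebesgue _ _ _ sub)); apply: (le_trans (lebesgue_bigcup _ _)).
rewrite mulrAC; apply: nneseries_geometric_le => //.
- by rewrite mulr_ge0 ?expR_ge0// ltW.
move=> j.
have -> : lebesgue_measure (Y j) = lebesgue_measure (W j).
  have [mE eE] := exceptional_negligible ml j.
  apply: measureU0 => //; apply: fin_bigcup_measurable; first exact: finite_finset.
  by move=> w _; exact: (word_cyl_measurable ml).
rewrite words_measure lee_fin.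
apply: (@le_trans _ _ (expR (r * b j) * psums j r)).
  rewrite /psum mulr_sumr big_mkcond; apply: ler_sum => w _.
  have m0 := mass_ge0 ml w.
  case: ifP => [hw|_]; last by rewrite !mulr_ge0 ?expR_ge0.
  rewrite mulrCA ler_peMr// -expRD -[leLHS]expR0 ler_expR.
  by have := ler_wpM2l (ltW r0) hw; lra.
apply: (le_trans (ler_wpM2l (expR_ge0 _) (hC j))).
have -> : D * expR (- (r * x)) * expR (- (k / 2 * j%:R)) =
   C * (expR (r * (d - ln rho)) * expR (- (r * x)) * expR (- (k / 2 * j%:R))).
  by rewrite /D; ring.
rewrite mulrCA -!expRD ler_wpM2l ?(ltW C0)// ler_expR.
have e : r * eta = k / 2 by rewrite /eta; field; rewrite gt_eqF.
rewrite /b !mulrBr !mulrDr mulrA e; lra.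
Qed.

End Tail.

Lemma expanding_markov_lift (R : realType) (S : R -> R) (N : nat) (p : nat -> R) :
  expanding_markov S N p -> exists F F' c lam, markov_lift R S N p F F' c lam.
Proof.
move=> [Sc [plt pper] lift [mk mix] [c [lam [c0 lam1 ex]]]].
have [F hF] := choice lift; have [F' hF'] := choice hF.
exists F, F', c, lam.
have oI (k : 'I_N.+1) : open (`]p k, p k.+1[%classic : set R) by exact: interval_open.
split=> //.
- by move=> k t tk; have [[h _ _ _ _] _] := hF' k; exact: h.
- by move=> k t tk; have [[_ h _ _ _] _] := hF' k; exact: ((deriv_within_open _ _ _ _ (oI k)).1 h).
- move=> k t tk; have [[_ _ h _ _] _] := hF' k; move: h.
  by rewrite continuous_open_subspace//; apply; rewrite inE.
- by move=> k t tk; have [[_ _ _ h _] _] := hF' k; exact: h.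
- move=> k; have [[_ _ _ _ [q hq]] _] := hF' k; exists q => t tk.
  by have := hq (F k t); rewrite /= in_itv/=; apply; exists t.
- by move=> k; have [_ h] := hF' k.
Qed.

(** * From exponential bounds to logarithmic limits *)

Section Exponent.
Context {R : realType} {q : R -> \bar R} {s : R}.
Hypothesis s_gt0 : 0 < s.
Hypothesis q_lower : forall t, s < t -> exists x0, forall x, x0 <= x ->
  ((expR (- (t * x)))%:E <= q (expR (- x)))%E.
Hypothesis q_upper : forall r, 0 < r < s -> exists2 C, 0 < C &
  forall x, (q (expR (- x)) <= (C * expR (- (r * x)))%:E)%E.

Lemma log_ratio e : 0 < e -> exists x0, 0 < x0 /\ forall x, x0 <= x -> exists y,
  [/\ q (expR (- x)) = y%:E, 0 < y & `|ln y / x + s| <= e].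
Proof.
(* The maximum keeps [r] positive when [e] is large; half of [e] is left for the constant [C]. *)
move=> e0; pose r := Num.max (s / 2) (s - e / 2).
have r0 : 0 < r by rewrite lt_max divr_gt0.
have rs : r < s by rewrite gt_max; apply/andP; split; move: s_gt0; lra.
have re : s - e / 2 <= r by rewrite le_max lexx orbT.
have [x1 hx1] := q_lower (s + e) ltac:(lra).
have [|C C0 hC] := q_upper r; first by rewrite r0.
pose x0 := Num.max 1 (Num.max x1 (2 * `|ln C| / e)).
exists x0; split; first by rewrite lt_max ltr01.
move=> x; rewrite !ge_max => /and3P[x_1 xx1]; rewrite ler_pdivrMr// => xC.
have x_0 : 0 < x by lra.
have := hx1 _ xx1; have := hC x.
case: (q _) => [y||] //=; rewrite !lee_fin => h1 h2.
have y0 : 0 < y by apply: lt_le_trans h2; exact: expR_gt0.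
exists y; split => //.
have h3 : - ((s + e) * x) <= ln y by rewrite -[leLHS]expRK ler_ln ?posrE ?expR_gt0.
have h4 : ln y <= ln C - r * x.
  by rewrite -[- (r * x)]expRK -lnM ?posrE ?expR_gt0// ler_ln ?posrE ?mulr_gt0 ?expR_gt0.
have -> : ln y / x + s = (ln y + s * x) / x by field; rewrite gt_eqF.
rewrite normrM [`|x^-1|]ger0_norm ?invr_ge0 ?(ltW x_0)// ler_pdivrMr// ler_norml.
have := ler_norm (ln C); have := ler_wpM2r (ltW x_0) re.
by move=> ? ?; apply/andP; split; lra.
Qed.

Lemma log_ratio_pinfty :
  ((x^-1)%:E * lne (q (expR (- x))))%E @[x --> +oo] --> (- s)%:E.
Proof.
have [x0 [x00 hx0]] := log_ratio 1 ltr01.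
apply: cvg_EFin.
  near=> x; have [|y [-> y0 _]] := hx0 x; first by near: x; exact: (nbhs_pinfty_ge (num_real _)).
  by rewrite lne_EFin.
apply/cvgrPdist_le => e e0; have [x1 [x10 hx1]] := log_ratio e e0.
near=> x; have [|y [qy y0 hy]] := hx1 x; first by near: x; exact: (nbhs_pinfty_ge (num_real _)).
by rewrite /= qy lne_EFin//= -opprD normrN addrC mulrC.
Unshelve. all: by end_near. Qed.

Lemma log_ratio_right0 :
  (lne (q e) * ((ln e)^-1)%:E)%E @[e --> 0^'+] --> s%:E.
Proof.
have key d : 0 < d -> \forall e \near 0^'+, exists y,
    [/\ q e = y%:E, 0 < y & `|s - ln y / ln e| <= d].
  move=> d0; have [x0 [x00 hx0]] := log_ratio d d0.
  near=> e; have e0 : 0 < e by near: e; exact: nbhs_right_gt.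
  have ee : e <= expR (- x0).
    by near: e; apply: nbhs_right_le; exact: expR_gt0.
  have [|y [qy y0 hy]] := hx0 (- ln e).
    by rewrite lerNr -[leRHS]expRK ler_ln ?posrE ?expR_gt0.
  exists y; split => //; first by rewrite -qy opprK lnK ?posrE.
  by move: hy; rewrite invrN mulrN addrC.
apply: cvg_EFin.
  have := key 1 ltr01; apply: filterS => e [y [-> y0 _]].
  by rewrite lne_EFin.
apply/cvgrPdist_le => d d0; have := key d d0; apply: filterS => e [y [qy y0 hy]].
by rewrite /= qy lne_EFin.
Unshelve. all: by end_near. Qed.

End Exponent.

Theorem theorem1 (R : realType) (a : R) (h S g : R -> R) (N : nat)
    (p : nat -> R) (mu_ac : probability (measurableTypeR R) R) (s : R)
    (a_gt0 : 0 < a)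
    (hh : fibre_map a h)
    (hg : multiplier a h g)
    (hS : expanding_markov S N p)
    (hac : invariant_prob S mu_ac /\ mu_ac `<< lebesgue_measure)
    (hdist : bounded_distortion S g)
    (hgap : lyapunov_gap S g mu_ac)
    (hs : 0 < s /\ pressure S g N p s = 0%E) :
  ((x^-1)%:E * lne (lebesgue_measure
       [set v | circle R v /\ (lne (phi_inf a h S g v)%:E < (- x)%:E)%E]))%E
     @[x --> +oo] --> (- s)%:E
  /\
  (lne (lebesgue_measure [set v | circle R v /\ (phi_inf a h S g v < e)%R])
     * ((ln e)^-1)%:E)%E
     @[e --> 0^'+] --> s%:E.
Proof.
have [F [F' [c [lam ml]]]] := expanding_markov_lift R S N p hS.
have [g_meas g_pos] := hg.
have g_gt0 v : circle R v -> 0 < g v by move=> /g_pos[].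
have [s0 hp] := hs.
have ha : 0 < h a.
  have [mono _ _ h0 _] := hh; rewrite -h0; apply: mono => //.
    by rewrite in_itv/= lexx ltW.
  by rewrite in_itv/= lexx ltW.
have g_bounded : exists B, forall v, circle R v -> `|ln (g v)| <= B.
  (* That the fibre maps preserve [[0, a]] bounds [g] from above by [a / h a]. *)
  apply: (ln_g_bounded ml g_gt0 hdist (a / h a)) => v cv.
  by rewrite ler_pdivlMr//; have [] := g_pos v cv.
have [K [C [n0 qb]]] := quasi_bernoulli_mass ml g_gt0 hdist.
have drift := mass_drift ml g_gt0 g_meas hdist g_bounded
  mu_ac hac.1 hac.2 hgap.2.
have bdd := pressure_zero_bounded ml g_gt0 hdist g_bounded s (ltW s0) hp.
pose q e := lebesgue_measure (@small_phi R a h S g e).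
have q_lower t : s < t -> exists x0, forall x, x0 <= x ->
    ((expR (- (t * x)))%:E <= q (expR (- x)))%E.
  move=> st; apply: (tail_lower a_gt0 hh ml g_pos hdist s t).
    by rewrite s0.
  exact: (deviation_lower qb drift s s0 bdd).
have q_upper r : 0 < r < s -> exists2 C', 0 < C' &
    forall x, (q (expR (- x)) <= (C' * expR (- (r * x)))%:E)%E.
  move=> rs; have [C' [k [C'0 k0 hC']]] := psum_decay qb drift s s0 bdd r rs.
  have /andP[r0 _] := rs.
  exact: (tail_upper a_gt0 hh ml g_pos hdist r C' k r0 k0 C'0 hC').
split; last exact: (log_ratio_right0 s0 q_lower q_upper).
(* On zeros of the graph the logarithm is [-oo], so these points lie in both sets. *)
have -> : (fun x : R => (x^-1)%:E * lne (lebesgue_measure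
       [set v | circle R v /\ (lne (phi_inf a h S g v)%:E < (- x)%:E)%E]))%E =
    (fun x => (x^-1)%:E * lne (q (expR (- x))))%E.
  apply/funext => x; congr (_ * lne (lebesgue_measure _))%E.
  apply/seteqP; split=> v [cv h1]; split => //.
    have := phi_inf_ge0 a_gt0 hh (ml_circle ml) g_pos v cv.
    rewrite le_eqVlt => /predU1P[<-|phi0]; first exact: expR_gt0.
    by move: h1; rewrite lne_EFin// lte_fin -[in X in _ -> X](lnK phi0) ltr_expR.
  have := phi_inf_ge0 a_gt0 hh (ml_circle ml) g_pos v cv.
  rewrite le_eqVlt => /predU1P[<-|phi0]; first by rewrite le0_lneNy ?ltNyr.
  by rewrite lne_EFin// lte_fin -ltr_expR (lnK phi0).
exact: (log_ratio_pinfty s0 q_lower q_upper).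
Qed.
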